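(* Let $\sigma\colon(\mathcal M,L)\to(\mathcal B,\tilde L)$ be a pseudo-Finsler submersion such that for every $v\in\mathcal A$ the vertical space at $\pi(v)$ is $g_v$-non-degenerate. For each admissible $v$ at $p$, all vertical vectors $s',s,u,w$ at $p$ and all $g_v$-horizontal vectors $x,y,z,z'$ at $p$: \begin{align*} \{0\}\quad & g_v(R_v(w,u)s,s')=g_v(R^\top_v(w,u)s,s')+g_v(\mathbf T^v_ws,\mathbf T^v_us')-g_v(\mathbf T^v_us,\mathbf T^v_ws'),\\ \{1\}\quad & g_v(R_v(w,u)s,z)=g_v((\nabla_w\mathbf T)^v_us,z)-g_v((\nabla_u\mathbf T)^v_ws,z),\\ \{1'\}\quad & g_v(R_v(x,u)s,w)=g_v(R^\top_v(x,u)s,w)-g_v(\mathbf T^v_us,\mathbf A^v_xw)+g_v(\mathbf A^v_xs,\mathbf T^v_uw),\\ \{2\}\quad & g_v(R_v(x,u)s,z)=g_v((\nabla_x\mathbf T)^v_us,z)-g_v((\nabla_u\mathbf A)^v_xs,z)-g_v(\mathbf A^v_{\mathbf A^v_xu}s,z)-g_v(\mathbf T^v_ux,\mathbf T^v_sz),\\ \{2'\}\quad & g_v(R_v(x,y)s,w)=g_v(R^\top_v(x,y)s,w)-g_v(\mathbf A^v_ys,\mathbf A^v_xw)+g_v(\mathbf A^v_xs,\mathbf A^v_yw),\\ \{3\}\quad & g_v(R_v(x,y)s,z)=g_v((\nabla_x\mathbf A)^v_ys,z)-g_v((\nabla_y\mathbf A)^v_xs,z)-g_v(\mathbf A^v_yx,\mathbf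 T^v_sz)+g_v(\mathbf A^v_xy,\mathbf T^v_sz),\\ \{4\}\quad & g_v(R_v(x,y)z,z')=g_v(R^\bot_v(x,y)z,z')+g_v(\mathbf A^v_xz,\mathbf A^v_yz')-g_v(\mathbf A^v_yz,\mathbf A^v_xz'). \end{align*}
   Context: **Metrics.** A pseudo-Finsler metric on $\mathcal M$ (with projection $\pi\colon T\mathcal M\to\mathcal M$) is a smooth $L\colon\mathcal A\to\mathbb R$, $\mathcal A\subset T\mathcal M\setminus\mathbf 0$ open and invariant under positive scalar multiplication, with $L(\lambda v)=\lambda^2L(v)$ for $\lambda>0$ and with non-degenerate fundamental tensor $g_v(e,h)=\frac12\frac{\partial^2}{\partial s\partial t}L(v+se+th)|_{s=t=0}$, $v\in\mathcal A$, $e,h\in T_{\pi(v)}\mathcal M$. Elements of $\mathcal A$ are called admissible; a local vector field $V$ is admissible if it takes values in $\mathcal A$. **Anisotropic calculus.** An anisotropic tensor $T$ assigns smoothly to $v\in\mathcal A$ a tensor $T_v$ (or $T^v$) on $T_{\pi(v)}\mathcal M$; in particular an anisotropic vector field $\mathcal X$ assigns $\mathcal X_v\in T_{\pi(v)}\mathcal M$. $T_V$ is the ordinary tensor $(T_V)_q=T_{V_q}$. Fiber derivative: $(\dot\partial T)_v(e)=\frac{d}{dt}T_{v+te}|_{t=0}$. An anisotropic connection assigns to vector fields $E,H$ an anisotropic vector field $\nabla_EH$, $v\mapsto\nabla^v_EH$, $C^\infty$-linear in $E$, additive and satisfying the Leibniz rule in $H$. For anisotropic vector fields $\nabla^v_e\mathcal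 X=\nabla^v_e(\mathcal X_V)-(\dot\partial\mathcal X)_v(\nabla^v_eV)$, and for functions $f$ on $\mathcal A$, $(\nabla_ef)(v)=e(f(V))-(\dot\partial f)_v(\nabla^v_eV)$, for any admissible local extension $V$ of $v$ (independent of the choice); covariant derivatives of other anisotropic tensors are defined by the product rule. The Levi-Civita–Chern connection $\nabla$ of $(\mathcal M,L)$ is the unique anisotropic connection with $\nabla^v_EH-\nabla^v_HE=[E,H]_{\pi(v)}$ and $\nabla g=0$. Its curvature is $R_v(E,H)B=\nabla^v_E\nabla_HB-\nabla^v_H\nabla_EB-\nabla^v_{[E,H]}B$. **Submersions.** Let $\sigma\colon\mathcal M\to\mathcal B$ be a surjective map with surjective differential, $\mathcal V_p=\ker d\sigma_p$ (vertical vectors). An admissible $v\in T_p\mathcal M$ is horizontal if $g_v(v,w)=0$ for all $w\in\mathcal V_p$. $\sigma\colon(\mathcal M,L)\to(\mathcal B,\tilde L)$ is a pseudo-Finsler submersion if the restriction of $L$ to the tangent spaces of the fibers is a pseudo-Finsler metric on each fiber, and $L(v)=\tilde L(d\sigma(v))$ for every horizontal $v$. A vector $x\in T_p\mathcal M$ is $g_v$-horizontal if it is $g_v$-orthogonal to $\mathcal V_p$. **O'Neill tensors.** For admissible $v\in T_p\mathcal M$, write $e=e^\top_v+e^\bot_v$ with $e^\top_v\in\mathcal V_p$ and $e^\bot_v$ $g_v$-horizontal. For an (anisotropic) vector field $E$, $E^\top,E^\bot$ are the anisotropic vector fields $v\mapsto (E_v)^\top_v$, $v\mapsto (E_v)^\bot_v$.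 Put $\chi^v_he=(\nabla^v_hE^\bot)^\top_v+(\nabla^v_hE^\top)^\bot_v$ for any extension $E$ of $e$ (tensorial), and $\mathbf T^v_be=\chi^v_{b^\top_v}e$, $\mathbf A^v_be=\chi^v_{b^\bot_v}e$. **Vertical and horizontal curvature.** For $b,e,h\in T_p\mathcal M$ with extensions $B,E,H$, $R^\top_v(b,e)h=\big(\nabla^v_b(\nabla_EH^\top)^\top-\nabla^v_e(\nabla_BH^\top)^\top-\nabla^v_{[B,E]}H^\top\big)^\top_v$ and $R^\bot_v(b,e)h=\big(\nabla^v_b(\nabla_EH^\bot)^\bot-\nabla^v_e(\nabla_BH^\bot)^\bot-\nabla^v_{[B,E]}H^\bot\big)^\bot_v$; these are anisotropic tensors. *)

(* Defs.v *)
From HB Require Import structures.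
From mathcomp Require Import all_boot all_order all_algebra.
From mathcomp Require Import all_classical all_reals all_analysis.

Set Implicit Arguments.
Unset Strict Implicit.
Unset Printing Implicit Defensive.

Import Order.TTheory GRing.Theory Num.Theory.
Import numFieldNormedType.Exports.

Local Open Scope classical_set_scope.
Local Open Scope ring_scope.

Section Smooth.
Context {R : realType} {V W : normedModType R}.

(* Used only for open U and finite-dimensional V, where f is C^(k+1) on U iff
   it is differentiable on U and all its directional derivatives are C^k. *)
Fixpoint Ck (k : nat) (U : set V) (f : V -> W) : Prop :=
  match k with
  | 0 => forall x, U x -> {for x, continuous f}
  | k'.+1 => (forall x, U x -> differentiable f x) /\
             (forall v : V, Ck k' U (fun x => 'd f x v))
  end.

Definition smooth_on (U : set V) (f : V -> W) : Prop := forall k, Ck k U f.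

End Smooth.

(* An n-dimensional smooth manifold without boundary.  [cinv i] is a total
   function, only meaningful on the open set [cmap i @` cdom i].  As part of the
   data, each point p has a preferred chart [chart_at p] around it. *)
Record manifold (R : realType) (n : nat) := Manifold {
  mcarrier :> topologicalType;
  chart : Type;
  cdom : chart -> set mcarrier;
  cmap : chart -> mcarrier -> 'rV[R]_n;
  cinv : chart -> 'rV[R]_n -> mcarrier;
  chart_at : mcarrier -> chart;
  cdom_chart_at : forall p, cdom (chart_at p) p;
  open_cdom : forall i, open (cdom i);
  open_cimage : forall i, open (cmap i @` cdom i);
  cmapK : forall i p, cdom i p -> cinv i (cmap i p) = p;
  cmap_continuous : forall i p, cdom i p -> {for p, continuous (cmap i)};
  cinv_continuous : forall i p, cdom i p -> {for cmap i p, continuous (cinv i)};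
  transition_smooth : forall i j,
    smooth_on (cmap i @` (cdom i `&` cdom j)) (cmap j \o cinv i);
  manifold_hausdorff : hausdorff_space mcarrier;
  manifold_second_countable : @second_countable mcarrier }.

Arguments chart {R n} m.
Arguments cdom {R n m} i.
Arguments cmap {R n m} i.
Arguments cinv {R n m} i.
Arguments chart_at {R n m} p.

(* T_p M: a tangent vector at p is represented by its components in the
   preferred chart at p. *)
Definition tangent {R : realType} {n : nat} {M : manifold R n} (p : M) :
  normedModType R := 'rV[R]_n.

Section Fields.
Context {R : realType} {n : nat} {M : manifold R n}.

Definition vfield := forall p : M, tangent p.
Definition avfield := forall p : M, tangent p -> tangent p.
(* S p v b e is S^v_b e *)
Definition atensor := forall p : M, tangent p -> tangent p -> tangent p -> tangent p.

Definition pos (p : M) : 'rV[R]_n := cmap (chart_at p) p.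

(* From a vector at p to its components in the chart i, and back. *)
Definition tcoord (i : chart M) (p : M) (v : tangent p) : 'rV[R]_n :=
  'd (cmap i \o cinv (chart_at p)) (pos p) v.
Definition tvect (i : chart M) (p : M) (w : 'rV[R]_n) : tangent p :=
  'd (cmap (chart_at p) \o cinv i) (cmap i p) w.

Definition smooth_fun (U : set M) (f : M -> R) : Prop :=
  forall i : chart M, smooth_on (cmap i @` (U `&` cdom i)) (f \o cinv i).

Definition smooth_vfield (U : set M) (X : vfield) : Prop :=
  forall i : chart M,
    smooth_on (cmap i @` (U `&` cdom i)) (fun x => tcoord i (X (cinv i x))).

(* The part of D, a subset of TM, over the domain of the chart i, read in the
   chart of TM induced by i. *)
Definition timage (i : chart M) (D : forall p : M, set (tangent p)) :
    set ('rV[R]_n * 'rV[R]_n)%type :=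
  [set xw | (cmap i @` cdom i) xw.1 /\ D (cinv i xw.1) (tvect i _ xw.2)].

Definition open_tangent (D : forall p : M, set (tangent p)) : Prop :=
  forall i : chart M, open (timage i D).

Definition smooth_tfun (D : forall p : M, set (tangent p))
    (f : forall p : M, tangent p -> R) : Prop :=
  forall i : chart M, smooth_on (timage i D)
    (fun xw => f (cinv i xw.1) (tvect i _ xw.2)).

Definition smooth_avfield (D : forall p : M, set (tangent p)) (X : avfield) : Prop :=
  forall i : chart M, smooth_on (timage i D)
    (fun xw => tcoord i (X (cinv i xw.1) (tvect i _ xw.2))).

(* e(f) *)
Definition dfun (f : M -> R) (p : M) (e : tangent p) : R :=
  'd (f \o cinv (chart_at p)) (pos p) e.

(* The local extension of e in T_p M with constant components in the preferred
   chart at p; it is smooth on the domain of that chart and only meaningful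
   there.  It is used wherever "any local extension" is called for. *)
Definition ext (p : M) (e : tangent p) : vfield := fun q => tvect (chart_at p) q e.

(* [E, H] = DH(E) - DE(H) in the preferred chart *)
Definition bracket (E H : vfield) : vfield := fun p =>
  let comp (X : vfield) x := tcoord (chart_at p) (X (cinv (chart_at p) x)) in
  'd (comp H) (pos p) (E p) - 'd (comp E) (pos p) (H p).

Definition aniso (E : vfield) : avfield := fun p _ => E p.

End Fields.

Arguments vfield {R n} M.
Arguments avfield {R n} M.
Arguments atensor {R n} M.

Section Maps.
Context {R : realType} {m n : nat} {M : manifold R m} {N : manifold R n}.

Definition smooth_map (f : M -> N) : Prop :=
  continuous f /\
  forall (i : chart M) (j : chart N),
    smooth_on (cmap i @` (cdom i `&` f @^-1` cdom j)) (cmap j \o f \o cinv i).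

Definition tmap (f : M -> N) (p : M) (v : tangent p) : tangent (f p) :=
  'd (cmap (chart_at (f p)) \o f \o cinv (chart_at p)) (pos p) v.

Definition embedding (f : M -> N) : Prop :=
  [/\ smooth_map f,
      injective f,
      forall p, injective (@tmap f p) &
      forall O : set M, open O ->
        exists2 O' : set N, open O' & f @` O = range f `&` O'].

End Maps.

Section Metric.
Context {R : realType} {n : nat} {M : manifold R n}.
Variables (A : forall p : M, set (tangent p)) (L : forall p : M, tangent p -> R).
Arguments A : clear implicits.
Arguments L : clear implicits.

(* g_v(e, h) *)
Definition fundamental (p : M) (v e h : tangent p) : R :=
  2^-1 * derive1 (fun s : R => derive1 (fun t : R => L p (v + s *: e + t *: h)) 0) 0.

Record pseudo_finsler : Prop := PseudoFinsler {
  pf_open : open_tangent A;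
  pf_nonzero : forall p : M, ~ A p 0;
  pf_conic : forall (p : M) (v : tangent p) (a : R), 0 < a -> A p v -> A p (a *: v);
  pf_smooth : smooth_tfun A L;
  pf_homogeneous : forall (p : M) (v : tangent p) (a : R),
    0 < a -> A p v -> L p (a *: v) = a ^+ 2 * L p v;
  pf_nondegenerate : forall (p : M) (v : tangent p), A p v ->
    forall e : tangent p, (forall h, fundamental v e h = 0) -> e = 0 }.

End Metric.

Section Connection.
Context {R : realType} {n : nat} {M : manifold R n}.
Variables (A : forall p : M, set (tangent p)) (L : forall p : M, tangent p -> R).
Arguments A : clear implicits.
Arguments L : clear implicits.

(* nab E H p v is nabla^v_E H, for v in T_p M and for vector fields E and H
   which only have to be smooth near p. *)
Variable nab : vfield M -> vfield M -> avfield M.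
Arguments nab : clear implicits.

Record anisotropic_connection : Prop := AnisotropicConnection {
  ac_smooth : forall (U : set M) (E H : vfield M), open U ->
    smooth_vfield U E -> smooth_vfield U H ->
    smooth_avfield (fun p => [set v : tangent p | U p /\ A p v]) (nab E H);
  ac_local : forall (U : set M) (E E' H H' : vfield M), open U ->
    smooth_vfield U E -> smooth_vfield U H ->
    (forall q, U q -> E' q = E q) -> (forall q, U q -> H' q = H q) ->
    forall (p : M) (v : tangent p), U p -> A p v -> nab E' H' p v = nab E H p v;
  ac_addl : forall (U : set M) (E E' H : vfield M), open U ->
    smooth_vfield U E -> smooth_vfield U E' -> smooth_vfield U H ->
    forall (p : M) (v : tangent p), U p -> A p v ->
    nab (fun q => E q + E' q) H p v = nab E H p v + nab E' H p v;
  ac_scalel : forall (U : set M) (f : M -> R) (E H : vfield M), open U ->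
    smooth_fun U f -> smooth_vfield U E -> smooth_vfield U H ->
    forall (p : M) (v : tangent p), U p -> A p v ->
    nab (fun q => f q *: E q) H p v = f p *: nab E H p v;
  ac_addr : forall (U : set M) (E H H' : vfield M), open U ->
    smooth_vfield U E -> smooth_vfield U H -> smooth_vfield U H' ->
    forall (p : M) (v : tangent p), U p -> A p v ->
    nab E (fun q => H q + H' q) p v = nab E H p v + nab E H' p v;
  ac_leibniz : forall (U : set M) (f : M -> R) (E H : vfield M), open U ->
    smooth_fun U f -> smooth_vfield U E -> smooth_vfield U H ->
    forall (p : M) (v : tangent p), U p -> A p v ->
    nab E (fun q => f q *: H q) p v = dfun f (E p) *: H p + f p *: nab E H p v }.

(* Covariant derivatives of a function on A, of an anisotropic vector field, of
   the fundamental tensor and of an anisotropic (1,2)-tensor. *)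
Definition nabla_fun (E : vfield M) (f : forall p : M, tangent p -> R)
    (p : M) (v : tangent p) : R :=
  dfun (fun q => f q (ext v q)) (E p) - 'D_(nab E (ext v) p v) (f p) v.

Definition nabla_av (E : vfield M) (X : avfield M) : avfield M := fun p v =>
  nab E (fun q => X q (ext v q)) p v - 'D_(nab E (ext v) p v) (X p) v.
Arguments nabla_av : clear implicits.

Definition nabla_g (p : M) (v e x y : tangent p) : R :=
  nabla_fun (ext e) (fun q (w : tangent q) => fundamental L w (ext x q) (ext y q)) v
  - fundamental L v (nab (ext e) (ext x) p v) y
  - fundamental L v x (nab (ext e) (ext y) p v).

Definition nabla_tensor (S : atensor M) (p : M) (v w u s : tangent p) : tangent p :=
  nabla_av (ext w) (fun q (z : tangent q) => S q z (ext u q) (ext s q)) p v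
  - S p v (nab (ext w) (ext u) p v) s
  - S p v u (nab (ext w) (ext s) p v).

Record levi_civita_chern : Prop := LeviCivitaChern {
  lcc_connection : anisotropic_connection;
  lcc_torsion_free : forall (U : set M) (E H : vfield M), open U ->
    smooth_vfield U E -> smooth_vfield U H ->
    forall (p : M) (v : tangent p), U p -> A p v ->
    nab E H p v - nab H E p v = bracket E H p;
  lcc_metric : forall (p : M) (v e x y : tangent p), A p v ->
    nabla_g v e x y = 0 }.

Definition curv (p : M) (v e h b : tangent p) : tangent p :=
  let E := ext e in let H := ext h in let B := ext b in
  nabla_av E (nab H B) p v - nabla_av H (nab E B) p v - nab (bracket E H) B p v.

End Connection.

Arguments nabla_av {R n M} nab E X p v.

Section Submersion.
Context {R : realType} {m n : nat} {M : manifold R m} {B : manifold R n}.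
Variables (A : forall p : M, set (tangent p)) (L : forall p : M, tangent p -> R).
Arguments A : clear implicits.
Arguments L : clear implicits.
Variables (AB : forall p : B, set (tangent p)) (LB : forall p : B, tangent p -> R).
Arguments AB : clear implicits.
Arguments LB : clear implicits.
Variable sigma : M -> B.

Definition vertical (p : M) : set (tangent p) := [set w | tmap sigma w = 0].

(* x is g_v-horizontal; v itself is horizontal iff it is g_v-horizontal. *)
Definition ghorizontal (p : M) (v x : tangent p) : Prop :=
  forall w : tangent p, vertical w -> fundamental L v x w = 0.

(* The fiber of sigma over b as an embedded submanifold of M. *)
Definition is_fiber (b : B) (F : manifold R (m - n)) (iota : F -> M) : Prop :=
  embedding iota /\ range iota = sigma @^-1` [set b].

Record finsler_submersion : Prop := FinslerSubmersion {
  fs_total : pseudo_finsler A L;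
  fs_base : pseudo_finsler AB LB;
  fs_smooth : smooth_map sigma;
  fs_surj : forall b : B, exists p : M, sigma p = b;
  fs_dsurj : forall (p : M) (w : tangent (sigma p)),
    exists v : tangent p, tmap sigma v = w;
  fs_fiber : forall (b : B) (F : manifold R (m - n)) (iota : F -> M),
    is_fiber b iota ->
    pseudo_finsler (fun q => [set v : tangent q | A (iota q) (tmap iota v)])
                   (fun q v => L (iota q) (tmap iota v));
  (* membership in AB is what makes LB (tmap sigma v) meaningful *)
  fs_isometric : forall (p : M) (v : tangent p), A p v -> ghorizontal v v ->
    AB (sigma p) (tmap sigma v) /\ L p v = LB (sigma p) (tmap sigma v) }.

Definition vertical_nondegenerate (p : M) (v : tangent p) : Prop :=
  forall w : tangent p, vertical w ->
    (forall u, vertical u -> fundamental L v w u = 0) -> w = 0.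

(* The unique decomposition e = vpart v e + hpart v e, provided that the
   vertical space is g_v-non-degenerate. *)
Definition vpart (p : M) (v e : tangent p) : tangent p :=
  xget 0 [set w | vertical w /\ ghorizontal v (e - w)].
Definition hpart (p : M) (v e : tangent p) : tangent p := e - vpart v e.

Definition vtop (X : avfield M) : avfield M := fun p v => vpart v (X p v).
Definition hbot (X : avfield M) : avfield M := fun p v => hpart v (X p v).

Variable nab : vfield M -> vfield M -> avfield M.
Arguments nab : clear implicits.

Definition oneill_chi : atensor M := fun p v h e =>
  vpart v (nabla_av nab (ext h) (hbot (aniso (ext e))) p v)
  + hpart v (nabla_av nab (ext h) (vtop (aniso (ext e))) p v).

Arguments oneill_chi : clear implicits.

Definition oneill_T : atensor M := fun p v b e => oneill_chi p v (vpart v b) e.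
Definition oneill_A : atensor M := fun p v b e => oneill_chi p v (hpart v b) e.

(* The curvature-like tensor of the connection P(nabla) induced on the image of
   the projection P, for P = vtop or P = hbot. *)
Definition proj_curv (P : avfield M -> avfield M) (p : M) (v b e h : tangent p) :
    tangent p :=
  let B := ext b in let E := ext e in let H := aniso (ext h) in
  let D := nabla_av nab in
  P (fun q (w : tangent q) =>
       D B (P (D E (P H))) q w - D E (P (D B (P H))) q w
       - D (bracket B E) (P H) q w) p v.

Definition curv_top := proj_curv vtop.
Definition curv_bot := proj_curv hbot.

End Submersion.

(* Main.v *)
(* In the chart of TM induced by the preferred chart at p, an anisotropic vector
   field is a function X(x, w) on an open set of R^m x R^m and
     nabla_e X = delta_e X + Gamma_e X,
   where delta_e is the derivative along the horizontal lift (e, - Gamma_e w).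
   For constant e and h one has [delta_e, delta_h] F = - d_w F (R(e, h) w), so that
   [nabla_e, nabla_h] is the curvature corrected by a fibre derivative.

   Let P(x, w) be the g-orthogonal projection on the vertical space, Q = 1 - P and
   P_e = nabla_e P.  Differentiating P P = P gives P P_e P = Q P_e Q = 0, and then
   chi_e = P_e P - P P_e as operators.  For s in the image of P,
     R^top(e, h) s = P R(e, h) s + P_e P_h s - P_h P_e s,
   and the same holds for R^bot with Q; since P_e is g-self-adjoint these are {0},
   {1'}, {2'} and {4}.  Commuting two covariant derivatives of P gives
     Q R(e, h) s = Q ((nabla_e chi)_h s - (nabla_h chi)_e s).
   Since T_u = chi_(P u) and A_u = chi_(Q u), the derivatives of T and A differ from
   those of chi by chi_(P_e u), up to sign, and {1}, {2}, {3} follow from T_u s = T_s u on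
   vertical vectors and the skew-symmetry of chi.  The fibre derivative of P drops
   out everywhere because the vertical space does not depend on w, and because
   P P' P = 0 for any derivative P' of an idempotent P. *)

(* A tangent vector at q is stored by its components in the preferred chart at q, so [ext],
   [nabla_av] and [oneill_chi] change chart with the point. Everything is therefore carried to the
   single chart chosen at p, where [hat] turns an anisotropic field into a function on an open set
   of R^m x R^m; that the chart of the auxiliary extension is immaterial is [tcoord_nabla_av]. The
   projection [vpart] is defined by choice and shows no regularity, which comes from the explicit
   matrix [vertical_mx]. Differentiation ends once the values at the given v are taken. From there
   P, its covariant derivatives, the curvature and the derivatives of chi are plain matrices tied by
   a few identities, and the seven equations are algebra in them ([oneill_pointwise]). As vectors
   are rows, operators compose from left to right: the correction P_e P_h - P_h P_e of the projected
   curvature reads [D h *m D e - D e *m D h]. *)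
Require Import Defs.
From HB Require Import structures.
From mathcomp Require Import all_boot all_order all_algebra.
From mathcomp Require Import all_classical all_reals all_analysis.
From mathcomp Require Import ring.
Set Implicit Arguments.
Unset Strict Implicit.
Unset Printing Implicit Defensive.
Import Order.TTheory GRing.Theory Num.Theory.
Import numFieldNormedType.Exports.
Local Open Scope classical_set_scope.
Local Open Scope ring_scope.

(** * Differentials and the classes Ck *)

Section DiffRules.
Context {R : realType}.
Implicit Types U V W : normedModType R.

(** The basis of locality: [is_diff_near] adds the locally zero function [g - f] to [f], so
    additivity of the differential finishes it. *)
Lemma is_diff_near0 V W (h : V -> W) (x : V) :
  (\forall y \near x, h y = 0) -> is_diff x h 0.
Proof.
move=> h0.
have hx : h x = 0 by apply: nbhs_singleton h0.
have c0 : continuous (\0 : V -> W) by move=> y; exact: cvg_cst.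
have ho : h \o shift x = cst (h x) + (\0 : {linear V -> W}) +o_ 0 id.
  apply/eqaddoP => e e0.
  have : \forall y \near (0 : V), h (y + x) = 0.
    by move: h0; rewrite (near_shift 0) /= subr0; apply.
  apply: filterS => y hy.
  rewrite /= !fctE /= hx hy addr0 subr0 normr0.
  by rewrite mulr_ge0// ltW.
have d0 := diff_unique c0 ho.
by split=> //; apply/diff_locallyP; rewrite d0.
Qed.

Lemma is_diff_near V W (f g df : V -> W) (x : V) :
  (\forall y \near x, f y = g y) -> is_diff x f df -> is_diff x g df.
Proof.
move=> fg dfx.
have : is_diff x (f + (g - f)) (df + 0).
  apply: is_diffD dfx _; apply: is_diff_near0.
  by apply: filterS fg => y fgy; rewrite !fctE fgy subrr.
by rewrite addr0 addrC subrK.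
Qed.

Lemma differentiable_near V W (f g : V -> W) (x : V) :
  (\forall y \near x, f y = g y) -> differentiable f x -> differentiable g x.
Proof. by move=> fg /differentiableP/(is_diff_near fg)/@ex_diff. Qed.

Lemma diff_near V W (f g : V -> W) (x v : V) :
  (\forall y \near x, f y = g y) -> differentiable f x -> 'd f x v = 'd g x v.
Proof.
by move=> fg /differentiableP/(is_diff_near fg) h; rewrite (@diff_val _ _ _ _ _ _ _ h).
Qed.

Lemma is_diff_const V W (a : W) (x : V) : is_diff x (fun _ => a) (fun _ => 0).
Proof. exact: is_diff_cst. Qed.

Lemma is_diff_add V W (f df g dg : V -> W) (x : V) :
  is_diff x f df -> is_diff x g dg ->
  is_diff x (fun y => f y + g y) (fun v => df v + dg v).
Proof. exact: is_diffD. Qed.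

Lemma is_diff_opp V W (f df : V -> W) (x : V) :
  is_diff x f df -> is_diff x (fun y => - f y) (fun v => - df v).
Proof. exact: is_diffN. Qed.

Lemma is_diff_sub V W (f df g dg : V -> W) (x : V) :
  is_diff x f df -> is_diff x g dg ->
  is_diff x (fun y => f y - g y) (fun v => df v - dg v).
Proof. exact: is_diffB. Qed.

Lemma is_diff_inv V (f df : V -> R) (x : V) : f x != 0 ->
  is_diff x f df -> is_diff x (fun y => (f y)^-1) (fun v => - (f x) ^- 2 * df v).
Proof.
move=> f0 [d e]; split; first exact: differentiableV.
by rewrite diffV // e.
Qed.

Lemma is_diff_bilin U V V' W (B : {bilinear V -> V' -> W})
    (f df : U -> V) (g dg : U -> V') (x : U) :
  continuous (fun p => B p.1 p.2) ->
  is_diff x f df -> is_diff x g dg ->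
  is_diff x (fun y => B (f y) (g y)) (fun v => B (df v) (g x) + B (f x) (dg v)).
Proof.
move=> cB dfx dgx.
have dB : is_diff (f x, g x) (fun q => B q.1 q.2)
    (fun q => B (f x) q.2 + B q.1 (g x)).
  by split; [exact: differentiable_bilin|rewrite diff_bilin].
have [d e] := is_diff_comp (is_diff_pair dfx dgx) dB.
by split=> //; rewrite e; apply/funext => v /=; rewrite addrC.
Qed.

Lemma is_diff_linear V W (f : V -> W) (x : V) :
  linear f -> continuous f -> is_diff x f f.
Proof.
move=> lf cf.
pose fM := GRing.isLinear.Build _ _ _ _ _ lf.
pose fL : {linear _ -> _} := HB.pack f fM.
by split; [exact: (@linear_differentiable _ _ _ fL)|exact: (@diff_lin _ _ _ fL)].
Qed.

Lemma is_diff_linear_comp U V W (l : V -> W) (f df : U -> V) x :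
  linear l -> continuous l ->
  is_diff x f df -> is_diff x (fun y => l (f y)) (fun v => l (df v)).
Proof. by move=> ll cl dfx; apply: is_diff_comp dfx (is_diff_linear _ ll cl). Qed.

End DiffRules.

Section ScaleBilinear.
Context {R : realType} (W : normedModType R).

(** Makes scaling an instance of the general product rules [is_diff_bilin] and [Ck_bilin]. *)
Lemma scale_is_bilinear : bilinear_for
    (GRing.Scale.Law.clone _ _ *:%R _) (GRing.Scale.Law.clone _ _ *:%R _)
    ( *:%R : R -> W -> W).
Proof.
split=> [u'|u] a x y /=; first by rewrite scalerDl scalerA.
by rewrite scalerDr !scalerA mulrC.
Qed.

HB.instance Definition _ := bilinear_isBilinear.Build R R W W _ _
  ( *:%R : R -> W -> W) scale_is_bilinear.

End ScaleBilinear.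

Section MatrixDiff.
Context {R : realType}.
Implicit Types U V W : normedModType R.

Lemma continuous_sum (T : topologicalType) W n (f : 'I_n -> T -> W) (x : T) :
  (forall i, {for x, continuous (f i)}) ->
  {for x, continuous (fun y => \sum_i f i y)}.
Proof.
move=> cf; apply: (@cvg_big _ _ _ _ _ _ _ _ _ f (fun i => f i x)) => [|i _].
  exact: add_continuous.
exact: cf.
Qed.

Lemma continuous_mx (T : topologicalType) m n (f : T -> 'M[R]_(m, n)) (x : T) :
  (forall i j, {for x, continuous (fun y => f y i j)}) -> {for x, continuous f}.
Proof.
move=> cf.
have -> : f = fun y => \sum_(i < m) \sum_(j < n) f y i j *: delta_mx i j.
  by apply/funext => y; exact: matrix_sum_delta.
apply: continuous_sum => i; apply: continuous_sum => j.
exact: (cvgZr_tmp (cf i j)).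
Qed.

Lemma mulmx_continuous m n p :
  continuous (fun q : 'M[R]_(m, n) * 'M[R]_(n, p) => q.1 *m q.2).
Proof.
move=> q; apply: continuous_mx => i j.
rewrite (_ : (fun _ => _) = fun y : 'M[R]_(m, n) * 'M[R]_(n, p) =>
  \sum_k y.1 i k * y.2 k j); last by apply/funext => y; rewrite mxE.
apply: continuous_sum => k; apply: continuousM.
  exact: (continuous_comp cvg_fst (@coord_continuous _ _ _ _ _ _)).
exact: (continuous_comp cvg_snd (@coord_continuous _ _ _ _ _ _)).
Qed.

Lemma is_diff_mulmx U m n p (f df : U -> 'M[R]_(m, n)) (g dg : U -> 'M[R]_(n, p)) x :
  is_diff x f df -> is_diff x g dg ->
  is_diff x (fun y => f y *m g y) (fun v => df v *m g x + f x *m dg v).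
Proof. exact/is_diff_bilin/mulmx_continuous. Qed.

Lemma is_diff_scale U W (f df : U -> R) (g dg : U -> W) x :
  is_diff x f df -> is_diff x g dg ->
  is_diff x (fun y => f y *: g y) (fun v => df v *: g x + f x *: dg v).
Proof. by apply: is_diff_bilin => q; apply: scale_continuous. Qed.

Lemma linear_mx_continuous W m n (f : 'M[R]_(m, n) -> W) : linear f -> continuous f.
Proof.
move=> lf x.
pose fM := GRing.isLinear.Build _ _ _ _ _ lf.
pose fL : {linear _ -> _} := HB.pack f fM.
rewrite (_ : f = fun y => \sum_(i < m) \sum_(j < n) y i j *: f (delta_mx i j)); last first.
  apply/funext => y; rewrite {1}[y]matrix_sum_delta.
  rewrite -[LHS]/(fL _) linear_sum.
  apply: eq_bigr => i _; rewrite linear_sum; apply: eq_bigr => j _.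
  by rewrite linearZ.
apply: continuous_sum => i; apply: continuous_sum => j.
exact: (cvgZr_tmp (@coord_continuous _ _ _ i j x)).
Qed.

End MatrixDiff.

Section FinDim.
Context {R : realType}.
Implicit Types U V W : normedModType R.

(** [Ck] only controls derivatives in constant directions. A derivative in a moving direction is
    expanded on the fixed vectors [b i], with coefficients that inherit regularity from the
    continuous linear map [c]. *)
Definition fin_dim V := exists n (b : 'I_n -> V) (c : V -> 'rV[R]_n),
  [/\ linear c, continuous c & forall v, v = \sum_i c v 0 i *: b i].

Lemma fin_dim_rV n : fin_dim 'rV[R]_n.
Proof.
exists n, (delta_mx 0), id; split=> // [x|v]; first exact: cvg_id.
exact: row_sum_delta.
Qed.

Lemma fin_dim_pair V W : fin_dim V -> fin_dim W -> fin_dim (V * W)%type.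
Proof.
move=> [n1 [b1 [c1 [l1 k1 e1]]]] [n2 [b2 [c2 [l2 k2 e2]]]].
exists (n1 + n2)%N, (fun i => match fintype.split i with
  inl j => (b1 j, 0) | inr j => (0, b2 j) end), (fun z => row_mx (c1 z.1) (c2 z.2)).
split.
- by move=> a x y; rewrite /= l1 l2 -add_row_mx scale_row_mx.
- move=> z; apply: continuous_mx => i j; case: (fintype.splitP j) => k jk.
    rewrite (_ : (fun _ => _) = fun y : V * W => c1 y.1 i k).
      have cc : {for z.1, continuous (fun a : V => c1 a i k)}.
        exact: (continuous_comp (k1 _) (@coord_continuous _ _ _ _ _ _)).
      exact: (continuous_comp cvg_fst cc).
    by apply/funext => y; rewrite -(row_mxEl (c1 y.1) (c2 y.2)); congr (row_mx _ _ i _); apply/val_inj.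
  rewrite (_ : (fun _ => _) = fun y : V * W => c2 y.2 i k).
    have cc : {for z.2, continuous (fun a : W => c2 a i k)}.
      exact: (continuous_comp (k2 _) (@coord_continuous _ _ _ _ _ _)).
    exact: (continuous_comp cvg_snd cc).
  by apply/funext => y; rewrite -(row_mxEr (c1 y.1) (c2 y.2)); congr (row_mx _ _ i _); apply/val_inj.
- move=> [v w]; rewrite big_split_ord /=.
  have -> : (v, w) = (v, 0) + (0, w) by rewrite -[RHS]/(v + 0, 0 + w) addr0 add0r.
  congr (_ + _).
    have H (F : 'I_n1 -> V) : (\sum_i F i, 0 : W) = \sum_i (F i, 0).
      apply: (big_morph (fun v => (v, 0 : W))) => // x y.
      by rewrite -[RHS]/(_ + _, _ + _) /= addr0.
    rewrite {1}(e1 v) H.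
    apply: eq_bigr => i _.
    rewrite row_mxEl; case: (fintype.splitP (lshift n2 i)) => k /= ik; last first.
      by have := ltn_ord i; rewrite ik ltnNge leq_addr.
    by have -> : i = k by [apply/val_inj]; rewrite -[RHS]/(_ *: _, _ *: _) scaler0.
  have H (F : 'I_n2 -> W) : (0 : V, \sum_i F i) = \sum_i (0, F i).
    apply: (big_morph (fun w => (0 : V, w))) => // x y.
    by rewrite -[RHS]/(_ + _, _ + _) /= addr0.
  rewrite {1}(e2 w) H.
  apply: eq_bigr => i _.
  rewrite row_mxEr; case: (fintype.splitP (rshift n1 i)) => k /= ik.
    by have := ltn_ord k; rewrite -ik ltnNge leq_addr.
  have -> : i = k by apply/val_inj; move/addnI: ik.
  by rewrite -[RHS]/(_ *: _, _ *: _) scaler0.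
Qed.

End FinDim.

(** * Closure of the classes Ck under algebraic operations and composition *)

Section CkCalculus.
Context {R : realType}.
Implicit Types U V W : normedModType R.

Lemma Ck_cts k V W (D : set V) (f : V -> W) x : Ck k D f -> D x -> {for x, continuous f}.
Proof.
case: k => [|k] /= => [h|[h _]] Dx; first exact: h.
exact/differentiable_continuous/h.
Qed.

Lemma CkS k V W (D : set V) (f : V -> W) : Ck k.+1 D f -> Ck k D f.
Proof.
elim: k f => [|k IH] f; first by move=> h x Dx; exact: Ck_cts h Dx.
by move=> [df h]; split=> // v; apply: IH; exact: h.
Qed.

Lemma Ck_sub k V W (D E : set V) (f : V -> W) : E `<=` D -> Ck k D f -> Ck k E f.
Proof.
move=> ED; elim: k f => [|k IH] f /=; first by move=> h x /ED; apply: h.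
by move=> [df h]; split=> [x /ED/df//|v]; apply: IH.
Qed.

Lemma Ck_ext k V W (D : set V) (f g : V -> W) : open D ->
  (forall x, D x -> f x = g x) -> Ck k D f -> Ck k D g.
Proof.
move=> oD; elim: k f g => [|k IH] f g fg /=.
  move=> h x Dx; have nx : \forall y \near x, f y = g y.
    by have := open_nbhs_nbhs (conj oD Dx); apply: filterS.
  have hx : f @ x --> g x by rewrite -fg //; exact: h.
  by apply: cvg_trans hx; apply: near_eq_cvg; apply: filterS nx.
have nx x : D x -> \forall y \near x, f y = g y.
  by move=> Dx; have := open_nbhs_nbhs (conj oD Dx); apply: filterS.
move=> [df h]; split=> [x Dx|v].
  exact: differentiable_near (nx x Dx) (df x Dx).
by apply: IH (h v) => x Dx; apply: diff_near (nx x Dx) (df x Dx).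
Qed.

Lemma Ck_cst k V W (D : set V) (a : W) : Ck k D (fun _ : V => a).
Proof.
elim: k a => [|k IH] a /=; first by move=> x _; exact: cvg_cst.
split=> [x _|v]; first exact: differentiable_cst.
rewrite (_ : (fun _ => _) = fun _ => 0); first exact: IH.
by apply/funext => x; rewrite diff_cst.
Qed.

Lemma CkD k V W (D : set V) (f g : V -> W) : open D ->
  Ck k D f -> Ck k D g -> Ck k D (fun x => f x + g x).
Proof.
move=> oD; elim: k f g => [|k IH] f g /=.
  by move=> hf hg x Dx; apply: continuousD; [exact: hf|exact: hg].
move=> [df hf] [dg hg].
have dfg x : D x -> is_diff x (fun y => f y + g y) (fun v => 'd f x v + 'd g x v).
  by move=> Dx; apply: is_diff_add; apply: differentiableP; [exact: df|exact: dg].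
split=> [x /dfg/@ex_diff//|v].
by apply: Ck_ext (IH _ _ (hf v) (hg v)) => // x /dfg/@diff_val ->.
Qed.

Lemma Ck_linear k V W (D : set V) (l : V -> W) : linear l -> continuous l -> Ck k D l.
Proof.
move=> ll cl; case: k => [|k] /=; first by move=> x _; exact: cl.
split=> [x _|v]; first exact: (@ex_diff _ _ _ _ _ _ _ (is_diff_linear x ll cl)).
rewrite (_ : (fun _ => _) = fun _ => l v); first exact: Ck_cst.
by apply/funext => x; rewrite (@diff_val _ _ _ _ _ _ _ (is_diff_linear x ll cl)).
Qed.

Lemma Ck_linear_comp k U V W (D : set U) (l : V -> W) (f : U -> V) : open D ->
  linear l -> continuous l -> Ck k D f -> Ck k D (fun x => l (f x)).
Proof.
move=> oD ll cl; elim: k f => [|k IH] f /=.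
  move=> hf x Dx; exact: (continuous_comp (hf x Dx) (cl _)).
move=> [df hf].
have dlf x : D x -> is_diff x (fun y => l (f y)) (fun v => l ('d f x v)).
  by move=> /df/differentiableP; exact: is_diff_linear_comp.
split=> [x /dlf/@ex_diff//|v].
by apply: Ck_ext (IH _ (hf v)) => // x /dlf/@diff_val ->.
Qed.

Lemma Ck_bilin k U V V' W (B : {bilinear V -> V' -> W}) (D : set U)
    (f : U -> V) (g : U -> V') : open D -> continuous (fun p => B p.1 p.2) ->
  Ck k D f -> Ck k D g -> Ck k D (fun x => B (f x) (g x)).
Proof.
move=> oD cB; elim: k f g => [|k IH] f g.
  move=> hf hg x Dx.
  apply: (@continuous_comp _ _ _ (fun y => (f y, g y)) (fun p => B p.1 p.2)).
    by apply: cvg_pair; [exact: hf|exact: hg].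
  exact: cB.
move=> hf hg; have [df hf'] := hf; have [dg hg'] := hg.
have dB x : D x -> is_diff x (fun y => B (f y) (g y))
    (fun v => B ('d f x v) (g x) + B (f x) ('d g x v)).
  by move=> Dx; apply: is_diff_bilin => //; apply: differentiableP; [exact: df|exact: dg].
split=> [x /dB/@ex_diff//|v].
apply: (@Ck_ext _ _ _ _
  (fun x => B ('d f x v) (g x) + B (f x) ('d g x v))) => // [x /dB/@diff_val->//|].
by apply: CkD => //; apply: IH => //; [exact: hf'|exact: CkS|exact: CkS|exact: hg'].
Qed.

Lemma Ck_scale k U W (D : set U) (f : U -> R) (g : U -> W) : open D ->
  Ck k D f -> Ck k D g -> Ck k D (fun x => f x *: g x).
Proof. by move=> oD; apply: Ck_bilin => // q; apply: scale_continuous. Qed.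

Lemma Ck_mulmx k U m n p (D : set U) (f : U -> 'M[R]_(m, n)) (g : U -> 'M[R]_(n, p)) :
  open D -> Ck k D f -> Ck k D g -> Ck k D (fun x => f x *m g x).
Proof. by move=> oD; apply: Ck_bilin => //; exact: mulmx_continuous. Qed.

Lemma CkM k U (D : set U) (f g : U -> R) : open D ->
  Ck k D f -> Ck k D g -> Ck k D (fun x => f x * g x).
Proof. exact: Ck_scale. Qed.

Lemma CkN k V W (D : set V) (f : V -> W) : open D -> Ck k D f -> Ck k D (fun x => - f x).
Proof.
move=> oD hf; apply: (@Ck_ext _ _ _ _ (fun x => (-1 : R) *: f x)) => //.
  by move=> x _; rewrite scaleN1r.
by apply: Ck_scale => //; exact: Ck_cst.
Qed.

Lemma CkB k V W (D : set V) (f g : V -> W) : open D ->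
  Ck k D f -> Ck k D g -> Ck k D (fun x => f x - g x).
Proof. by move=> oD hf hg; apply: CkD => //; apply: CkN. Qed.

Lemma Ck_sum k V W (D : set V) I (r : seq I) (P : pred I) (f : I -> V -> W) : open D ->
  (forall i, P i -> Ck k D (f i)) -> Ck k D (fun x => \sum_(i <- r | P i) f i x).
Proof.
move=> oD hf; elim: r => [|i r IH].
  apply: (@Ck_ext _ _ _ _ (fun _ => 0)) => //; last exact: Ck_cst.
  by move=> x _; rewrite big_nil.
case Pi : (P i); last first.
  by apply: Ck_ext IH => // x _; rewrite big_cons Pi.
apply: (@Ck_ext _ _ _ _ (fun x => f i x + \sum_(i <- r | P i) f i x)) => //.
  by move=> x _; rewrite big_cons Pi.
by apply: CkD => //; apply: hf.
Qed.

Lemma Ck_prod k V (D : set V) I (r : seq I) (P : pred I) (f : I -> V -> R) : open D ->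
  (forall i, P i -> Ck k D (f i)) -> Ck k D (fun x => \prod_(i <- r | P i) f i x).
Proof.
move=> oD hf; elim: r => [|i r IH].
  apply: (@Ck_ext _ _ _ _ (fun _ => 1 : R)) => //; last exact: Ck_cst.
  by move=> x _; rewrite big_nil.
case Pi : (P i); last first.
  by apply: Ck_ext IH => // x _; rewrite big_cons Pi.
apply: (@Ck_ext _ _ _ _ (fun x => f i x * \prod_(i <- r | P i) f i x : R)) => //.
  by move=> x _; rewrite big_cons Pi.
by apply: CkM => //; apply: hf.
Qed.

Lemma CkV k V (D : set V) (f : V -> R) : open D -> (forall x, D x -> f x != 0) ->
  Ck k D f -> Ck k D (fun x => (f x)^-1).
Proof.
move=> oD f0; elim: k => [|k IH].
  by move=> hf x Dx; apply: cvgV; [exact: f0|exact: hf].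
move=> hf; have [df hf'] := hf.
have dV x : D x -> is_diff x (fun y => (f y)^-1) (fun v => - (f x) ^- 2 * 'd f x v).
  by move=> Dx; apply: is_diff_inv; [exact: f0|exact/differentiableP/df].
split=> [x /dV/@ex_diff//|v].
have iV := IH (CkS hf).
apply: (@Ck_ext _ _ _ _ (fun x => - ((f x)^-1 * (f x)^-1 * 'd f x v) : R)) => //.
  by move=> x /dV/@diff_val ->; rewrite expr2 invfM mulNr.
by apply: CkN => //; apply: CkM => //; [exact: CkM|exact: hf'].
Qed.

Lemma Ck_pair k U V W (D : set U) (f : U -> V) (g : U -> W) : open D ->
  Ck k D f -> Ck k D g -> Ck k D (fun x => (f x, g x)).
Proof.
move=> oD; elim: k f g => [|k IH] f g /=.
  by move=> hf hg x Dx; apply: cvg_pair; [exact: hf|exact: hg].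
move=> [df hf] [dg hg]; split=> [x Dx|v].
  by apply: differentiable_pair; [exact: df|exact: dg].
apply: Ck_ext (IH _ _ (hf v) (hg v)) => // x Dx.
by have -> := diff_pair (df x Dx) (dg x Dx).
Qed.

Lemma coord_linear m n i j : linear (fun M : 'M[R]_(m, n) => M i j : R).
Proof. by move=> a x y; rewrite !mxE. Qed.

Lemma Ck_coord k V m n (D : set V) (f : V -> 'M[R]_(m, n)) i j : open D ->
  Ck k D f -> Ck k D (fun x => f x i j : R).
Proof.
move=> oD hf; apply: (@Ck_linear_comp _ _ _ _ _ (fun M : 'M[R]_(m, n) => M i j : R)) => //.
  exact: coord_linear.
exact: coord_continuous.
Qed.

Lemma Ck_mx k V m n (D : set V) (f : V -> 'M[R]_(m, n)) : open D ->
  (forall i j, Ck k D (fun x => f x i j : R)) -> Ck k D f.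
Proof.
move=> oD hf.
apply: (@Ck_ext _ _ _ _ (fun y => \sum_(i < m) \sum_(j < n) f y i j *: delta_mx i j)) => //.
  by move=> x _; rewrite -matrix_sum_delta.
do 2!(apply: Ck_sum => // ? _).
by apply: Ck_scale => //; exact: Ck_cst.
Qed.

(** The chain rule differentiates f in the direction ['d g x v], which moves with x. Expanded on the
    spanning family it becomes a finite sum of C^k coefficients times derivatives of f in fixed
    directions, to which the induction hypothesis applies. *)
Lemma Ck_comp k U V W (D : set U) (E : set V) (g : U -> V) (f : V -> W) : fin_dim V ->
  open D -> open E -> (forall x, D x -> E (g x)) ->
  Ck k D g -> Ck k E f -> Ck k D (fun x => f (g x)).
Proof.
move=> [n [b [c [lc cc bc]]]] oD oE DE; elim: k f => [|k IH] f.
  move=> hg hf x Dx; exact: (continuous_comp (hg x Dx) (hf _ (DE _ Dx))).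
move=> hg hf; have [dg hg'] := hg; have [df hf'] := hf.
have dfg x : D x -> is_diff x (fun y => f (g y)) (fun v => 'd f (g x) ('d g x v)).
  move=> Dx; apply: is_diff_comp; apply: differentiableP; first exact: dg.
  exact/df/DE.
split=> [x /dfg/@ex_diff//|v].
apply: (@Ck_ext _ _ _ _ (fun x => \sum_i c ('d g x v) 0 i *: 'd f (g x) (b i))) => //.
  move=> x /dfg/@diff_val ->; rewrite [in RHS](bc ('d g x v)) linear_sum.
  by apply: eq_bigr => i _; rewrite linearZ.
apply: Ck_sum => // i _; apply: Ck_scale => //; last first.
  by apply: (IH (fun y => 'd f y (b i))) => //; [exact: CkS|exact: hf'].
apply: Ck_coord => //; apply: Ck_linear_comp => //; exact: hg'.
Qed.

Lemma Ck_diff k U V W (D : set U) (E : set V) (g h : U -> V) (f : V -> W) : fin_dim V ->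
  open D -> open E -> (forall x, D x -> E (g x)) ->
  Ck k D g -> Ck k D h -> Ck k.+1 E f -> Ck k D (fun x => 'd f (g x) (h x)).
Proof.
move=> fV; have [n [b [c [lc cc bc]]]] := fV.
move=> oD oE DE hg hh [df hf].
apply: (@Ck_ext _ _ _ _ (fun x => \sum_i c (h x) 0 i *: 'd f (g x) (b i))) => //.
  move=> x Dx; rewrite [in RHS](bc (h x)) linear_sum.
  by apply: eq_bigr => i _; rewrite linearZ.
apply: Ck_sum => // i _; apply: Ck_scale => //.
  by apply: Ck_coord => //; apply: Ck_linear_comp.
by apply: (@Ck_comp _ _ _ _ D E g (fun y => 'd f y (b i))) => //; exact: hf.
Qed.

Lemma Ck_det k V n (D : set V) (f : V -> 'M[R]_n) : open D ->
  Ck k D f -> Ck k D (fun x => \det (f x)).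
Proof.
move=> oD hf; apply: Ck_sum => // s _; apply: CkM => //; first exact: Ck_cst.
by apply: Ck_prod => // i _; apply: Ck_coord.
Qed.

Lemma Ck_invmx k V n (D : set V) (f : V -> 'M[R]_n) : open D ->
  (forall x, D x -> f x \in unitmx) ->
  Ck k D f -> Ck k D (fun x => invmx (f x)).
Proof.
move=> oD uf hf.
(* Cramer's formula reduces inversion to determinants, which are polynomial in the entries. *)
apply: (@Ck_ext _ _ _ _ (fun x => (\det (f x))^-1 *: \adj (f x))) => //.
  by move=> x Dx; rewrite /invmx uf.
apply: Ck_scale => //.
  apply: CkV => //; last exact: Ck_det.
  by move=> x /uf; rewrite unitmxE unitfE.
apply: Ck_mx => // i j; apply: (@Ck_ext _ _ _ _ (fun x => cofactor (f x) j i)) => //.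
  by move=> x _; rewrite mxE.
apply: CkM => //; first exact: Ck_cst.
apply: Ck_det => //; apply: Ck_mx => // a b.
apply: (@Ck_ext _ _ _ _ (fun x => f x (lift j a) (lift i b))) => //.
  by move=> x _; rewrite !mxE.
exact: Ck_coord.
Qed.

End CkCalculus.

(** * Symmetry of second differentials *)

Section Schwarz.
Context {R : realType}.
Implicit Types U V W : normedModType R.

Lemma is_diff_derive (f df : R -> R) (x : R) : is_diff x f df -> is_derive x 1 f (df 1).
Proof.
move=> [d e]; split; first exact/derivable1_diffP.
by rewrite deriveE // e.
Qed.

Lemma second_difference V (f : V -> R) (x u v : V) (e : R) : 0 < e ->
  (\forall y \near x, differentiable f y) ->
  differentiable (fun y => 'd f y v : R) x ->
  exists2 d : R, 0 < d & forall h, 0 < h < d ->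
    `|f (x + h *: u + h *: v) - f (x + h *: v) - (f (x + h *: u) - f x)
      - h ^+ 2 * 'd (fun y => 'd f y v : R) x u| <= e * h ^+ 2.
Proof.
move=> e0 df dF; set F := fun y => 'd f y v : R.
set C := `|u| + `|v|; have C0 : 0 <= C by rewrite addr_ge0.
have C1 : 0 < 2 * C + 1 by rewrite ltr_wpDl // mulr_ge0.
(* Two remainders of size at most e' h C, each multiplied by h, add up to at most e h^2. The summand
   1 keeps the denominator positive when u = v = 0. *)
set e' := e / (2 * C + 1); have e'0 : 0 < e' by rewrite divr_gt0.
have /eqaddoP/(_ _ e'0) := diff_locally dF.
move=> /nbhs_ballP[d1 /= d10 Hd1].
move: df => /nbhs_ballP[d2 /= d20 Hd2].
set d := Num.min d1 d2 / (C + 1).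
have C2 : 0 < C + 1 by rewrite ltr_wpDl.
have m0 : 0 < Num.min d1 d2 by rewrite lt_min d10.
exists d => [|h /andP[h0 hd]]; first by rewrite divr_gt0.
have hC : h * C < Num.min d1 d2.
  rewrite (@le_lt_trans _ _ (h * (C + 1)))//; last by rewrite -ltr_pdivlMr.
  by rewrite ler_wpM2l ?(ltW h0)// lerDl.
have small s t : 0 <= s <= h -> 0 <= t <= h -> `|s *: u + t *: v| <= h * C.
  move=> /andP[s0 sh] /andP[t0 th]; rewrite (le_trans (ler_normD _ _))// !normrZ.
  by rewrite !ger0_norm// mulrDr lerD// ler_wpM2r.
have diffxy s t : 0 <= s <= h -> 0 <= t <= h -> differentiable f (x + s *: u + t *: v).
  move=> sh th; apply: Hd2; rewrite -ball_normE /= -addrA opprD addrA subrr add0r normrN.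
  by apply: le_lt_trans (small s t sh th) _; rewrite (lt_le_trans hC)// ge_min lexx orbT.
have est s t : 0 <= s <= h -> 0 <= t <= h ->
    `|F (x + s *: u + t *: v) - F x - 'd F x (s *: u + t *: v)| <= e' * (h * C).
  move=> sh th; have hk : ball 0 d1 (s *: u + t *: v).
    rewrite -ball_normE /= sub0r normrN.
    by rewrite (le_lt_trans (small s t sh th)) // (lt_le_trans hC)// ge_min lexx.
  apply: le_trans (ler_wpM2l (ltW e'0) (small s t sh th)).
  move: (Hd1 _ hk) => /=; congr (`| _ | <= _).
  by rewrite !fctE /= [_ + x]addrC addrA opprD addrA.
set g := fun t : R => f (x + h *: u + t *: v) - f (x + 0 *: u + t *: v).
have h0h : 0 <= h <= h by rewrite lexx ltW.
have zh : (0 : R) <= 0 <= h by rewrite lexx ltW.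
have dl (y : V) (t : R) : is_diff t (fun t : R => y + t *: v) (fun s : R => s *: v).
  have := is_diff_add (is_diff_cst y t) (is_diff_scalel t v).
  congr (is_diff _ _ _); apply/funext => s; exact: add0r.
have dg t : 0 <= t <= h -> is_derive t 1 g
    (F (x + h *: u + t *: v) - F (x + 0 *: u + t *: v)).
  move=> th.
  have dgt : is_diff t g (fun s => 'd f (x + h *: u + t *: v) (s *: v)
      - 'd f (x + 0 *: u + t *: v) (s *: v)).
    apply: is_diff_sub.
      apply: (is_diff_comp (dl (x + h *: u) t)); exact/differentiableP/diffxy.
    apply: (is_diff_comp (dl (x + 0 *: u) t)); exact/differentiableP/diffxy.
  by have := is_diff_derive dgt; rewrite scale1r.
have [||c ch] := @MVT R g (fun t => F (x + h *: u + t *: v) - F (x + 0 *: u + t *: v)) 0 h h0.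
- move=> t; rewrite in_itv /= => /andP[t0 th]; apply: dg.
  by rewrite !ltW.
- apply: derivable_within_continuous => t; rewrite in_itv /= => th.
  by have [] := dg t th.
move: ch; rewrite in_itv /= => /andP[c0 ch].
have chh : 0 <= c <= h by rewrite !ltW.
rewrite {1 2}/g !scale0r !addr0 subr0 => ->.
set a := F _; set b := F _; set D := 'd F x.
have ea := est h c h0h chh; have eb := est 0 c zh chh.
rewrite -/a in ea; rewrite scale0r addr0 -/b add0r in eb.
(* Since D is linear, subtracting the two first-order expansions at the same c leaves exactly
   [h * D u]; the terms in v cancel. *)
have eqh : (a - b) * h - h ^+ 2 * D u =
    (a - F x - D (h *: u + c *: v) - (b - F x - D (c *: v))) * h.
  have Dc : D (c *: v) = c * D v by rewrite linearZ.
  have Dh : D (h *: u) = h * D u by rewrite linearZ.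
  rewrite linearD Dc Dh.
  have id6 (a' b' h' c' x' A B : R) : (a' - b') * h' - h' ^+ 2 * A =
    (a' - x' - (h' * A + c' * B) - (b' - x' - c' * B)) * h' by ring.
  exact: id6.
rewrite eqh normrM (gtr0_norm h0) expr2 mulrA ler_wpM2r ?(ltW h0)//.
apply: le_trans (ler_normB _ _) _; apply: le_trans (lerD ea eb) _.
have id7 (e1 h1 c1 : R) : 2 * c1 + 1 != 0 -> e1 / (2 * c1 + 1) * (h1 * c1) +
    e1 / (2 * c1 + 1) * (h1 * c1) = h1 * (e1 * ((2 * c1) / (2 * c1 + 1))).
  by move=> c10; field.
rewrite /e' id7 ?gt_eqF// [e * h]mulrC.
rewrite ler_wpM2l ?(ltW h0)// ger_pMr// ler_pdivrMr// mul1r lerDl.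
by [].
Qed.

(** The second difference is symmetric in u and v, so both mixed derivatives times h^2 approximate
    the same number, each with error at most (e / 2) h^2; dividing by h^2 leaves e. *)
Lemma diff_symR V (f : V -> R) (x u v : V) :
  (\forall y \near x, differentiable f y) ->
  differentiable (fun y => 'd f y u : R) x ->
  differentiable (fun y => 'd f y v : R) x ->
  'd (fun y => 'd f y v : R) x u = 'd (fun y => 'd f y u : R) x v.
Proof.
move=> df du dv; apply/eqP; rewrite -subr_eq0 -normr_le0; apply/ler_addgt0Pl => e e0.
rewrite addr0; have e2 : 0 < e / 2 by rewrite divr_gt0.
have [d1 d10 H1] := second_difference u e2 df dv.
have [d2 d20 H2] := second_difference v e2 df du.
pose h := Num.min d1 d2 / 2.
have m0 : 0 < Num.min d1 d2 by rewrite lt_min d10.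
have h0 : 0 < h by rewrite divr_gt0.
have hm : h < Num.min d1 d2 by rewrite ltr_pdivrMr// ltr_pMr// ltr1n.
move: (hm); rewrite lt_min => /andP[h1 h2].
have {}H1 := H1 h; have {}H2 := H2 h; rewrite h0 in H1 H2.
have {}H1 := H1 h1; have {}H2 := H2 h2.
have hh : 0 < h ^+ 2 by rewrite exprn_gt0.
rewrite -(ler_pM2r hh) -(gtr0_norm hh) -normrM (gtr0_norm hh).
set a := 'd _ x u in H1 *; set b := 'd _ x v in H2 *.
set p1 := f (x + h *: u + h *: v) in H1; set p2 := f (x + h *: u) in H1 H2.
set p3 := f (x + h *: v) in H1 H2.
rewrite (_ : x + h *: v + h *: u = x + h *: u + h *: v) -/p1 in H2; last by rewrite addrAC.
rewrite (_ : (a - b) * _ = (p1 - p2 - (p3 - f x) - h ^+ 2 * b)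
   - (p1 - p3 - (p2 - f x) - h ^+ 2 * a)); last by ring.
apply: le_trans (ler_normB _ _) _; apply: le_trans (lerD H2 H1) _.
by rewrite -mulrDl -splitr.
Qed.

Lemma diff_coord V m n (f : V -> 'M[R]_(m, n)) x v i j : differentiable f x ->
  'd f x v i j = 'd (fun y => f y i j : R) x v.
Proof.
move=> /differentiableP df.
by rewrite (@diff_val _ _ _ _ _ _ _ (is_diff_linear_comp (@coord_linear _ _ _ i j)
  (@coord_continuous _ _ _ _ _) df)).
Qed.

Lemma diff_sym V m n (D : set V) (f : V -> 'M[R]_(m, n)) (x u v : V) : open D ->
  D x -> Ck 2 D f ->
  'd (fun y => 'd f y v) x u = 'd (fun y => 'd f y u) x v.
Proof.
move=> oD Dx [df d2f].
have nD : \forall y \near x, D y by have := open_nbhs_nbhs (conj oD Dx).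
have nf w i j : \forall y \near x, 'd f y w i j = 'd (fun y => f y i j : R) y w.
  by apply: filterS nD => y Dy; rewrite diff_coord //; exact: df.
have dfw w i j : differentiable (fun y => 'd f y w i j : R) x.
  have [d2 _] := d2f w.
  exact: (@ex_diff _ _ _ _ _ _ _ (is_diff_linear_comp (@coord_linear _ _ _ i j)
    (@coord_continuous _ _ _ _ _) (differentiableP (d2 x Dx)))).
have d2fx w : differentiable (fun y => 'd f y w) x by have [d2 _] := d2f w; exact: d2.
apply/matrixP => i j; rewrite !diff_coord //.
apply: etrans (diff_near u (nf v i j) (dfw v i j)) _.
apply: etrans _ (esym (diff_near v (nf u i j) (dfw u i j))).
apply: diff_symR.
- apply: filterS nD => y Dy.
  exact: (@ex_diff _ _ _ _ _ _ _ (is_diff_linear_comp (@coord_linear _ _ _ i j)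
    (@coord_continuous _ _ _ _ _) (differentiableP (df y Dy)))).
- exact: differentiable_near (nf u i j) (dfw u i j).
- exact: differentiable_near (nf v i j) (dfw v i j).
Qed.

End Schwarz.

(* Unification would otherwise compare differentials of distinct functions by
   unfolding [diff], which does not terminate in practice. *)
#[local] Opaque diff.

Lemma entryD (R : nzRingType) p q (A B : 'M[R]_(p, q)) i j : (A + B) i j = A i j + B i j.
Proof. by rewrite mxE. Qed.
Lemma entryN (R : nzRingType) p q (A : 'M[R]_(p, q)) i j : (- A) i j = - A i j.
Proof. by rewrite mxE. Qed.
Lemma entryZ (R : nzRingType) p q a (A : 'M[R]_(p, q)) i j : (a *: A) i j = a * A i j.
Proof. by rewrite mxE. Qed.
Lemma entry0 (R : nzRingType) p q i j : (0 : 'M[R]_(p, q)) i j = 0.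
Proof. by rewrite mxE. Qed.

(* Equality of two linear combinations of matrices, whose products are atoms. *)
Ltac mx_abel :=
  let i := fresh in let j := fresh in
  apply/matrixP => i j; rewrite ?(entryD, entryN, entryZ, entry0); ring.

(** * Anisotropic calculus in an open set of R^m x R^m *)

Section Parametric.
Context {R : realType}.
Implicit Types E U V W : normedModType R.

Lemma is_diff_sum V W n (f df : 'I_n -> V -> W) x :
  (forall i, is_diff x (f i) (df i)) ->
  is_diff x (fun y => \sum_i f i y) (fun v => \sum_i df i v).
Proof.
move=> h.
have -> : (fun y => \sum_i f i y) = \sum_i f i by apply/funext => y; rewrite fct_sumE.
have -> : (fun y => \sum_i df i y) = \sum_i df i by apply/funext => y; rewrite fct_sumE.
elim/big_ind2 : _ => // [|f1 f2 g1 g2 h1 h2]; first exact: is_diff_cst.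
exact: is_diffD.
Qed.

(** A product rule for a pairing linear in its first argument. Expanding that argument on a spanning
    family yields a finite sum of scalar functions times the maps [K (b i)], so differentiability of
    each [K e] separately is enough. *)
Lemma is_diff_param E V W (K : E -> V -> W) (f df : V -> E) (x : V) : fin_dim E ->
  (forall y, linear (K ^~ y)) -> (forall e, differentiable (K e) x) ->
  is_diff x f df ->
  is_diff x (fun y => K (f y) y) (fun v => K (df v) x + 'd (K (f x)) x v).
Proof.
move=> [p [b [c [lc cc bc]]]] lK dK dfx.
have KE e y : K e y = \sum_i c e 0 i *: K (b i) y.
  pose lM := GRing.isLinear.Build _ _ _ _ _ (lK y).
  pose l : {linear _ -> _} := HB.pack (K ^~ y) lM.
  rewrite -[LHS]/(l e) {1}(bc e) linear_sum.
  by apply: eq_bigr => i _; rewrite linearZ.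
have dc i : is_diff x (fun y => c (f y) 0 i *: K (b i) y)
    (fun v => c (df v) 0 i *: K (b i) x + c (f x) 0 i *: 'd (K (b i)) x v).
  apply: is_diff_scale; last exact: differentiableP.
  have := is_diff_linear_comp lc cc dfx.
  apply: (is_diff_linear_comp (@coord_linear _ _ _ _ _)).
  exact: coord_continuous.
have dKe v : 'd (K (f x)) x v = \sum_i c (f x) 0 i *: 'd (K (b i)) x v.
  have -> : K (f x) = fun y => \sum_i c (f x) 0 i *: K (b i) y.
    by apply/funext => y.
  have dk i : is_diff x (fun y => c (f x) 0 i *: K (b i) y)
      (fun v => c (f x) 0 i *: 'd (K (b i)) x v).
    by apply: (is_diffZ _ (differentiableP _)).
  by rewrite (@diff_val _ _ _ _ _ _ _ (is_diff_sum dk)).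
have := is_diff_sum dc.
congr (is_diff _ _ _); apply/funext => y; first by rewrite -KE.
by rewrite big_split /= -KE -dKe.
Qed.

(** The case K e y = dF(f y) e of the previous product rule. It serves to differentiate [hder],
    whose direction [hlift e z] moves with z. *)
Lemma is_diff_diff E V W (D : set V) (F : V -> W) (f df : E -> V) (g dg : E -> V) (x : E) :
  fin_dim V -> Ck 2 D F -> D (f x) -> is_diff x f df -> is_diff x g dg ->
  is_diff x (fun y => 'd F (f y) (g y))
    (fun v => 'd (fun y => 'd F y (g x)) (f x) (df v) + 'd F (f x) (dg v)).
Proof.
move=> fV [dF d2F] Dx dfx dgx.
have dFe e : differentiable (fun y => 'd F y e) (f x) by have [d _] := d2F e; exact: d.
have := @is_diff_param V E W (fun e y => 'd F (f y) e) g dg x fV.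
have dc e := is_diff_comp dfx (differentiableP (dFe e)).
move=> /(_ (fun y => linearP _) (fun e => (@ex_diff _ _ _ _ _ _ _ (dc e))) dgx).
congr (is_diff _ _ _); apply/funext => v; rewrite addrC; congr (_ + _).
by rewrite (@diff_val _ _ _ _ _ _ _ (dc (g x))).
Qed.

Lemma is_diff_val V W (f df : V -> W) x v : is_diff x f df -> 'd f x v = df v.
Proof. by move=> d; rewrite (@diff_val _ _ _ _ _ _ _ d). Qed.

Lemma diff_linearP V W (f : V -> W) x a u v :
  'd f x (a *: u + v) = a *: 'd f x u + 'd f x v.
Proof. exact: linearP. Qed.

End Parametric.

Section Local.
Context {R : realType} {m : nat}.
Let Z : normedModType R := ('rV[R]_m * 'rV[R]_m)%type.
Variables (O : set Z) (Gi : 'I_m -> Z -> 'M[R]_m).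
Hypotheses (oO : open O) (sG : forall i, smooth_on O (Gi i)).
Implicit Types (e h a b : 'rV[R]_m) (z : Z) (V W : normedModType R).

(* Vectors are rows: [nabla^w_e X] is the derivative of [X] along the horizontal
   lift [(e, - w *m christoffel e)] of [e], plus [X *m christoffel e].  An
   endomorphism field acts on the right, hence the signs in [covm] and [curvm]. *)
Definition christoffel e z : 'M[R]_m := \sum_i e 0 i *: Gi i z.
Definition hlift e z : Z := (e, - (z.2 *m christoffel e z)).
Definition hder W e (F : Z -> W) z : W := 'd F z (hlift e z).
Definition covv e (X : Z -> 'rV[R]_m) z := hder e X z + X z *m christoffel e z.
Definition covm e (M : Z -> 'M[R]_m) z :=
  hder e M z + M z *m christoffel e z - christoffel e z *m M z.
Definition curvm e h z := hder e (christoffel h) z - hder h (christoffel e) z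
  + christoffel h z *m christoffel e z - christoffel e z *m christoffel h z.

Lemma fin_dimZ : fin_dim Z.
Proof. exact: fin_dim_pair (fin_dim_rV _) (fin_dim_rV _). Qed.

Lemma smooth_diff V W (D : set V) (f : V -> W) x : smooth_on D f -> D x -> is_diff x f ('d f x).
Proof. by move=> /(_ 1%N) [df _] Dx; apply/differentiableP/df. Qed.

Lemma Ck_snd k : Ck k O (fun z : Z => z.2).
Proof. by apply: (@Ck_linear _ _ _ _ _ (fun z : Z => z.2)) => // z; exact: cvg_snd. Qed.

Lemma is_diff_snd z : is_diff z (fun z : Z => z.2) (fun z : Z => z.2).
Proof. by apply: is_diff_linear => // y; exact: cvg_snd. Qed.

Lemma christoffel_linear z : linear (christoffel ^~ z).
Proof.
move=> a x y; rewrite /christoffel scaler_sumr -big_split; apply: eq_bigr => i _.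
by rewrite !mxE scalerDl scalerA.
Qed.

(** The [_param] variants let the direction depend on z, as it does in T, where chi is taken along
    [u *m P z]. *)
Lemma smooth_christoffel_param (f : Z -> 'rV[R]_m) :
  smooth_on O f -> smooth_on O (fun z => christoffel (f z) z).
Proof.
move=> sf k; apply: Ck_sum => // i _; apply: Ck_scale => //; last exact: sG.
by apply: Ck_coord.
Qed.

Lemma smooth_christoffel e : smooth_on O (christoffel e).
Proof. by apply: (@smooth_christoffel_param (fun _ => e)) => k; exact: Ck_cst. Qed.

Lemma smooth_hlift_param (f : Z -> 'rV[R]_m) :
  smooth_on O f -> smooth_on O (fun z => hlift (f z) z).
Proof.
move=> sf k; apply: Ck_pair => //; apply: CkN => //; apply: Ck_mulmx => //.
  exact: Ck_snd.
exact: smooth_christoffel_param.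
Qed.

Lemma smooth_hder_param W (F : Z -> W) (f : Z -> 'rV[R]_m) :
  smooth_on O f -> smooth_on O F -> smooth_on O (fun z => hder (f z) F z).
Proof.
move=> sf sF k; apply: (@Ck_diff _ _ _ _ _ O O id) => //; first exact: fin_dimZ.
  by apply: Ck_linear => // z; exact: cvg_id.
exact: smooth_hlift_param.
Qed.

Lemma smooth_hder W e (F : Z -> W) : smooth_on O F -> smooth_on O (hder e F).
Proof. by apply: (@smooth_hder_param _ F (fun _ => e)) => k; exact: Ck_cst. Qed.

Lemma smooth_covv_param (X f : Z -> 'rV[R]_m) :
  smooth_on O f -> smooth_on O X -> smooth_on O (fun z => covv (f z) X z).
Proof.
move=> sf sX k; apply: CkD => //; first exact: smooth_hder_param.
apply: Ck_mulmx => //; exact: smooth_christoffel_param.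
Qed.

Lemma smooth_covv e X : smooth_on O X -> smooth_on O (covv e X).
Proof. by apply: (@smooth_covv_param X (fun _ => e)) => k; exact: Ck_cst. Qed.

Lemma smooth_covm_param (M : Z -> 'M[R]_m) (f : Z -> 'rV[R]_m) :
  smooth_on O f -> smooth_on O M -> smooth_on O (fun z => covm (f z) M z).
Proof.
move=> sf sM k; have sc := smooth_christoffel_param sf k.
apply: CkB => //; [apply: CkD => //|exact: Ck_mulmx].
  exact: smooth_hder_param.
exact: Ck_mulmx.
Qed.

Lemma smooth_covm e M : smooth_on O M -> smooth_on O (covm e M).
Proof. by apply: (@smooth_covm_param M (fun _ => e)) => k; exact: Ck_cst. Qed.

Lemma hlift_linear z : linear (hlift ^~ z).
Proof.
move=> a x y; rewrite /hlift christoffel_linear mulmxDr -scalemxAr opprD -scalerN.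
by [].
Qed.

Lemma covm_linear M z : linear (fun e => covm e M z).
Proof.
move=> a x y; rewrite /covm /hder hlift_linear diff_linearP christoffel_linear.
have K (c : R) (d1 d2 N g1 g2 : 'M[R]_m) :
    c *: d1 + d2 + N *m (c *: g1 + g2) - (c *: g1 + g2) *m N =
    c *: (d1 + N *m g1 - g1 *m N) + (d2 + N *m g2 - g2 *m N).
  by rewrite mulmxDr mulmxDl -!scalemxAr -!scalemxAl; mx_abel.
exact: K.
Qed.

Lemma hderB W e (F G : Z -> W) z : differentiable F z -> differentiable G z ->
  hder e (fun z => F z - G z) z = hder e F z - hder e G z.
Proof. by move=> /differentiableP dF /differentiableP dG; exact: is_diff_val (is_diff_sub dF dG). Qed.

Lemma hder_mulmx p q r e (M : Z -> 'M[R]_(p, q)) (N : Z -> 'M[R]_(q, r)) z :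
  differentiable M z -> differentiable N z ->
  hder e (fun z => M z *m N z) z = hder e M z *m N z + M z *m hder e N z.
Proof.
by move=> /differentiableP dM /differentiableP dN; exact: is_diff_val (is_diff_mulmx dM dN).
Qed.

Lemma covv_mulmx e X M z : differentiable X z -> differentiable M z ->
  covv e (fun z => X z *m M z) z = covv e X z *m M z + X z *m covm e M z.
Proof.
move=> dX dM; rewrite /covv /covm hder_mulmx //.
have K (x' x : 'rV[R]_m) (d' d g : 'M[R]_m) : x' *m d + x *m d' + x *m d *m g =
    (x' + x *m g) *m d + x *m (d' + d *m g - g *m d).
  by rewrite mulmxBr mulmxDr mulmxDl !mulmxA; mx_abel.
exact: K.
Qed.

Lemma covm_mulmx e M N z : differentiable M z -> differentiable N z ->
  covm e (fun z => M z *m N z) z = covm e M z *m N z + M z *m covm e N z.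
Proof.
move=> dM dN; rewrite /covm hder_mulmx //.
have K (x' x d' d g : 'M[R]_m) :
    x' *m d + x *m d' + x *m d *m g - g *m (x *m d) =
    (x' + x *m g - g *m x) *m d + x *m (d' + d *m g - g *m d).
  by rewrite mulmxBr mulmxDr mulmxBl mulmxDl !mulmxA; mx_abel.
exact: K.
Qed.

Lemma covmB e M N z : differentiable M z -> differentiable N z ->
  covm e (fun z => M z - N z) z = covm e M z - covm e N z.
Proof.
move=> dM dN; rewrite /covm (hderB e dM dN).
have K (x' x d' d g : 'M[R]_m) : x' - d' + (x - d) *m g - g *m (x - d) =
    (x' + x *m g - g *m x) - (d' + d *m g - g *m d).
  by rewrite mulmxBl mulmxBr; mx_abel.
exact: K.
Qed.

Lemma covv_cst e s z : covv e (fun _ => s) z = s *m christoffel e z.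
Proof. by rewrite /covv /hder diff_cst add0r. Qed.

Lemma is_diff_hlift e z : O z -> is_diff z (hlift e)
  (fun v => (0, - (v.2 *m christoffel e z + z.2 *m 'd (christoffel e) z v))).
Proof.
move=> Oz; have dG := smooth_diff (smooth_christoffel e) Oz.
apply: is_diff_pair (is_diff_const e z) _.
apply: is_diff_opp; apply: is_diff_mulmx => //; exact: is_diff_snd.
Qed.

Lemma is_diff_hder p q e (F : Z -> 'M[R]_(p, q)) z : O z -> smooth_on O F ->
  is_diff z (hder e F) (fun v => 'd (fun y => 'd F y (hlift e z)) z v
    + 'd F z (0, - (v.2 *m christoffel e z + z.2 *m 'd (christoffel e) z v))).
Proof.
move=> Oz sF.
exact: (is_diff_diff (f := id) fin_dimZ (sF 2%N) Oz (is_diff_id z) (is_diff_hlift e Oz)).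
Qed.

(** The second-order terms cancel by [diff_sym], which leaves dF on the bracket of the two lifts.
    Their base components are constant, so this bracket is tangent to the fibre, with component - w
    R(e, h). *)
Lemma hder_comm p q e h (F : Z -> 'M[R]_(p, q)) z : O z -> smooth_on O F ->
  hder e (hder h F) z - hder h (hder e F) z = - 'd F z (0, z.2 *m curvm e h z).
Proof.
move=> Oz sF.
have D e' h' : hder e' (hder h' F) z = 'd (fun y => 'd F y (hlift h' z)) z (hlift e' z)
    + 'd F z (0, - ((hlift e' z).2 *m christoffel h' z + z.2 *m hder e' (christoffel h') z)).
  exact: is_diff_val (is_diff_hder h' Oz sF).
rewrite (D e h) (D h e).
have K (V W : zmodType) (f : {additive V -> W}) (c c' : W) (a b x : V) :
  c = c' -> a - b = - x -> c + f a - (c' + f b) = - f x.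
  by move=> <- abx; rewrite opprD addrACA subrr add0r -raddfB abx raddfN.
apply: K; first exact: diff_sym oO Oz (sF 2%N).
apply: (congr2 pair); rewrite /= ?subrr ?oppr0 //.
have K2 (w : 'rV[R]_m) (ge gh deh dhe : 'M[R]_m) :
    - (- (w *m ge) *m gh + w *m deh) - (- (- (w *m gh) *m ge + w *m dhe)) =
    - (w *m (deh - dhe + gh *m ge - ge *m gh)).
  by rewrite !mulmxBr mulmxDr mulmxBr !mulNmx !mulmxA; mx_abel.
exact: K2.
Qed.

Lemma covv_comm e h X z : O z -> smooth_on O X ->
  covv e (covv h X) z - covv h (covv e X) z =
  X z *m curvm e h z - 'd X z (0, z.2 *m curvm e h z).
Proof.
move=> Oz sX.
have D e' h' : hder e' (covv h' X) z = hder e' (hder h' X) z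
    + (hder e' X z *m christoffel h' z + X z *m hder e' (christoffel h') z).
  have d1 := smooth_diff (smooth_hder h' sX) Oz.
  have d2 := is_diff_mulmx (smooth_diff sX Oz) (smooth_diff (smooth_christoffel h') Oz).
  exact: is_diff_val (is_diff_add d1 d2).
have C := hder_comm e h Oz sX.
have E e' h' : covv e' (covv h' X) z = hder e' (hder h' X) z
    + (hder e' X z *m christoffel h' z + X z *m hder e' (christoffel h') z)
    + (hder h' X z + X z *m christoffel h' z) *m christoffel e' z.
  by rewrite -D.
rewrite (E e h) (E h e); clear D E; move: C; rewrite /curvm.
move: (hder e (hder h X) z) (hder h (hder e X) z) (hder e X z) (hder h X z) (X z)
  (hder e (christoffel h) z) (hder h (christoffel e) z)
  (christoffel e z) (christoffel h z) ('d X z _).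
move=> xeh xhe xe xh x geh ghe ge gh w C.
have {C} -> : xeh = xhe - w by rewrite -C addrC subrK.
by rewrite !(mulmxBr, mulmxDr, mulmxDl) !mulmxA; mx_abel.
Qed.

Lemma covm_comm e h M z : O z -> smooth_on O M ->
  covm e (covm h M) z - covm h (covm e M) z =
  M z *m curvm e h z - curvm e h z *m M z - 'd M z (0, z.2 *m curvm e h z).
Proof.
move=> Oz sM.
have D e' h' : hder e' (covm h' M) z = hder e' (hder h' M) z
    + (hder e' M z *m christoffel h' z + M z *m hder e' (christoffel h') z)
    - (hder e' (christoffel h') z *m M z + christoffel h' z *m hder e' M z).
  have d1 := smooth_diff (smooth_hder h' sM) Oz.
  have dG := smooth_diff (smooth_christoffel h') Oz.
  have d2 := is_diff_mulmx (smooth_diff sM Oz) dG.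
  have d3 := is_diff_mulmx dG (smooth_diff sM Oz).
  exact: is_diff_val (is_diff_sub (is_diff_add d1 d2) d3).
have C := hder_comm e h Oz sM.
have E e' h' : covm e' (covm h' M) z = hder e' (hder h' M) z
    + (hder e' M z *m christoffel h' z + M z *m hder e' (christoffel h') z)
    - (hder e' (christoffel h') z *m M z + christoffel h' z *m hder e' M z)
    + (hder h' M z + M z *m christoffel h' z - christoffel h' z *m M z)
       *m christoffel e' z
    - christoffel e' z *m (hder h' M z + M z *m christoffel h' z - christoffel h' z *m M z).
  by rewrite -D.
rewrite (E e h) (E h e); clear D E; move: C; rewrite /curvm.
move: (hder e (hder h M) z) (hder h (hder e M) z) (hder e M z) (hder h M z) (M z)
  (hder e (christoffel h) z) (hder h (christoffel e) z)
  (christoffel e z) (christoffel h z) ('d M z _).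
move=> xeh xhe xe xh x geh ghe ge gh w C.
have {C} -> : xeh = xhe - w by rewrite -C addrC subrK.
by rewrite !(mulmxBr, mulmxDr, mulmxDl, mulmxBl, mulNmx, mulmxN) !mulmxA ?mulNmx; mx_abel.
Qed.

End Local.

(** * Covariant derivatives of a field of projections *)

Section ProjectionField.
Context {R : realType} {m : nat}.
Let Z : normedModType R := ('rV[R]_m * 'rV[R]_m)%type.
Variables (O : set Z) (Gi : 'I_m -> Z -> 'M[R]_m).
Hypotheses (oO : open O) (sG : forall i, smooth_on O (Gi i)).
Implicit Types (e h a b s u : 'rV[R]_m) (z : Z) (V W : normedModType R).

Local Notation covv := (covv Gi).
Local Notation covm := (covm Gi).
Local Notation hder := (hder Gi).
Local Notation curvm := (curvm Gi).
Local Notation christoffel := (christoffel Gi).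

Lemma near_open z : O z -> \forall y \near z, O y.
Proof. by move=> Oz; have := open_nbhs_nbhs (conj oO Oz). Qed.

Lemma hder_ext W e (F G : Z -> W) z : O z -> differentiable F z ->
  (forall z, O z -> F z = G z) -> hder e F z = hder e G z.
Proof. by move=> Oz dF FG; apply: diff_near dF; apply: filterS (near_open Oz). Qed.

Lemma covm_ext e (M N : Z -> 'M[R]_m) z : O z -> differentiable M z ->
  (forall z, O z -> M z = N z) -> covm e M z = covm e N z.
Proof. by move=> Oz dM MN; rewrite /covm (hder_ext e Oz dM MN) (MN z Oz). Qed.

Lemma covv_ext e (X Y : Z -> 'rV[R]_m) z : O z -> differentiable X z ->
  (forall z, O z -> X z = Y z) -> covv e X z = covv e Y z.
Proof. by move=> Oz dX XY; rewrite /covv (hder_ext e Oz dX XY) (XY z Oz). Qed.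

Variable P : Z -> 'M[R]_m.
Hypotheses (sP : smooth_on O P) (PP : forall z, O z -> P z *m P z = P z).

Let dP z : O z -> differentiable P z.
Proof. by move=> /(smooth_diff sP)/@ex_diff. Qed.

(* [P (nabla_h P) P = 0] turns chi_h a = P nabla_h (Q a) + Q nabla_h (P a), where
   Q = 1 - P, into this commutator. *)
Definition chi h z := P z *m covm h P z - covm h P z *m P z.

Lemma covm_idem h z : O z -> covm h P z *m P z + P z *m covm h P z = covm h P z.
Proof.
move=> Oz; rewrite -covm_mulmx; [|exact: dP..].
apply: covm_ext => //.
exact: (@ex_diff _ _ _ _ _ _ _ (is_diff_mulmx (smooth_diff sP Oz) (smooth_diff sP Oz))).
Qed.

Lemma diff_idem z v : O z -> 'd P z v *m P z + P z *m 'd P z v = 'd P z v.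
Proof.
move=> Oz; have d := is_diff_mulmx (smooth_diff sP Oz) (smooth_diff sP Oz).
apply: etrans (esym (is_diff_val v d)) _; apply: diff_near; last exact: (@ex_diff _ _ _ _ _ _ _ d).
by apply: filterS (near_open Oz) => y; exact: PP.
Qed.

(** Multiplying the differentiated identity by p on both sides gives pdp = pdp + pdp. *)
Lemma idem_deriv_sandwich (p d : 'M[R]_m) : p *m p = p -> d *m p + p *m d = d ->
  p *m d *m p = 0.
Proof.
move=> pp dd; have : p *m d *m p = p *m d *m p + p *m d *m p.
  by rewrite -{1}dd mulmxDr mulmxDl !mulmxA pp -!mulmxA pp.
by move=> /eqP; rewrite -subr_eq subrr eq_sym => /eqP.
Qed.

Lemma smooth_mulmx_cst s (M : Z -> 'M[R]_m) :
  smooth_on O M -> smooth_on O (fun z => s *m M z).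
Proof. by move=> sM k; apply: Ck_mulmx => //; exact: Ck_cst. Qed.

(* The fibre derivative of [P], which appears when covariant derivatives of the
   anisotropic field [s *m P] are commuted, is killed by the outer projections. *)
Lemma projected_curvature e h s z : O z -> s *m P z = s ->
  (covv e (fun z => covv h (fun z => s *m P z) z *m P z) z
   - covv h (fun z => covv e (fun z => s *m P z) z *m P z) z) *m P z =
  s *m curvm e h z *m P z
  + s *m (covm h P z *m covm e P z - covm e P z *m covm h P z).
Proof.
move=> Oz sPz; have sF := smooth_mulmx_cst s sP.
have E e' h' : covv e' (fun z => covv h' (fun z => s *m P z) z *m P z) z =
    covv e' (covv h' (fun z => s *m P z)) z *m P z
    + (s *m christoffel h' z *m P z + s *m covm h' P z) *m covm e' P z.
  rewrite covv_mulmx; last exact: dP; last first.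
    exact: (@ex_diff _ _ _ _ _ _ _ (smooth_diff (smooth_covv oO sG h' sF) Oz)).
  congr (_ + _ *m _).
  by rewrite covv_mulmx ?covv_cst//; exact: dP.
have C := covv_comm oO sG e h Oz sF.
have Ce := covm_idem e Oz; have Ch := covm_idem h Oz.
have Cd := diff_idem (0, z.2 *m curvm e h z) Oz.
have D : 'd (fun z => s *m P z) z (0, z.2 *m curvm e h z) = s *m 'd P z (0, z.2 *m curvm e h z).
  by rewrite (is_diff_val _ (is_diff_mulmx (is_diff_const s z) (smooth_diff sP Oz))) mul0mx add0r.
rewrite D in C; rewrite (E e h) (E h e); move: (PP Oz) sPz C Ce Ch Cd {E D}.
move: (covv e (covv h _) z) (covv h (covv e _) z) (covm e P z) (covm h P z)
  (P z) (christoffel h z) (christoffel e z).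
move: (curvm e h z) => r; move: ('d P z (0, z.2 *m r)) => d.
move=> xeh xhe pe ph p gh ge pp sp C Ce Ch Cd.
have Zd := idem_deriv_sandwich pp Cd.
have Ze := idem_deriv_sandwich pp Ce; have Zh := idem_deriv_sandwich pp Ch.
(* The Christoffel term contains p q2 p = 0. In the rest q2 p = q2 - p q2, and s q1 p q2 = s p q1 p
   q2 vanishes as well, since s = s p. *)
have F q1 q2 g : p *m q1 *m p = 0 -> p *m q2 *m p = 0 -> q2 *m p + p *m q2 = q2 ->
    (s *m g *m p + s *m q1) *m q2 *m p = s *m q1 *m q2.
  move=> H1 H2 H3; rewrite mulmxDl mulmxDl -!mulmxA [p *m (q2 *m p)]mulmxA H2 !mulmx0 add0r.
  have -> : q2 *m p = q2 - p *m q2 by rewrite -{2}H3 addrK.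
  rewrite !mulmxBr !mulmxA -{2}sp -!mulmxA.
  by rewrite [p *m (q1 *m _)]mulmxA [p *m q1 *m _]mulmxA H1 mul0mx mulmx0 subr0.
have K (x1 x2 y1 y2 : 'rV[R]_m) : (x1 *m p + y1 - (x2 *m p + y2)) *m p =
    (x1 - x2) *m p + (y1 *m p - y2 *m p).
  by rewrite opprD addrACA -mulmxBl mulmxDl -mulmxA pp !mulmxBl.
rewrite K (F _ _ _ Zh Ze Ce) (F _ _ _ Ze Zh Ch) C sp mulmxBr !mulmxA mulmxBl.
have -> : s *m d *m p = 0 by rewrite -[s]sp -!mulmxA [p *m _]mulmxA Zd mulmx0.
by rewrite subr0.
Qed.

Lemma smooth_chi_param (f : Z -> 'rV[R]_m) :
  smooth_on O f -> smooth_on O (fun z => chi (f z) z).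
Proof.
move=> sf k; have sc := smooth_covm_param oO sG sf sP k.
by apply: CkB => //; apply: Ck_mulmx => //; exact: sP.
Qed.

Lemma smooth_chi h : smooth_on O (chi h).
Proof. by apply: (@smooth_chi_param (fun _ => h)) => k; exact: Ck_cst. Qed.

Lemma chi_linear z : linear (chi ^~ z).
Proof.
move=> a x y; rewrite /chi (covm_linear Gi P z).
have K (c : R) (p d1 d2 : 'M[R]_m) : p *m (c *: d1 + d2) - (c *: d1 + d2) *m p =
    c *: (p *m d1 - d1 *m p) + (p *m d2 - d2 *m p).
  by rewrite mulmxDr mulmxDl -scalemxAl -scalemxAr; mx_abel.
exact: K.
Qed.

Lemma covm_chi e h z : O z -> covm e (chi h) z =
  covm e P z *m covm h P z + P z *m covm e (covm h P) z
  - (covm e (covm h P) z *m P z + covm h P z *m covm e P z).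
Proof.
move=> Oz; have dPz := smooth_diff sP Oz.
have dch := smooth_diff (smooth_covm oO sG h sP) Oz.
rewrite /chi covmB.
- by rewrite !covm_mulmx //.
- exact: (@ex_diff _ _ _ _ _ _ _ (is_diff_mulmx dPz dch)).
- exact: (@ex_diff _ _ _ _ _ _ _ (is_diff_mulmx dch dPz)).
Qed.

(** Antisymmetrising [covm_chi] leaves products of two first derivatives and the commutator of
    second derivatives. The products preserve the image of P and are removed by 1 - P. The
    commutator gives the curvature, a term ending in P that 1 - P also removes, and a fibre
    derivative d with s d = s P d = 0. *)
Lemma chi_ricci e h s z : O z -> s *m P z = s ->
  (forall a, P z *m 'd P z (0, a) = 0) ->
  s *m (covm e (chi h) z - covm h (chi e) z) *m (1%:M - P z) =
  s *m curvm e h z *m (1%:M - P z).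
Proof.
move=> Oz sPz Pd; rewrite !covm_chi //.
have C := covm_comm oO sG e h Oz sP.
have Ce := covm_idem e Oz; have Ch := covm_idem h Oz.
have {}Pd := Pd (z.2 *m curvm e h z).
move: (PP Oz) sPz C Ce Ch Pd.
move: (covm e (covm h P) z) (covm h (covm e P) z) (covm e P z) (covm h P z)
  (P z).
move: (curvm e h z) => r; move: ('d P z (0, z.2 *m r)) => d.
move=> xeh xhe pe ph p pp sp C Ce Ch Pd.
have Ze := idem_deriv_sandwich pp Ce; have Zh := idem_deriv_sandwich pp Ch.
(* Here q2 (1 - p) = p q2, so that s = s p produces the factor p q1 p. *)
have F q1 q2 : p *m q1 *m p = 0 -> q2 *m p + p *m q2 = q2 ->
    s *m (q1 *m q2) *m (1%:M - p) = 0.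
  move=> H1 H2; rewrite -mulmxA -[q1 *m q2 *m _]mulmxA mulmxBr mulmx1.
  have -> : q2 - q2 *m p = p *m q2 by rewrite -{1}H2 addrC addKr.
  by rewrite -[s]sp -!mulmxA [p *m (q1 *m _)]mulmxA [p *m q1 *m _]mulmxA H1 mul0mx mulmx0.
have {C} -> : xeh = xhe + (p *m r - r *m p - d) by rewrite -C addrC subrK.
set w := p *m r - r *m p - d.
have -> : pe *m ph + p *m (xhe + w) - ((xhe + w) *m p + ph *m pe)
   - (ph *m pe + p *m xhe - (xhe *m p + pe *m ph)) =
   (pe *m ph + pe *m ph - (ph *m pe + ph *m pe)) + p *m w - w *m p.
  by rewrite !(mulmxDr, mulmxDl); mx_abel.
have pq : p *m (1%:M - p) = 0 by rewrite mulmxBr mulmx1 pp subrr.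
have K (a b x y q : 'M[R]_m) : s *m (a + a - (b + b) + x - y) *m q =
    s *m a *m q + s *m a *m q - (s *m b *m q + s *m b *m q)
    + s *m x *m q - s *m y *m q.
  by rewrite !(mulmxBr, mulmxDr, mulmxBl, mulmxDl, mulNmx).
have K' (a b c q : 'M[R]_m) : s *m (a - b - c) *m q =
    s *m a *m q - s *m b *m q - s *m c *m q.
  by rewrite !(mulmxBr, mulmxBl).
rewrite K (F _ _ Ze Ch) (F _ _ Zh Ce) !addr0 subr0 add0r.
have Zp (x : 'M[R]_m) : s *m (x *m p) *m (1%:M - p) = 0.
  by rewrite -!mulmxA pq !mulmx0.
have Sp (x : 'M[R]_m) : s *m (p *m x) = s *m x by rewrite mulmxA sp.
rewrite Zp subr0 Sp /w K' Zp Sp subr0.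
by rewrite -(Sp d) Pd mulmx0 mul0mx subr0.
Qed.

(* The left-hand side is [nabla_e S] for the tensor [S_u s = chi_(k u) s]; with
   [k = P] this is T and with [k = 1 - P] it is A. *)
Lemma covv_chi e (k : Z -> 'M[R]_m) s u z : O z -> smooth_on O k ->
  covv e (fun z => s *m chi (u *m k z) z) z
  - s *m chi (u *m christoffel e z *m k z) z
  - s *m christoffel e z *m chi (u *m k z) z =
  s *m (covm e (chi (u *m k z)) z
        + chi (u *m covm e k z - u *m k z *m christoffel e z) z).
Proof.
move=> Oz sk.
have dk := is_diff_mulmx (is_diff_const u z) (smooth_diff sk Oz).
have dK e' : differentiable (chi e') z.
  by exact: (@ex_diff _ _ _ _ _ _ _ (smooth_diff (smooth_chi e') Oz)).
have dp := is_diff_param (fin_dim_rV m) chi_linear dK dk.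
have E : hder e (fun z => s *m chi (u *m k z) z) z =
    s *m (chi (u *m hder e k z) z + hder e (chi (u *m k z)) z).
  rewrite /hder (is_diff_val _ (is_diff_mulmx (is_diff_const s z) dp)).
  by rewrite !mul0mx !add0r.
rewrite /covv E {E}.
have CB a b : chi (a - b) z = chi a z - chi b z.
  have := chi_linear z (-1) b a; rewrite !scaleN1r => H.
  by rewrite [a - b]addrC H addrC.
have -> : u *m covm e k z - u *m k z *m christoffel e z =
   u *m hder e k z - u *m christoffel e z *m k z.
  have K (a b c : 'M[R]_m) : u *m (a + b *m c - c *m b) - u *m b *m c = u *m a - u *m c *m b.
    by rewrite mulmxBr mulmxDr !mulmxA; mx_abel.
  exact: K.
rewrite CB /covm.
have K (a b c g x : 'M[R]_m) : s *m (a + b) + s *m x *m g - s *m c - s *m g *m x =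
    s *m (b + x *m g - g *m x + (a - c)).
  by rewrite !(mulmxDr, mulmxBr, mulmxN) !mulmxA; mx_abel.
exact: K.
Qed.

End ProjectionField.

(** * Projections onto the kernel of a matrix-valued function constant along the fibres *)

Section VerticalProjection.
Context {R : realType} {m n : nat}.
Let Z : normedModType R := ('rV[R]_m * 'rV[R]_m)%type.
Variables (O : set Z) (Gi : 'I_m -> Z -> 'M[R]_m).
Hypotheses (oO : open O) (sG : forall i, smooth_on O (Gi i)).
Variables (P : Z -> 'M[R]_m) (S : Z -> 'M[R]_(m, n)).
Hypotheses (sP : smooth_on O P) (sS : smooth_on O S).
Hypothesis PS : forall z, O z -> P z *m S z = 0.
Hypothesis SP : forall z (e : 'rV[R]_m), O z -> e *m S z = 0 -> e *m P z = e.
Implicit Types (e h a b s u w : 'rV[R]_m) (z : Z).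

Lemma vertical_idem z : O z -> P z *m P z = P z.
Proof.
move=> Oz; apply/row_matrixP => i; rewrite row_mul; apply: SP => //.
by rewrite -row_mul PS // row0.
Qed.

Lemma diff_vertical z v : O z -> 'd P z v *m S z = - (P z *m 'd S z v).
Proof.
move=> Oz; have d := is_diff_mulmx (smooth_diff sP Oz) (smooth_diff sS Oz).
have E : 'd (fun y => P y *m S y) z v = 0.
  apply: etrans (esym (diff_near v _ (differentiable_cst 0 z))) _.
    by apply: filterS (near_open oO Oz) => y /PS ->.
  by rewrite diff_cst.
apply/eqP; rewrite -addr_eq0; apply/eqP.
exact: etrans (esym (is_diff_val v d)) E.
Qed.

Hypothesis Sw : forall z a, O z -> 'd S z (0, a) = 0.

(** The kernel of S does not move along the fibre, so the fibre derivative d of P still has vertical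
    rows, that is d P = d. Then P d = P d P = 0. *)
Lemma vertical_fiber_deriv z a : O z -> P z *m 'd P z (0, a) = 0.
Proof.
move=> Oz; have dP0 : 'd P z (0, a) *m P z = 'd P z (0, a).
  apply/row_matrixP => i; rewrite row_mul; apply: SP => //.
  by rewrite -row_mul diff_vertical // Sw // mulmx0 oppr0 row0.
have := idem_deriv_sandwich (vertical_idem Oz) (diff_idem oO sP vertical_idem (0, a) Oz).
by rewrite -mulmxA dP0.
Qed.

Hypothesis Ssym : forall z u w, O z -> u *m 'd S z (w, 0) = w *m 'd S z (u, 0).

(* Integrability of the vertical distribution enters only through [Ssym], the
   symmetry of the second derivative of the submersion. *)
Lemma covm_vertical_sym u w z : O z ->
  u *m christoffel Gi w z = w *m christoffel Gi u z ->
  u *m P z = u -> w *m P z = w ->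
  u *m covm Gi w P z = w *m covm Gi u P z.
Proof.
move=> Oz Gsym uP wP.
have dPD a b : 'd P z (a, b) = 'd P z (a, 0) + 'd P z (0, b).
  rewrite -linearD; congr ('d P z _).
  by rewrite -[RHS]/(_ + _, _ + _) /= addr0 add0r.
have E a b : a *m P z = a ->
    a *m covm Gi b P z = a *m 'd P z (b, 0) + a *m christoffel Gi b z
      - a *m christoffel Gi b z *m P z.
  move=> aP; rewrite /covm /hder /hlift dPD.
  have K (d1 d2 g p : 'M[R]_m) : a *m p = a -> p *m d2 = 0 ->
      a *m (d1 + d2 + p *m g - g *m p) = a *m d1 + a *m g - a *m g *m p.
    move=> ap pd; have ad : a *m d2 = 0 by rewrite -ap -mulmxA pd mulmx0.
    by rewrite mulmxBr !mulmxDr !mulmxA ap ad addr0.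
  exact: K aP (vertical_fiber_deriv _ Oz).
rewrite (E _ _ uP) (E _ _ wP) Gsym; congr (_ + _ - _).
have sand a b : a *m P z = a -> a *m 'd P z (b, 0) *m P z = 0.
  move=> aP; have := idem_deriv_sandwich (vertical_idem Oz)
    (diff_idem oO sP vertical_idem (b, 0) Oz).
  move: ('d P z (b, 0)) => d H.
  by rewrite -aP -2!mulmxA [P z *m (d *m _)]mulmxA H mulmx0.
have SE a b : a *m P z = a -> a *m 'd P z (b, 0) *m S z = - (a *m 'd S z (b, 0)).
  by move=> aP; rewrite -mulmxA diff_vertical // mulmxN mulmxA aP.
(* By the symmetry of dS, the difference is annihilated by S; it is therefore vertical and fixed by
   P. But [sand] shows that P annihilates it. *)
apply/eqP; rewrite -subr_eq0; apply/eqP.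
rewrite -(SP Oz (e := u *m 'd P z (w, 0) - w *m 'd P z (u, 0))).
  by rewrite mulmxBl !sand // subrr.
by rewrite mulmxBl !SE // (Ssym u w Oz) subrr.
Qed.

End VerticalProjection.

(** * The O'Neill identities as matrix algebra at one vector *)

Section PointwiseAlgebra.
Context {R : realType} {m : nat}.
Variables (G P : 'M[R]_m) (D Gam : 'rV[R]_m -> 'M[R]_m).
Variables (Rm C : 'rV[R]_m -> 'rV[R]_m -> 'M[R]_m).
Implicit Types (a b e h s u v w x y : 'rV[R]_m).
Hypotheses (PP : P *m P = P) (lD : linear D) (DP : forall h, D h *m P + P *m D h = D h).
Hypotheses (PG : P *m G = G *m P^T) (DG : forall h, D h *m G = G *m (D h)^T).
Hypothesis Dsym : forall u w, u *m P = u -> w *m P = w -> u *m D w = w *m D u.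
Hypothesis Gsym : forall u w, u *m Gam w = w *m Gam u.

(** The value of chi_h at a fixed vector: [D h] stands for nabla_h P, [Gam e] for the Christoffel
    matrix, [Rm e h] for the curvature and [C e h] for nabla_e chi_h. The link between [C] and [Rm]
    is the Ricci identity [CR]. *)
Definition chiP h := P *m D h - D h *m P.
Hypothesis CR : forall e h s, s *m P = s ->
  s *m (C e h - C h e) *m (1%:M - P) = s *m Rm e h *m (1%:M - P).
Definition gform a b : R := (a *m G *m b^T) 0 0.

Lemma gformDl a b c : gform (a + b) c = gform a c + gform b c.
Proof. by rewrite /gform !mulmxDl mxE. Qed.
Lemma gformNl a c : gform (- a) c = - gform a c.
Proof. by rewrite /gform !mulNmx mxE. Qed.
Lemma gformBl a b c : gform (a - b) c = gform a c - gform b c.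
Proof. by rewrite gformDl gformNl. Qed.
Lemma gformNr a c : gform a (- c) = - gform a c.
Proof. by rewrite /gform linearN /= mulmxN mxE. Qed.
Lemma gformBr a b c : gform a (b - c) = gform a b - gform a c.
Proof. by rewrite /gform linearB /= mulmxBr !mxE. Qed.

Lemma gform0r a : gform a 0 = 0.
Proof. by rewrite /gform trmx0 mulmx0 mxE. Qed.

Lemma gform_adj (M : 'M[R]_m) a b : M *m G = G *m M^T -> gform (a *m M) b = gform a (b *m M).
Proof. by move=> MG; rewrite /gform -!mulmxA (mulmxA M) MG trmx_mul -!mulmxA. Qed.

Let PDP h : P *m D h *m P = 0.
Proof. exact: idem_deriv_sandwich. Qed.

Let DE h : D h *m P = D h - P *m D h.
Proof. by rewrite -{2}DP addrK. Qed.

(** [D h] exchanges vertical and horizontal rows. Hence the commutator chi_h is [D h] on vertical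
    rows and, by [chi_hor], its opposite on horizontal ones. *)
Let chi_vert s h : s *m P = s -> s *m chiP h = s *m D h.
Proof. by move=> sP; rewrite /chiP mulmxBr !mulmxA sP -{2}sP -!mulmxA (mulmxA P) PDP mulmx0 subr0. Qed.

Let D_vert s h : s *m P = s -> s *m D h *m P = 0.
Proof. by move=> sP; rewrite -sP -!mulmxA (mulmxA P) PDP mulmx0. Qed.

Let chi_hor x h : x *m P = 0 -> x *m chiP h = - (x *m D h).
Proof. by move=> xP; rewrite /chiP mulmxBr mulmxA xP mul0mx sub0r DE mulmxBr mulmxA xP mul0mx subr0. Qed.

Let D_hor x h : x *m P = 0 -> x *m D h *m P = x *m D h.
Proof. by move=> xP; rewrite -mulmxA DE mulmxBr mulmxA xP mul0mx subr0. Qed.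

(** A commutator of two self-adjoint matrices is skew-adjoint. *)
Let chi_skew h a b : gform (a *m chiP h) b = - gform a (b *m chiP h).
Proof.
rewrite /chiP !mulmxBr gformBl gformBr !mulmxA opprB.
by rewrite (gform_adj _ _ (DG h)) !(gform_adj _ _ PG) (gform_adj _ _ (DG h)).
Qed.

Let chi_sym u w : u *m P = u -> w *m P = w -> u *m chiP w = w *m chiP u.
Proof. by move=> uP wP; rewrite !chi_vert // Dsym. Qed.

Let lchi : linear chiP.
Proof.
move=> a x y; rewrite /chiP lD.
have K (c : R) (p d1 d2 : 'M[R]_m) : p *m (c *: d1 + d2) - (c *: d1 + d2) *m p =
    c *: (p *m d1 - d1 *m p) + (p *m d2 - d2 *m p).
  by rewrite mulmxDr mulmxDl -scalemxAl -scalemxAr; mx_abel.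
exact: K.
Qed.

Let chiB a b : chiP (a - b) = chiP a - chiP b.
Proof.
by rewrite addrC -scaleN1r lchi scaleN1r addrC.
Qed.

Let chiN a : chiP (- a) = - chiP a.
Proof. by rewrite -[- a]sub0r chiB -{1}[0](subrr 0) chiB subrr sub0r. Qed.

Lemma oneill_pointwise s' s u w x y z z' :
  s' *m P = s' -> s *m P = s -> u *m P = u -> w *m P = w ->
  x *m P = 0 -> y *m P = 0 -> z *m P = 0 -> z' *m P = 0 ->
  let g := gform in
  let Rtop e h s := s *m Rm e h *m P + s *m (D h *m D e - D e *m D h) in
  let Rbot e h s := s *m Rm e h *m (1%:M - P) + s *m (D h *m D e - D e *m D h) in
  let T h s := s *m chiP (h *m P) in
  let O h s := s *m chiP (h *m (1%:M - P)) in
  let dT e u s := s *m (C e (u *m P) + chiP (u *m D e - u *m P *m Gam e)) in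
  let dA e u s := s *m (C e (u *m (1%:M - P))
    + chiP (- (u *m D e) - u *m (1%:M - P) *m Gam e)) in
  [/\ g (s *m Rm w u) s' =
        g (Rtop w u s) s' + g (T w s) (T u s') - g (T u s) (T w s'),
      g (s *m Rm w u) z = g (dT w u s) z - g (dT u w s) z,
      g (s *m Rm x u) w = g (Rtop x u s) w - g (T u s) (O x w) + g (O x s) (T u w) &
   [/\ g (s *m Rm x u) z =
        g (dT x u s) z - g (dA u x s) z - g (O (O x u) s) z - g (T u x) (T s z),
      g (s *m Rm x y) w = g (Rtop x y s) w - g (O y s) (O x w) + g (O x s) (O y w),
      g (s *m Rm x y) z =
        g (dA x y s) z - g (dA y x s) z - g (O y x) (T s z) + g (O x y) (T s z) &
      g (z *m Rm x y) z' =
        g (Rbot x y z) z' + g (O x z) (O y z') - g (O y z) (O x z')]].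
Proof.
move=> s'P sP uP wP xP yP zP z'P /=.
have Q a : a *m P = 0 -> a *m (1%:M - P) = a.
  by move=> aP; rewrite mulmxBr mulmx1 aP subr0.
rewrite !(Q _ xP) !(Q _ yP) !uP !wP !sP.
have gP a b : b *m P = b -> gform (a *m P) b = gform a b.
  by move=> bP; rewrite (gform_adj _ _ PG) bP.
have gQ a b : b *m P = 0 -> gform (a *m (1%:M - P)) b = gform a b.
  move=> bP; rewrite mulmxBr mulmx1 gformBl (gform_adj _ _ PG) bP.
  by rewrite gform0r subr0.
(* The Gauss-type equation behind {0}, {1'} and {2'}: self-adjointness moves one factor [D] of the
   quadratic correction onto b, turning it into products of values of chi. *)
have sub1 e h a b : a *m P = a -> b *m P = b ->
    gform (a *m Rm e h) b = gform (a *m Rm e h *m P + a *m (D h *m D e - D e *m D h)) b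
      + gform (a *m chiP e) (b *m chiP h) - gform (a *m chiP h) (b *m chiP e).
  move=> aP bP; rewrite !chi_vert // gformDl gP // mulmxBr gformBl !mulmxA.
  rewrite (gform_adj (a *m D h) b (DG e)) (gform_adj (a *m D e) b (DG h)).
  by ring.
(* The horizontal counterpart, for {4}; the minus signs from [chi_hor] cancel in pairs. *)
have sub2 e h a b : a *m P = 0 -> b *m P = 0 ->
    gform (a *m Rm e h) b = gform (a *m Rm e h *m (1%:M - P) + a *m (D h *m D e - D e *m D h)) b
      + gform (a *m chiP e) (b *m chiP h) - gform (a *m chiP h) (b *m chiP e).
  move=> aP bP; rewrite !chi_hor // !gformNl !gformNr !opprK gformDl gQ // mulmxBr gformBl !mulmxA.
  rewrite (gform_adj (a *m D h) b (DG e)) (gform_adj (a *m D e) b (DG h)).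
  by ring.
(* The Codazzi-type equation behind {1}, {2} and {3}: pairing with a horizontal b makes the factor 1
   - P of [CR] invisible. *)
have ricci e h b : b *m P = 0 -> gform (s *m Rm e h) b = gform (s *m C e h) b - gform (s *m C h e) b.
  by move=> bP; rewrite -gQ // -CR // gQ // mulmxBr gformBl.
have swap t : t *m P = t -> gform (s *m chiP t) z = - gform t (z *m chiP s).
  by move=> tP; rewrite (chi_sym sP tP) chi_skew.
have expand c a b : gform (s *m (c + chiP (a - b))) z =
    gform (s *m c) z + gform (s *m chiP a) z - gform (s *m chiP b) z.
  by rewrite chiB mulmxDr mulmxBr gformDl gformBl addrA.
have chiNs a : gform (s *m chiP (- a)) z = - gform (s *m chiP a) z.
  by rewrite chiN mulmxN gformNl.
split; [exact: sub1| |by rewrite (sub1 x u s w) //; ring|split; [| | |exact: sub2]].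
(* For {1}, the extra terms chi_(u D_w) and chi_(w D_u) coincide, as do the Christoffel terms, so
   they cancel in the difference. *)
- rewrite (ricci _ _ _ zP) !expand (Gsym u w) (Dsym uP wP).
  by ring.
(* For {2}, u D_x = A_x u is horizontal, so its chi term cancels the iterated A. The vector x D_u =
   - T_u x is vertical, and [swap] turns its chi term into the product of two T. *)
- rewrite (ricci _ _ _ zP) !expand chiNs (Gsym u x) (chi_vert x uP) (chi_hor u xP).
  rewrite (Q (u *m D x)) ?D_vert // gformNl (swap (x *m D u)) ?D_hor //.
  by ring.
- by rewrite (sub1 x y s w) //; ring.
(* For {3}, both x D_y = - A_y x and y D_x = - A_x y are vertical, and [swap] accounts for the two
   mixed terms. *)
- rewrite (ricci _ _ _ zP) !expand !chiNs (Gsym y x).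
  rewrite (chi_hor y xP) (chi_hor x yP) !gformNl.
  rewrite (swap (x *m D y)) ?(swap (y *m D x)) ?D_hor //.
  by ring.
Qed.

End PointwiseAlgebra.

(** * Vector fields and anisotropic connections in a chart *)

Section Charts.
Context {R : realType} {n : nat} {M : manifold R n}.
Implicit Types (i j k : chart M) (p q : M) (U : set M).

Definition transition i j : 'rV[R]_n -> 'rV[R]_n := cmap j \o cinv i.

Lemma open_cmap i U : open U -> open (cmap i @` (U `&` cdom i)).
Proof.
move=> oU; rewrite openE => _ [q [Uq iq] <-].
have n1 : nbhs (cmap i q) (cmap i @` cdom i).
  by apply: open_nbhs_nbhs; split; [exact: open_cimage|exists q].
have n2 : nbhs (cmap i q) (cinv i @^-1` U).
  apply: (cinv_continuous iq); rewrite cmapK //.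
  exact: open_nbhs_nbhs.
apply: filterS (filterI n1 n2) => _ [[r ir <-]] /=; rewrite cmapK // => Ur.
by exists r.
Qed.

Lemma open_overlap i j : open (cmap i @` (cdom i `&` cdom j)).
Proof. by rewrite setIC; apply: open_cmap; exact: open_cdom. Qed.

Lemma smooth_transition i j : smooth_on (cmap i @` (cdom i `&` cdom j)) (transition i j).
Proof. exact: transition_smooth. Qed.

Lemma is_diff_transition i j q : cdom i q -> cdom j q ->
  is_diff (cmap i q) (transition i j) ('d (transition i j) (cmap i q)).
Proof. by move=> iq jq; apply: (smooth_diff (smooth_transition i j)); exists q. Qed.

Lemma near_overlap i j q : cdom i q -> cdom j q ->
  \forall x \near cmap i q, cdom i (cinv i x) /\ cdom j (cinv i x).
Proof.
move=> iq jq; have : nbhs (cmap i q) (cmap i @` (cdom i `&` cdom j)).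
  by apply: open_nbhs_nbhs; split; [exact: open_overlap|exists q].
by apply: filterS => _ [r [ir jr] <-]; rewrite cmapK.
Qed.

Lemma diff_transition_comp i j k q v : cdom i q -> cdom j q -> cdom k q ->
  'd (transition j k) (cmap j q) ('d (transition i j) (cmap i q) v) =
  'd (transition i k) (cmap i q) v.
Proof.
move=> iq jq kq; have d1 := is_diff_transition iq jq.
have e : transition i j (cmap i q) = cmap j q by rewrite /transition /= cmapK.
have d2 : is_diff (transition i j (cmap i q)) (transition j k) ('d (transition j k) (cmap j q)).
  by rewrite e; exact: is_diff_transition.
have d3 := is_diff_comp d1 d2.
apply: etrans (esym (is_diff_val v d3)) _.
apply: diff_near; last exact: (@ex_diff _ _ _ _ _ _ _ d3).
by apply: filterS (near_overlap iq jq) => x [ix jx]; rewrite /transition /= cmapK.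
Qed.

Lemma diff_transition_id i q v : cdom i q -> 'd (transition i i) (cmap i q) v = v.
Proof.
move=> iq; have d : is_diff (cmap i q) id id := is_diff_id _.
apply: etrans _ (is_diff_val v d); apply/esym/diff_near; last exact: (@ex_diff _ _ _ _ _ _ _ d).
have : nbhs (cmap i q) (cmap i @` cdom i).
  by apply: open_nbhs_nbhs; split; [exact: open_cimage|exists q].
by apply: filterS => _ [r ir <-]; rewrite /transition /= cmapK.
Qed.

Lemma tcoord_tvect i j q w : cdom i q -> cdom j q ->
  tcoord j (tvect i q w) = 'd (transition i j) (cmap i q) w.
Proof. by move=> iq jq; exact: (diff_transition_comp w iq (cdom_chart_at q) jq). Qed.

Lemma tvectK i q w : cdom i q -> tcoord i (tvect i q w) = w.
Proof. by move=> iq; exact: etrans (tcoord_tvect w iq iq) (diff_transition_id w iq). Qed.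

Lemma tcoordK i q (v : tangent q) : cdom i q -> tvect i q (tcoord i v) = v.
Proof.
move=> iq; have cq := cdom_chart_at q.
exact: etrans (diff_transition_comp v cq iq cq) (diff_transition_id v cq).
Qed.

Lemma tcoord_chart_at q (v : tangent q) : tcoord (chart_at q) v = v.
Proof. exact: diff_transition_id v (cdom_chart_at q). Qed.

Lemma tvect_chart_at q (w : 'rV[R]_n) : tvect (chart_at q) q w = w.
Proof. exact: diff_transition_id w (cdom_chart_at q). Qed.

Lemma tcoord_transition i j q (v : tangent q) : cdom i q -> cdom j q ->
  tcoord j v = 'd (transition i j) (cmap i q) (tcoord i v).
Proof. by move=> iq jq; rewrite -tcoord_tvect // tcoordK. Qed.

Lemma tcoord_linear i q : linear (fun v : tangent q => tcoord i v).
Proof. by move=> a x y; exact: diff_linearP. Qed.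

Lemma tcoordD i q (x y : tangent q) : tcoord i (x + y : tangent q) = tcoord i x + tcoord i y.
Proof. by have := tcoord_linear i (q := q) 1 x y; rewrite !scale1r. Qed.

Lemma tcoordB i q (x y : tangent q) : tcoord i (x - y : tangent q) = tcoord i x - tcoord i y.
Proof.
have := tcoord_linear i (q := q) (-1) y x; rewrite !scaleN1r => H.
by rewrite addrC H addrC.
Qed.

Lemma tvect_linear i q : linear (fun w : 'rV[R]_n => tvect i q w).
Proof. by move=> a x y; exact: diff_linearP. Qed.

Definition vhat i (E : vfield M) (x : 'rV[R]_n) : 'rV[R]_n := tcoord i (E (cinv i x)).

(** One chart containing U decides smoothness: in any other chart the components are multiplied by
    the differential of a transition map. *)
Lemma smooth_vfieldP i U (E : vfield M) : open U -> U `<=` cdom i ->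
  smooth_on (cmap i @` U) (vhat i E) -> smooth_vfield U E.
Proof.
move=> oU Ui sE j k; set D := cmap j @` (U `&` cdom j).
have oD : open D by exact: open_cmap.
have oU' : open (cmap i @` U).
  by have := open_cmap (i := i) oU; rewrite (setIidl Ui).
have DE x : D x -> (cmap i @` (cdom i `&` cdom j)) (transition j i x).
  by move=> [q [Uq jq] <-]; exists q; rewrite /transition /= ?cmapK //; split => //; exact: Ui.
have DU x : D x -> (cmap i @` U) (transition j i x).
  by move=> [q [Uq jq] <-]; exists q; rewrite /transition /= ?cmapK.
have st : Ck k D (transition j i).
  apply: Ck_sub (smooth_transition j i k) => _ [q [Uq jq] <-].
  by exists q => //; split => //; exact: Ui.
apply: (@Ck_ext _ _ _ _ _ (fun x => 'd (transition i j) (transition j i x)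
   (vhat i E (transition j i x)))) => //.
  move=> _ [q [Uq jq] <-]; have iq := Ui _ Uq.
  have tq : transition j i (cmap j q) = cmap i q by rewrite /transition /= cmapK.
  rewrite tq /vhat; rewrite !cmapK //; exact/esym/tcoord_transition.
apply: (Ck_diff (E := cmap i @` (cdom i `&` cdom j))) => //.
- exact: fin_dim_rV.
- exact: open_overlap.
- by apply: (Ck_comp (E := cmap i @` U)) => //; exact: fin_dim_rV.
- exact: smooth_transition.
Qed.

Lemma smooth_funP i U (f : M -> R) : open U -> U `<=` cdom i ->
  smooth_on (cmap i @` U) (f \o cinv i) -> smooth_fun U f.
Proof.
move=> oU Ui sf j k; set D := cmap j @` (U `&` cdom j).
have oD : open D by exact: open_cmap.
have oU' : open (cmap i @` U).
  by have := open_cmap (i := i) oU; rewrite (setIidl Ui).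
have DU x : D x -> (cmap i @` U) (transition j i x).
  by move=> [q [Uq jq] <-]; exists q; rewrite /transition /= ?cmapK.
have st : Ck k D (transition j i).
  apply: Ck_sub (smooth_transition j i k) => _ [q [Uq jq] <-].
  by exists q => //; split => //; exact: Ui.
apply: (@Ck_ext _ _ _ _ _ (fun x => (f \o cinv i) (transition j i x))) => //.
  move=> _ [q [Uq jq] <-]; have iq := Ui _ Uq.
  by rewrite /transition /= !cmapK.
by apply: (Ck_comp (E := cmap i @` U)) => //; exact: fin_dim_rV.
Qed.

Lemma smooth_vhat i U (E : vfield M) : open U -> U `<=` cdom i ->
  smooth_vfield U E -> smooth_on (cmap i @` U) (vhat i E).
Proof. by move=> oU Ui /(_ i); rewrite (setIidl Ui). Qed.

Lemma dfunE i q (f : M -> R) (e : tangent q) : cdom i q ->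
  differentiable (f \o cinv i) (cmap i q) ->
  dfun f e = 'd (f \o cinv i) (cmap i q) (tcoord i e).
Proof.
move=> iq df; rewrite /dfun /pos; set c := chart_at q.
have cq : cdom c q by exact: cdom_chart_at.
have d1 := is_diff_transition cq iq.
have et : transition c i (cmap c q) = cmap i q by rewrite /transition /= cmapK.
have d2 : is_diff (transition c i (cmap c q)) (f \o cinv i) ('d (f \o cinv i) (cmap i q)).
  by rewrite et; exact: differentiableP.
have d3 := is_diff_comp d1 d2.
apply: etrans _ (is_diff_val e d3); apply/esym/diff_near; last exact: (@ex_diff _ _ _ _ _ _ _ d3).
by apply: filterS (near_overlap cq iq) => x [cx ix]; rewrite /transition /= cmapK.
Qed.

Lemma cinv_dom i x : (cmap i @` cdom i) x -> cdom i (cinv i x) /\ cmap i (cinv i x) = x.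
Proof. by move=> [q iq <-]; rewrite cmapK. Qed.

Lemma vhat_ext q e x : (cmap (chart_at q) @` cdom (chart_at q)) x ->
  vhat (chart_at q) (ext (p := q) e) x = e.
Proof. by move=> /cinv_dom[dx _]; rewrite /vhat /ext tvectK. Qed.

Lemma smooth_ext q (e : tangent q) : smooth_vfield (cdom (chart_at q)) (ext e).
Proof.
apply: (smooth_vfieldP (i := chart_at q)) => //; first exact: open_cdom.
move=> k; apply: (@Ck_ext _ _ _ _ _ (fun _ => e)) => //; first exact: open_cimage.
  by move=> x /vhat_ext ->.
exact: Ck_cst.
Qed.

End Charts.

Section VectorFields.
Context {R : realType} {n : nat} {M : manifold R n}.
Implicit Types (i j : chart M) (p q : M) (U : set M).

Lemma tcoord_sum i q I (r : seq I) (f : I -> R) (v : I -> tangent q) :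
  tcoord i (\sum_(k <- r) f k *: v k) = \sum_(k <- r) f k *: tcoord i (v k).
Proof. by rewrite /tcoord linear_sum; apply: eq_bigr => k _; rewrite linearZ. Qed.

Lemma tvect_sum i q I (r : seq I) (f : I -> R) (v : I -> 'rV[R]_n) :
  tvect i q (\sum_(k <- r) f k *: v k) = \sum_(k <- r) f k *: tvect i q (v k).
Proof. by rewrite /tvect linear_sum; apply: eq_bigr => k _; rewrite linearZ. Qed.

Lemma smooth_vfield_sum U I (r : seq I) (f : I -> M -> R) (H : I -> vfield M) : open U ->
  (forall k, smooth_fun U (f k)) -> (forall k, smooth_vfield U (H k)) ->
  smooth_vfield U (fun q => \sum_(k <- r) f k q *: H k q).
Proof.
move=> oU sf sH i d; have oD := open_cmap (i := i) oU.
apply: (@Ck_ext _ _ _ _ _ (fun x => \sum_(k <- r) f k (cinv i x) *: tcoord i (H k (cinv i x)))) => //.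
  by move=> x _; rewrite tcoord_sum.
apply: Ck_sum => // k _; apply: Ck_scale => //; [exact: (sf k i d)|exact: (sH k i d)].
Qed.

Lemma smooth_fun_cst U (a : R) : smooth_fun U (fun _ : M => a).
Proof. by move=> i k; exact: Ck_cst. Qed.

Lemma dfun_cst (a : R) q (e : tangent q) : dfun (fun _ : M => a) e = 0.
Proof. by rewrite /dfun (_ : _ \o _ = cst a) // diff_cst. Qed.

(** The bracket at q is computed in the chart at q, where the fields constant in the chart at p have
    the first derivatives of the transition map as components. Their bracket is a difference of
    mixed second derivatives. *)
Lemma bracket_ext p (e h : tangent p) q : cdom (chart_at p) q ->
  bracket (ext e) (ext h) q = 0.
Proof.
set c := chart_at p => cq; set c' := chart_at q.
have c'q : cdom c' q by exact: cdom_chart_at.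
have sT := smooth_transition c c'.
have cqin : (cmap c @` (cdom c `&` cdom c')) (cmap c q) by exists q.
have dT := is_diff_transition c'q cq.
have tq : transition c' c (cmap c' q) = cmap c q by rewrite /transition /= cmapK.
have key (a b : 'rV[R]_n) : 'd (fun x => tcoord c' (ext (p := p) a (cinv c' x))) (pos q) (ext (p := p) b q)
    = 'd (fun y => 'd (transition c c') y a) (cmap c q) b.
  have [_ /(_ a) [d2 _]] := sT 2%N.
  have d2' : is_diff (transition c' c (cmap c' q)) (fun y => 'd (transition c c') y a)
      ('d (fun y => 'd (transition c c') y a) (cmap c q)).
    by rewrite tq; apply: differentiableP; apply: d2.
  have d3 := is_diff_comp dT d2'.
  have eb : 'd (transition c' c) (cmap c' q) (ext (p := p) b q) = b.
    exact: tvectK.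
  rewrite -[in RHS]eb.
  apply: etrans _ (is_diff_val _ d3); apply/esym/diff_near; last exact: (@ex_diff _ _ _ _ _ _ _ d3).
  apply: filterS (near_overlap c'q cq) => x [c'x cx].
  by rewrite /ext tcoord_tvect.
apply/eqP; rewrite subr_eq0; apply/eqP.
apply: etrans (key h e) _; apply: etrans _ (esym (key e h)).
have S := diff_sym (e : 'rV[R]_n) (h : 'rV[R]_n) (@open_overlap _ _ _ c c') cqin (sT 2%N).
exact: S.
Qed.

End VectorFields.

Section ConnectionSums.
Context {R : realType} {n : nat} {M : manifold R n}.
Variables (A : forall p : M, set (tangent p)) (nab : vfield M -> vfield M -> avfield M).
Hypothesis Hac : anisotropic_connection A nab.
Implicit Types (U : set M) (E H : vfield M).

Lemma nab_sumr U E I (r : seq I) (f : I -> M -> R) (H : I -> vfield M)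
    q (z : tangent q) : open U -> U q -> A z ->
  smooth_vfield U E -> (forall k, smooth_fun U (f k)) -> (forall k, smooth_vfield U (H k)) ->
  nab E (fun q => \sum_(k <- r) f k q *: H k q) z =
  \sum_(k <- r) (dfun (f k) (E q) *: H k q + f k q *: nab E (H k) z).
Proof.
move=> oU Uq Az sE sf sH; elim: r => [|k r IH].
  (* The axioms speak of sums and multiples, so the zero field is presented as 0 times a smooth
     field. *)
  have -> : (fun q => \sum_(k <- [::]) f k q *: H k q) = (fun q => (0 : R) *: E q).
    by apply/functional_extensionality_dep => q'; rewrite big_nil scale0r.
  rewrite (ac_leibniz Hac oU (smooth_fun_cst U 0) sE sE Uq Az).
  by rewrite dfun_cst !scale0r big_nil addr0.
have -> : (fun q => \sum_(k <- k :: r) f k q *: H k q) =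
    (fun q => (f k q *: H k q) + \sum_(k <- r) f k q *: H k q).
  by apply/functional_extensionality_dep => q'; rewrite big_cons.
have sfH : smooth_vfield U (fun q => f k q *: H k q).
  have -> : (fun q => f k q *: H k q) = (fun q => \sum_(k <- [:: k]) f k q *: H k q).
    by apply/functional_extensionality_dep => q'; rewrite big_seq1.
  exact: smooth_vfield_sum.
rewrite (ac_addr Hac oU sE sfH (smooth_vfield_sum r oU sf sH) Uq Az).
by rewrite big_cons -IH (ac_leibniz Hac oU (sf k) sE (sH k) Uq Az).
Qed.

Lemma nab_suml U E I (r : seq I) (f : I -> M -> R) (H : I -> vfield M)
    q (z : tangent q) : open U -> U q -> A z ->
  smooth_vfield U E -> (forall k, smooth_fun U (f k)) -> (forall k, smooth_vfield U (H k)) ->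
  nab (fun q => \sum_(k <- r) f k q *: H k q) E z =
  \sum_(k <- r) f k q *: nab (H k) E z.
Proof.
move=> oU Uq Az sE sf sH; elim: r => [|k r IH].
  have -> : (fun q => \sum_(k <- [::]) f k q *: H k q) = (fun q => (0 : R) *: E q).
    by apply/functional_extensionality_dep => q'; rewrite big_nil scale0r.
  rewrite (ac_scalel Hac oU (smooth_fun_cst U 0) sE sE Uq Az).
  by rewrite scale0r big_nil.
have -> : (fun q => \sum_(k <- k :: r) f k q *: H k q) =
    (fun q => (f k q *: H k q) + \sum_(k <- r) f k q *: H k q).
  by apply/functional_extensionality_dep => q'; rewrite big_cons.
have sfH : smooth_vfield U (fun q => f k q *: H k q).
  have -> : (fun q => f k q *: H k q) = (fun q => \sum_(k <- [:: k]) f k q *: H k q).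
    by apply/functional_extensionality_dep => q'; rewrite big_seq1.
  exact: smooth_vfield_sum.
rewrite (ac_addl Hac oU sfH (smooth_vfield_sum r oU sf sH) sE Uq Az).
by rewrite big_cons -IH (ac_scalel Hac oU (sf k) (sH k) sE Uq Az).
Qed.

End ConnectionSums.

(** * An anisotropic connection read in one fixed chart *)

Section ChartConnection.
Context {R : realType} {m : nat} {M : manifold R m}.
Let Z : normedModType R := ('rV[R]_m * 'rV[R]_m)%type.
Variables (A : forall p : M, set (tangent p)) (nab : vfield M -> vfield M -> avfield M).
Hypotheses (oA : open_tangent A) (Hac : anisotropic_connection A nab).
Variable p0 : M.
Implicit Types (U : set M) (E H : vfield M) (X : avfield M).
Let c := chart_at p0.

Definition hat X (z : Z) : 'rV[R]_m := tcoord c (X (cinv c z.1) (tvect c (cinv c z.1) z.2)).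

(** The row index is that of the differentiated coordinate field, so that [s *m christoffel e z] is
    the derivative along e of the field with constant components s. *)
Definition christoffel_mx (j : 'I_m) (z : Z) : 'M[R]_m := \matrix_(k, l)
  hat (nab (ext (p := p0) (delta_mx 0 j)) (ext (p := p0) (delta_mx 0 k))) z 0 l.

Lemma hatE X q (v : tangent q) : cdom c q -> hat X (cmap c q, tcoord c v) = tcoord c (X q v).
Proof. by move=> cq; rewrite /hat /= cmapK // tcoordK. Qed.

Lemma timageP (D : forall p : M, set (tangent p)) (z : Z) : timage c D z ->
  exists q (v : tangent q), [/\ cdom c q, D q v & z = (cmap c q, tcoord c v)].
Proof.
case: z => x w [/= /cinv_dom[cx ex] Dv].
exists (cinv c x), (tvect c (cinv c x) w); split=> //.
by rewrite tvectK // ex.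
Qed.

Lemma timage_pair (D : forall p : M, set (tangent p)) q (v : tangent q) :
  cdom c q -> D q v -> timage c D (cmap c q, tcoord c v).
Proof. by move=> cq Dv; split=> /=; [exists q|rewrite cmapK // tcoordK]. Qed.

Lemma smooth_christoffel_mx j : smooth_on (timage c A) (christoffel_mx j).
Proof.
move=> d.
have s k : Ck d (timage c A) (hat (nab (ext (p := p0) (delta_mx 0 j)) (ext (p := p0) (delta_mx 0 k)))).
  have := ac_smooth Hac (open_cdom c) (smooth_ext (q := p0) (delta_mx 0 j))
    (smooth_ext (q := p0) (delta_mx 0 k)) c d.
  apply: Ck_sub => z [iz Az]; split=> //; split=> //.
  by have [] := cinv_dom iz.
apply: Ck_mx => [|k l]; first exact: oA.
apply: (@Ck_ext _ _ _ _ _ (fun z => hat (nab (ext (p := p0) (delta_mx 0 j))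
  (ext (p := p0) (delta_mx 0 k))) z 0 l : R)); first exact: oA.
  by move=> z _; rewrite mxE.
by apply: Ck_coord; [exact: oA|exact: s].
Qed.

Lemma smooth_vfield_sub U U' E : U' `<=` U -> smooth_vfield U E -> smooth_vfield U' E.
Proof.
move=> UU sE i d; apply: Ck_sub (sE i d) => _ [q [/UU Uq iq] <-].
by exists q.
Qed.

Lemma open_image U : open U -> U `<=` cdom c -> open (cmap c @` U).
Proof. by move=> oU Uc; have := open_cmap (i := c) oU; rewrite (setIidl Uc). Qed.

Lemma smooth_component U E j : open U -> U `<=` cdom c -> smooth_vfield U E ->
  smooth_fun U (fun q => tcoord c (E q) 0 j : R).
Proof.
move=> oU Uc sE; apply: (smooth_funP (i := c)) => // d.
apply: Ck_coord; first exact: open_image.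
exact: smooth_vhat.
Qed.

Lemma vfield_expand E q : cdom c q ->
  \sum_j tcoord c (E q) 0 j *: ext (p := p0) (delta_mx 0 j) q = E q.
Proof. by move=> cq; rewrite /ext -/c -tvect_sum -row_sum_delta tcoordK. Qed.

Lemma tcoord_ext (e : tangent p0) q : cdom c q -> tcoord c (ext e q) = e.
Proof. by move=> cq; rewrite /ext tvectK. Qed.

(** By locality E and H may be replaced by their expansions in coordinate fields; linearity in E and
    the Leibniz rule in H give the two terms. *)
Lemma tcoord_nab U E H q (v : tangent q) : open U -> U `<=` cdom c -> U q -> A v ->
  smooth_vfield U E -> smooth_vfield U H ->
  tcoord c (nab E H v) = 'd (vhat c H) (cmap c q) (tcoord c (E q))
    + tcoord c (H q) *m christoffel christoffel_mx (tcoord c (E q)) (cmap c q, tcoord c v).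
Proof.
move=> oU Uc Uq Av sE sH; have cq := Uc _ Uq.
pose f E j q := tcoord c (E q) 0 j : R.
pose D j : vfield M := ext (p := p0) (delta_mx 0 j).
have sf E' j : smooth_vfield U E' -> smooth_fun U (f E' j) by exact: smooth_component.
have sD j : smooth_vfield U (D j) by apply: smooth_vfield_sub (smooth_ext (q := p0) _).
have sS E' : smooth_vfield U E' -> smooth_vfield U (fun q => \sum_j f E' j q *: D j q).
  by move=> sE'; apply: smooth_vfield_sum => // j; exact: sf.
have dH : is_diff (cmap c q) (vhat c H) ('d (vhat c H) (cmap c q)).
  by apply: (smooth_diff (smooth_vhat oU Uc sH)); exists q.
have -> : nab E H v = nab (fun q => \sum_j f E j q *: D j q) (fun q => \sum_j f H j q *: D j q) v.
  by rewrite (ac_local Hac oU sE sH _ _ Uq Av) // => q' /Uc cq'; exact: vfield_expand.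
rewrite (nab_suml Hac _ oU Uq Av (sS _ sH) (sf E ^~ sE) sD) tcoord_sum.
have dHe : 'd (vhat c H) (cmap c q) (tcoord c (E q)) =
    \sum_j tcoord c (E q) 0 j *: 'd (vhat c H) (cmap c q) (delta_mx 0 j).
  rewrite {1}(row_sum_delta (tcoord c (E q))) linear_sum.
  by apply: eq_bigr => j _; rewrite linearZ.
rewrite dHe /christoffel mulmx_sumr -big_split /=; apply: eq_bigr => j _.
rewrite -scalemxAr -scalerDr; congr (_ *: _).
rewrite (nab_sumr Hac _ oU Uq Av (sD j) (sf H ^~ sH) sD).
rewrite big_split tcoordD !tcoord_sum /=; congr (_ + _).
  rewrite [RHS]row_sum_delta; apply: eq_bigr => k _.
  rewrite tcoord_ext // (diff_coord _ _ _ (@ex_diff _ _ _ _ _ _ _ dH)); congr (_ *: _).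
  rewrite (dfunE _ cq); last first.
    exact: (@ex_diff _ _ _ _ _ _ _ (is_diff_linear_comp (@coord_linear _ _ _ 0 k)
      (@coord_continuous _ _ _ _ _) dH)).
  by rewrite tcoord_ext.
rewrite mulmx_sum_row; apply: eq_bigr => k _; congr (_ *: _).
by apply/rowP => l; rewrite !mxE hatE.
Qed.

(** The extension V of v used by [nabla_av] is constant in the chart at q, hence has a nonzero
    derivative V' in the chart at p0. It cancels: dX(e, V') from the first term minus dX(0, V' + v
    Gamma_e) from the second is dX along the horizontal lift of e. *)
Lemma tcoord_nabla_av (W : set Z) U E X q (v : tangent q) :
  open W -> smooth_on W (hat X) -> open U -> U q -> cdom c q -> A v ->
  smooth_vfield U E -> W (cmap c q, tcoord c v) ->
  tcoord c (nabla_av nab E X q v) =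
  covv christoffel_mx (tcoord c (E q)) (hat X) (cmap c q, tcoord c v).
Proof.
move=> oW sX oU Uq cq Av sE Wv; set c' := chart_at q.
have c'q : cdom c' q by exact: cdom_chart_at.
pose V : vfield M := ext v; have Vq : V q = v by exact: tvect_chart_at.
have sV := smooth_ext v; rewrite -/c' in sV.
pose U1 := cdom c `&` cdom c'.
have oU1 : open U1 by apply: openI; exact: open_cdom.
have U1c : U1 `<=` cdom c by move=> r [].
have sV1 : smooth_on (cmap c @` U1) (vhat c V).
  by apply: smooth_vhat => //; apply: smooth_vfield_sub sV => r [].
pose psi x : Z := (x, vhat c V x).
have spsi : smooth_on (cmap c @` U1) psi.
  move=> d; apply: Ck_pair; first exact: open_image.
    by apply: (@Ck_linear _ _ _ _ _ (fun x => x)) => // x; exact: cvg_id.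
  exact: sV1.
(* W is only a neighbourhood of the one vector v, so the base is shrunk until the section V stays
   inside W. *)
pose U2 := U1 `&` cmap c @^-1` (psi @^-1` W).
have oU2 : open U2.
  rewrite openE => r [U1r Wr].
  have n1 : nbhs r U1 by apply: open_nbhs_nbhs.
  have cr : cdom c r by exact: U1c.
  have k1 : {for cmap c r, continuous psi}.
    by apply: (Ck_cts (spsi 0%N)); exists r.
  have k2 : {for r, continuous (psi \o cmap c)}.
    by apply: continuous_comp; [exact: cmap_continuous|exact: k1].
  have n3 : nbhs r ((psi \o cmap c) @^-1` W) by apply: k2; apply: open_nbhs_nbhs.
  exact: filterI n1 n3.
pose U3 := U `&` U2.
have oU3 : open U3 by apply: openI.
have U3c : U3 `<=` cdom c by move=> r [_ [/U1c]].
have psiq : psi (cmap c q) = (cmap c q, tcoord c v).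
  by rewrite /psi /vhat cmapK // Vq.
have U3q : U3 q by split => //; split => //; rewrite /= psiq.
pose Y : vfield M := fun r => X r (V r).
have YE x : (cmap c @` U3) x -> hat X (psi x) = vhat c Y x.
  move=> [r /U3c cr <-]; rewrite /hat /psi /vhat /= !cmapK // tcoordK //.
have oC3 := open_image oU3 U3c.
have sXpsi : smooth_on (cmap c @` U3) (fun x => hat X (psi x)).
  move=> d; apply: (Ck_comp (E := W)) => //.
  - exact: fin_dimZ.
  - by move=> _ [r [_ [_ Wr]] <-].
  - by apply: Ck_sub (spsi d) => _ [r [_ [U1r _]] <-]; exists r.
have sY : smooth_vfield U3 Y.
  apply: (smooth_vfieldP (i := c)) => // d.
  by apply: Ck_ext (sXpsi d) => // x; exact: YE.
have sV3 : smooth_vfield U3 V by apply: smooth_vfield_sub sV => r [_ [[]]].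
have sE3 : smooth_vfield U3 E by apply: smooth_vfield_sub sE => r [].
have xin : (cmap c @` U3) (cmap c q) by exists q.
have dXh := smooth_diff sX Wv.
have dV : is_diff (cmap c q) (vhat c V) ('d (vhat c V) (cmap c q)).
  by apply: (smooth_diff (smooth_vhat oU3 U3c sV3)).
have dpsi : is_diff (cmap c q) psi (fun e => (e, 'd (vhat c V) (cmap c q) e)).
  by apply: is_diff_pair dV; exact: is_diff_id.
have dXh' : is_diff (psi (cmap c q)) (hat X) ('d (hat X) (cmap c q, tcoord c v)).
  by rewrite psiq.
have dY e : 'd (vhat c Y) (cmap c q) e =
    'd (hat X) (cmap c q, tcoord c v) (e, 'd (vhat c V) (cmap c q) e).
  apply: etrans _ (is_diff_val e (is_diff_comp dpsi dXh')); apply/esym/diff_near; last first.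
    exact: (@ex_diff _ _ _ _ _ _ _ (is_diff_comp dpsi dXh')).
  have := open_nbhs_nbhs (conj oC3 xin); apply: filterS => x; exact: YE.
have N1 := tcoord_nab oU3 U3c U3q Av sE3 sY.
have N2 := tcoord_nab oU3 U3c U3q Av sE3 sV3.
set a := nab E V v in N2.
have dXq : is_diff v (X q) (fun e : tangent q =>
    tvect c q ('d (hat X) (cmap c q, tcoord c v) (0, tcoord c e))).
  have -> : X q = fun y => tvect c q (hat X (cmap c q, tcoord c y)).
    by apply/funext => y; rewrite hatE // tcoordK.
  have dt : is_diff v (fun y : tangent q => tcoord c y) (fun y : tangent q => tcoord c y).
    apply: is_diff_linear; first exact: tcoord_linear.
    by apply: linear_mx_continuous; exact: tcoord_linear.
  have dp := is_diff_pair (is_diff_const (cmap c q) v) dt.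
  have dh := is_diff_comp dp dXh.
  apply: is_diff_linear_comp dh; first exact: tvect_linear.
  by apply: linear_mx_continuous; exact: tvect_linear.
have DX : tcoord c ('D_a (X q) v) = 'd (hat X) (cmap c q, tcoord c v) (0, tcoord c a).
  rewrite (deriveE _ (@ex_diff _ _ _ _ _ _ _ dXq)).
  by rewrite (is_diff_val a dXq) tvectK.
have K (f : {linear Z -> 'rV[R]_m}) (n d e w w' y g t : 'rV[R]_m) :
    n = t + y -> t = f (e, w) -> d = f (0, w') -> w' = w + g -> n - d = f (e, - g) + y.
  move=> -> -> -> ->; rewrite addrAC -linearB; congr (f _ + _).
  by rewrite -[LHS]/(_ - _, _ - _) /= subr0 opprD addrA subrr sub0r.
have Yq : tcoord c (Y q) = hat X (cmap c q, tcoord c v) by rewrite hatE // /Y Vq.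
have Vq' : tcoord c (V q) = tcoord c v by rewrite Vq.
rewrite Yq in N1; rewrite Vq' in N2.
apply: etrans (tcoordB _ _ _) _.
exact: (K _ _ _ _ _ _ _ _ _ N1 (dY _) DX N2).
Qed.

Lemma hat_nabla_av (W : set Z) U E X z :
  open W -> smooth_on W (hat X) -> open U -> U (cinv c z.1) ->
  timage c A z -> smooth_vfield U E -> W z ->
  hat (nabla_av nab E X) z = covv christoffel_mx (vhat c E z.1) (hat X) z.
Proof.
move=> oW sX oU Uq Az sE Wz; have [q [v [cq Av ez]]] := timageP Az.
rewrite ez /= cmapK // in Uq; rewrite ez in Wz; rewrite ez hatE //.
by rewrite (tcoord_nabla_av oW sX oU Uq cq Av sE Wz) /vhat /= cmapK.
Qed.

End ChartConnection.

Lemma unitmx_inj (F : fieldType) m (G : 'M[F]_m) :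
  (forall u : 'rV_m, u *m G = 0 -> u = 0) -> G \in unitmx.
Proof.
move=> h; rewrite -row_free_unit -kermx_eq0; apply/rowV0P => u.
by move=> /sub_kermxP; exact: h.
Qed.

(** * The fundamental tensor and the vertical projection in a chart *)

Section OrthogonalProjection.
Variables (F : fieldType) (m n : nat) (G : 'M[F]_m) (S : 'M[F]_(m, n)).
Hypotheses (Gt : G^T = G) (uG : G \in unitmx).
Hypothesis surjS : forall b : 'rV_n, exists e : 'rV_m, e *m S = b.
Hypothesis ndS : forall w : 'rV_m, w *m S = 0 ->
  (forall u : 'rV_m, u *m S = 0 -> w *m G *m u^T = 0) -> w = 0.

(* With [S] the matrix of the submersion, the G-horizontal vectors are the rows in
   the image of [S^T *m invmx G]; solving [y *m S = e *m S] there gives the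
   horizontal part of [e]. *)
Definition gram := S^T *m invmx G *m S.
Definition hproj := S *m invmx gram *m S^T *m invmx G.

(** If a is in the kernel, then y = a S^T G^-1 is vertical because y S = 0, and orthogonal to every
    vertical u because y G u^T = a (u S)^T = 0. Non-degeneracy gives y = 0, hence a S^T = 0, and
    surjectivity of S gives a = 0. *)
Lemma gram_unit : gram \in unitmx.
Proof.
apply: unitmx_inj => a; rewrite /gram !mulmxA => aK.
have y0 : a *m S^T *m invmx G = 0.
  apply: ndS => // u uS.
  by rewrite mulmxKV // -mulmxA -trmx_mul uS trmx0 mulmx0.
have aS : a *m S^T = 0 by rewrite -(mulmxKV uG (a *m S^T)) y0 mul0mx.
apply/rowP => k; have [e eS] := surjS (delta_mx 0 k).
have : a *m (e *m S)^T = 0 by rewrite trmx_mul mulmxA aS mul0mx.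
rewrite eS => /matrixP/(_ 0 0); rewrite trmx_delta !mxE.
rewrite (bigD1 k) //= big1 => [|i ik]; last by rewrite mxE eqxx andbT (negbTE ik) mulr0.
by rewrite mxE !eqxx mulr1 addr0.
Qed.

Lemma hproj_S : hproj *m S = S.
Proof.
rewrite /hproj -!mulmxA [S^T *m (invmx G *m S)]mulmxA -/gram mulVmx ?mulmx1 //.
exact: gram_unit.
Qed.

Lemma hproj_horizontal (e w : 'rV_m) : w *m S = 0 -> e *m hproj *m G *m w^T = 0.
Proof.
move=> wS; rewrite /hproj !mulmxA mulmxKV // -!mulmxA -trmx_mul wS.
by rewrite trmx0 !mulmx0.
Qed.

Lemma hproj_vertical (e : 'rV_m) : e *m S = 0 -> e *m hproj = 0.
Proof. by move=> eS; rewrite /hproj !mulmxA eS !mul0mx. Qed.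

Lemma hproj_selfadjoint : hproj *m G = G *m hproj^T.
Proof.
have Kt : gram^T = gram.
  by rewrite /gram !trmx_mul trmxK trmx_inv Gt mulmxA.
rewrite /hproj mulmxKV // !trmx_mul trmxK !trmx_inv Kt Gt !mulmxA mulmxV // mul1mx.
by [].
Qed.

End OrthogonalProjection.

Section LineDerivative.
Context {R : realType} {V : normedModType R}.

Lemma is_diff_line (z v : V) (t : R) : is_diff t (fun t : R => z + t *: v) (fun s : R => s *: v).
Proof.
have := is_diff_add (is_diff_const z t) (is_diff_scalel t v).
by congr (is_diff _ _ _); apply/funext => s; exact: add0r.
Qed.

Lemma derive1_line (F : V -> R) (z v : V) : differentiable F z ->
  derive1 (fun t : R => F (z + t *: v)) 0 = 'd F z v.
Proof.
move=> dF; have dF' : is_diff (z + (0 : R) *: v) F ('d F z).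
  by rewrite scale0r addr0; exact: differentiableP.
have d := is_diff_comp (is_diff_line z v 0) dF'.
rewrite derive1E (@derive_val _ _ _ _ _ _ _ (is_diff_derive d)).
by rewrite /= scale1r.
Qed.

End LineDerivative.

Section ChartMetric.
Context {R : realType} {m : nat} {M : manifold R m}.
Let Z : normedModType R := ('rV[R]_m * 'rV[R]_m)%type.
Variables (A : forall p : M, set (tangent p)) (L : forall p : M, tangent p -> R).
Hypothesis HL : pseudo_finsler A L.
Variable p0 : M.
Let c := chart_at p0.
Let Om : set Z := timage c A.

Let oOm : open Om. Proof. exact: (pf_open HL). Qed.

Definition lhat (z : Z) : R := L (tvect c (cinv c z.1) z.2).
Definition vhess (z : Z) (e h : 'rV[R]_m) : R := 'd (fun y => 'd lhat y (0, h) : R) z (0, e).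
Definition metric_mx (z : Z) : 'M[R]_m :=
  \matrix_(k, l) (2^-1 * vhess z (delta_mx 0 k) (delta_mx 0 l)).

Lemma smooth_lhat : smooth_on Om lhat.
Proof. exact: (pf_smooth HL). Qed.

Lemma vhess_sym z e h : Om z -> vhess z e h = vhess z h e.
Proof.
move=> Oz; have [dL d2L] := smooth_lhat 2%N.
have d2 v : differentiable (fun y => 'd lhat y v : R) z by have [d _] := d2L v; exact: d.
apply: diff_symR; [|exact: d2..].
by apply: filterS (near_open oOm Oz) => y; exact: dL.
Qed.

Lemma vhess_linear z h : linear (vhess z ^~ h : 'rV[R]_m -> R).
Proof.
move=> a x y; rewrite /vhess -diff_linearP; congr ('d _ z _).
by rewrite -[RHS]/(_ *: _ + _, _ *: _ + _) /= scaler0 addr0.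
Qed.

Lemma linear_row (f : 'rV[R]_m -> R) (e : 'rV[R]_m) : linear f ->
  f e = \sum_k e 0 k * f (delta_mx 0 k).
Proof.
move=> lf; pose fM := GRing.isLinear.Build _ _ _ _ _ lf.
pose fL : {linear _ -> _} := HB.pack f fM.
rewrite -[LHS]/(fL e) {1}(row_sum_delta e) linear_sum.
by apply: eq_bigr => k _; rewrite linearZ.
Qed.

Lemma metric_mxE z e h : Om z -> (e *m metric_mx z *m h^T) 0 0 = 2^-1 * vhess z e h.
Proof.
move=> Oz; rewrite (linear_row e (vhess_linear z h)) mxE mulr_sumr.
under eq_bigr => l _ do rewrite mxE mulr_suml.
rewrite exchange_big /=; apply: eq_bigr => k _.
rewrite (vhess_sym _ _ Oz) (linear_row h (vhess_linear z _)) mulr_sumr mulr_sumr.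
apply: eq_bigr => l _; rewrite mxE (vhess_sym (delta_mx 0 k) (delta_mx 0 l) Oz) mxE.
have K (x y t u : R) : x * (y * t) * u = y * (x * (u * t)) by ring.
exact: K.
Qed.

Lemma metric_mx_sym z : Om z -> (metric_mx z)^T = metric_mx z.
Proof. by move=> Oz; apply/matrixP => k l; rewrite !mxE vhess_sym. Qed.

Lemma smooth_metric_mx : smooth_on Om metric_mx.
Proof.
move=> d; apply: Ck_mx => // k l.
apply: (@Ck_ext _ _ _ _ _ (fun z => 2^-1 * vhess z (delta_mx 0 k) (delta_mx 0 l) : R)) => //.
  by move=> z _; rewrite mxE.
apply: CkM => //; first exact: Ck_cst.
by have [_ /(_ (0, delta_mx 0 l))[_]] := smooth_lhat d.+2; apply.
Qed.

(** The inner derivative is identified with a differential of L only while v + s e stays admissible,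
    that is for s near 0; the outer derivative at 0 sees no more than that. *)
Lemma fundamentalE q (v e h : tangent q) : cdom c q -> A v ->
  fundamental L v e h =
  (tcoord c e *m metric_mx (cmap c q, tcoord c v) *m (tcoord c h)^T) 0 0.
Proof.
move=> cq Av; set z : Z := (cmap c q, tcoord c v).
have Oz : Om z by exact: timage_pair.
rewrite metric_mxE // /fundamental; congr (_ * _).
have [dL d2L] := smooth_lhat 2%N.
have zE (s : R) : (cmap c q, tcoord c (v + s *: e : tangent q)) = z + s *: (0, tcoord c e).
  rewrite -[RHS]/(_ + _ *: _, _ + _ *: _) /= scaler0 addr0; congr (_, _).
  by rewrite addrC; have := tcoord_linear c (q := q) s e v; rewrite addrC => ->; rewrite addrC.
have inner (s : R) : Om (z + s *: (0, tcoord c e)) ->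
    derive1 (fun t : R => L (v + s *: e + t *: h)) 0 =
    'd lhat (z + s *: (0, tcoord c e)) (0, tcoord c h).
  move=> Os; rewrite -derive1_line; last exact: dL.
  congr (derive1 _ 0); apply/funext => t; rewrite -zE.
  have := tcoord_linear c (q := q) t h (v + s *: e).
  rewrite [t *: h + _]addrC => E.
  have -> : (cmap c q, tcoord c (v + s *: e : tangent q)) + t *: (0, tcoord c h) =
      (cmap c q, tcoord c (v + s *: e + t *: h : tangent q)).
    by rewrite -[LHS]/(_ + _ *: _, _ + _ *: _) /= scaler0 addr0 E addrC.
  by rewrite /lhat /= cmapK // tcoordK.
have dh : differentiable (fun y => 'd lhat y (0, tcoord c h) : R) z.
  by have [d _] := d2L (0, tcoord c h); exact: d.
apply: etrans _ (derive1_line (0, tcoord c e) dh).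
rewrite !derive1E; apply: near_eq_derive.
have Oz' : Om (z + (0 : R) *: (0, tcoord c e)) by rewrite scale0r addr0.
have kl : {for (0 : R), continuous (fun s : R => z + s *: ((0, tcoord c e) : Z))}.
  by apply: differentiable_continuous; exact: (@ex_diff _ _ _ _ _ _ _ (is_diff_line _ _ _)).
have : \forall s \near (0 : R), Om (z + s *: ((0, tcoord c e) : Z)).
  by apply: kl; exact: near_open.
by apply: filterS => s; exact: inner.
Qed.

Lemma metric_mx_unit z : Om z -> metric_mx z \in unitmx.
Proof.
move=> Oz; have [q [v [cq Av ->]]] := timageP Oz.
apply: unitmx_inj => u uG.
rewrite -(tvectK (q := q) (i := c) u cq).
rewrite (_ : tvect c q u = 0); first by rewrite /tcoord linear0.
apply: (pf_nondegenerate HL Av) => h.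
by rewrite (fundamentalE _ _ cq Av) tvectK // uG mul0mx mxE.
Qed.

End ChartMetric.

(** * The submersion and the vertical projection in charts *)

Section ChartSubmersion.
Context {R : realType} {m n : nat} {M : manifold R m} {B : manifold R n}.
Let Z : normedModType R := ('rV[R]_m * 'rV[R]_m)%type.
Variables (A : forall p : M, set (tangent p)) (L : forall p : M, tangent p -> R).
Variables (AB : forall p : B, set (tangent p)) (LB : forall p : B, tangent p -> R).
Variable sigma : M -> B.
Hypotheses (Hsub : finsler_submersion A L AB LB sigma)
  (Hnd : forall (p : M) (v : tangent p), A v -> vertical_nondegenerate L sigma v).
Variable p0 : M.
Let c := chart_at p0.
Let j := chart_at (sigma p0).
Let HL := fs_total Hsub.

(** The points at which both the total space and the base can be read in the fixed charts at [p0]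
    and [sigma p0]. *)
Definition sdom : set M := cdom c `&` sigma @^-1` cdom j.
Definition schart : 'rV[R]_m -> 'rV[R]_n := cmap j \o sigma \o cinv c.
Definition sdomain : set Z := timage c (fun p => [set v : tangent p | sdom p /\ A v]).
Local Notation Om := sdomain.

Lemma open_sdom : open sdom.
Proof.
apply: openI; first exact: open_cdom.
have [cs _] := fs_smooth Hsub.
by move/continuousP : cs; apply; exact: open_cdom.
Qed.

Lemma smooth_schart : smooth_on (cmap c @` sdom) schart.
Proof. by have [_] := fs_smooth Hsub; exact. Qed.

Lemma open_sdomain : open Om.
Proof.
have oA : open (timage c A) by exact: (pf_open HL).
have oD : open (cmap c @` sdom).
  by have := open_cmap (i := c) open_sdom; rewrite (setIidl (@subIsetl _ _ _)).
have -> : Om = timage c A `&` (fst @^-1` (cmap c @` sdom)).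
  apply/seteqP; split=> z.
    move=> [iz [[cz jz] Az]]; split; first by split.
    by exists (cinv c z.1) => //; have [] := cinv_dom iz.
  by move=> [[iz Az] [q sq eq]]; split=> //; split=> //; rewrite /= -eq cmapK //; case: sq.
apply: openI => //.
by apply: open_comp => // z _; exact: cvg_fst.
Qed.

Lemma sdomain_sub : Om `<=` timage c A.
Proof. by move=> z [iz [_ Az]]; split. Qed.

Lemma sdomainP (z : Z) : Om z ->
  exists q (v : tangent q), [/\ sdom q, A v & z = (cmap c q, tcoord c v)].
Proof. by move=> /timageP[q [v [cq [sq Av] ->]]]; exists q, v. Qed.

Lemma sdomain_pair q (v : tangent q) : sdom q -> A v -> Om (cmap c q, tcoord c v).
Proof. by move=> sq Av; apply: timage_pair => //; case: sq. Qed.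

Lemma sdomain_fst (z : Z) : Om z -> (cmap c @` sdom) z.1.
Proof. by move=> /sdomainP[q [v [sq _ ->]]]; exists q. Qed.

(** The Jacobian of sigma for row vectors, regarded as a function on TM so that it enters the same
    calculus as P; its kernel is the vertical space. *)
Definition submersion_mx (z : Z) : 'M[R]_(m, n) := \matrix_(k, l) 'd schart (z.1) (delta_mx 0 k) 0 l.

Lemma submersion_mxE (z : Z) (e : 'rV[R]_m) : e *m submersion_mx z = 'd schart (z.1) e.
Proof.
rewrite {2}(row_sum_delta e) linear_sum mulmx_sum_row; apply: eq_bigr => k _.
by rewrite linearZ; congr (_ *: _); apply/rowP => l; rewrite !mxE.
Qed.

Lemma open_sdom_image : open (cmap c @` sdom).
Proof. by have := open_cmap (i := c) open_sdom; rewrite (setIidl (@subIsetl _ _ _)). Qed.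

Lemma Ck_dschart k (e : 'rV[R]_m) : Ck k Om (fun z : Z => 'd schart (z.1) e).
Proof.
apply: (@Ck_diff _ _ _ _ _ Om (cmap c @` sdom) fst (fun _ => e)).
- exact: fin_dim_rV.
- exact: open_sdomain.
- exact: open_sdom_image.
- exact: sdomain_fst.
- by apply: Ck_linear => // z; exact: cvg_fst.
- exact: Ck_cst.
- exact: smooth_schart.
Qed.

Lemma smooth_submersion_mx : smooth_on Om submersion_mx.
Proof.
move=> k; have oO := open_sdomain; apply: Ck_mx => // a b.
apply: (@Ck_ext _ _ _ _ _ (fun z : Z => 'd schart (z.1) (delta_mx 0 a) 0 b : R)) => //.
  by move=> z _; rewrite mxE.
by apply: Ck_coord => //; exact: Ck_dschart.
Qed.

Lemma diff_submersion_mx (u : 'rV[R]_m) z a b : Om z ->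
  u *m 'd submersion_mx z (a, b) = 'd (fun y => 'd schart y u) (z.1) a.
Proof.
move=> Oz; have d1 := smooth_diff smooth_submersion_mx Oz.
have d2 := is_diff_mulmx (is_diff_const u z) d1.
have E : (fun z : Z => u *m submersion_mx z) = (fun z : Z => 'd schart (z.1) u).
  by apply/funext => y; exact: submersion_mxE.
have dz : differentiable (fun y => 'd schart y u) (z.1).
  by have [_ /(_ u)[d _]] := smooth_schart 2%N; apply: d; exact: sdomain_fst.
have df : is_diff z (fst : Z -> 'rV[R]_m) (fst : Z -> 'rV[R]_m).
  by apply: is_diff_linear => // y; exact: cvg_fst.
have d3 := is_diff_comp df (differentiableP dz).
have e2 := is_diff_val ((a, b) : Z) d2; have e3 := is_diff_val ((a, b) : Z) d3.
rewrite mul0mx add0r in e2.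
by apply: etrans (esym e2) _; rewrite E; exact: e3.
Qed.

Lemma diff_submersion_mx_fiber z b : Om z -> 'd submersion_mx z (0, b) = 0.
Proof.
move=> Oz; apply/row_matrixP => k; rewrite row0 rowE diff_submersion_mx //.
by rewrite linear0.
Qed.

Lemma diff_submersion_mx_sym z u w : Om z -> u *m 'd submersion_mx z (w, 0) = w *m 'd submersion_mx z (u, 0).
Proof.
move=> Oz; apply: etrans (diff_submersion_mx u w 0 Oz) _; apply: etrans _ (esym (diff_submersion_mx w u 0 Oz)).
exact: (diff_sym w u open_sdom_image (sdomain_fst Oz) (smooth_schart 2%N)).
Qed.

Lemma tmapE q (w : tangent q) : sdom q ->
  tmap sigma w = tvect j (sigma q) ('d schart (cmap c q) (tcoord c w)).
Proof.
move=> sq; have [cq jq] := sq; set c' := chart_at q; set j' := chart_at (sigma q).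
have c'q : cdom c' q by exact: cdom_chart_at.
have j'q : cdom j' (sigma q) by exact: cdom_chart_at.
have d1 := is_diff_transition c'q cq.
have e1 : transition c' c (cmap c' q) = cmap c q by rewrite /transition /= cmapK.
have d2 : is_diff (transition c' c (cmap c' q)) schart ('d schart (cmap c q)).
  by rewrite e1; apply: (smooth_diff smooth_schart); exists q.
have e2 : schart (cmap c q) = cmap j (sigma q) by rewrite /schart /= cmapK.
have d12 := is_diff_comp d1 d2.
have d3 : is_diff ((schart \o transition c' c) (cmap c' q)) (transition j j')
    ('d (transition j j') (cmap j (sigma q))).
  by rewrite /= e1 e2; exact: is_diff_transition.
have d123 := is_diff_comp d12 d3.
apply: etrans _ (is_diff_val w d123); apply/esym/diff_near; last first.
  exact: (@ex_diff _ _ _ _ _ _ _ d123).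
have : nbhs (cmap c' q) (cmap c' @` (sdom `&` cdom c')).
  by apply: open_nbhs_nbhs; split; [apply: open_cmap; exact: open_sdom|exists q].
apply: filterS => _ [r [[cr jr] c'r] <-].
by rewrite /transition /schart /= !cmapK.
Qed.

Lemma verticalE q (v w : tangent q) : sdom q -> A v ->
  vertical sigma w <-> tcoord c w *m submersion_mx (cmap c q, tcoord c v) = 0.
Proof.
move=> sq Av; have [cq jq] := sq; rewrite /vertical /= tmapE // submersion_mxE /=.
split=> [h|->]; last by rewrite /tvect linear0.
by rewrite -(tvectK (q := sigma q) (i := j) ('d schart _ _) jq) h /tcoord linear0.
Qed.

Local Notation metric := (metric_mx L p0).

Lemma submersion_mx_surj z (b : 'rV[R]_n) : Om z -> exists e : 'rV[R]_m, e *m submersion_mx z = b.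
Proof.
move=> /sdomainP[q [v [sq Av ->]]]; have [cq jq] := sq.
have [u eu] := fs_dsurj Hsub (tvect j (sigma q) b).
exists (tcoord c u); rewrite submersion_mxE /=.
rewrite -(tvectK (q := sigma q) (i := j) ('d schart _ _) jq) -tmapE // eu.
by rewrite tvectK.
Qed.

Lemma submersion_mx_nondeg z (w : 'rV[R]_m) : Om z -> w *m submersion_mx z = 0 ->
  (forall u : 'rV[R]_m, u *m submersion_mx z = 0 -> w *m metric z *m u^T = 0) -> w = 0.
Proof.
move=> Oz; have [q [v [sq Av ez]]] := sdomainP Oz; have [cq jq] := sq; rewrite ez => wS wu.
rewrite -(tvectK (q := q) (i := c) w cq).
rewrite (_ : tvect c q w = 0); first by rewrite /tcoord linear0.
apply: (Hnd Av); first by apply/(verticalE _ sq Av); rewrite tvectK.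
move=> u /(verticalE _ sq Av) uS.
by rewrite (fundamentalE HL _ _ cq Av) tvectK // wu // mxE.
Qed.

Definition horizontal_mx (z : Z) : 'M[R]_m := hproj (metric z) (submersion_mx z).
Definition vertical_mx (z : Z) : 'M[R]_m := 1%:M - horizontal_mx z.

Section AtPoint.
Variable z : Z.
Hypothesis Oz : Om z.
Let Gt : (metric z)^T = metric z.
Proof. exact: (metric_mx_sym HL (sdomain_sub Oz)). Qed.
Let uG : metric z \in unitmx.
Proof. exact: (metric_mx_unit HL (sdomain_sub Oz)). Qed.
Let sj b := submersion_mx_surj b Oz.
Let nd w := submersion_mx_nondeg (w := w) Oz.

Lemma gram_submersion_mx_unit : gram (metric z) (submersion_mx z) \in unitmx.
Proof. exact: gram_unit. Qed.

Lemma vertical_mx_submersion_mx : vertical_mx z *m submersion_mx z = 0.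
Proof. by rewrite /vertical_mx mulmxBl mul1mx hproj_S // subrr. Qed.

Lemma vertical_mx_id (e : 'rV[R]_m) : e *m submersion_mx z = 0 -> e *m vertical_mx z = e.
Proof. by move=> eS; rewrite /vertical_mx mulmxBr mulmx1 /horizontal_mx hproj_vertical // subr0. Qed.

Lemma horizontal_mx_orthogonal (e w : 'rV[R]_m) : w *m submersion_mx z = 0 ->
  e *m horizontal_mx z *m metric z *m w^T = 0.
Proof. exact: hproj_horizontal. Qed.

Lemma vertical_mx_selfadjoint : vertical_mx z *m metric z = metric z *m (vertical_mx z)^T.
Proof.
rewrite /vertical_mx mulmxBl mul1mx linearB /= trmx1 mulmxBr mulmx1.
by rewrite /horizontal_mx hproj_selfadjoint.
Qed.

End AtPoint.

(** The explicit formula involves only products, transposes and inverses of smooth matrices. *)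
Lemma smooth_vertical_mx : smooth_on Om vertical_mx.
Proof.
move=> k; have oO := open_sdomain.
have sG : Ck k Om metric by apply: Ck_sub (smooth_metric_mx HL p0 k); exact: sdomain_sub.
have sGi : Ck k Om (fun z => invmx (metric z)).
  by apply: Ck_invmx => // z Oz; exact: (metric_mx_unit HL (sdomain_sub Oz)).
have sS := smooth_submersion_mx k.
have tl a b : linear (trmx : 'M[R]_(a, b) -> 'M[R]_(b, a)) by exact: linearP.
have sSt : Ck k Om (fun z => (submersion_mx z)^T).
  apply: (@Ck_linear_comp _ _ _ _ _ _ (trmx : 'M[R]_(m, n) -> 'M[R]_(n, m))) => //.
    exact: tl.
  by apply: linear_mx_continuous; exact: tl.
have sK : Ck k Om (fun z => gram (metric z) (submersion_mx z)).
  by apply: Ck_mulmx => //; apply: Ck_mulmx.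
have sKi : Ck k Om (fun z => invmx (gram (metric z) (submersion_mx z))).
  by apply: Ck_invmx => // z; exact: gram_submersion_mx_unit.
apply: CkB => //; first exact: Ck_cst.
by do 3!apply: Ck_mulmx => //.
Qed.

(** Against vertical vectors, x pairs as its projection x P does, and x P is itself vertical. If all
    these pairings vanish, non-degeneracy on the vertical space gives x P = 0. *)
Lemma ghorizontalE q (v x : tangent q) : sdom q -> A v ->
  ghorizontal L sigma v x <-> tcoord c x *m vertical_mx (cmap c q, tcoord c v) = 0.
Proof.
move=> sq Av; have [cq jq] := sq; set z : Z := (_, _).
have Oz : Om z by exact: sdomain_pair.
have hx (w : 'rV[R]_m) : w *m submersion_mx z = 0 -> tcoord c x *m metric z *m w^T =
    tcoord c x *m vertical_mx z *m metric z *m w^T.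
  move=> wS; rewrite /vertical_mx mulmxBr mulmx1 !mulmxBl horizontal_mx_orthogonal // subr0.
  by [].
split=> [h|h w /(verticalE _ sq Av) wS].
  apply: (submersion_mx_nondeg Oz); first by rewrite -mulmxA vertical_mx_submersion_mx // mulmx0.
  move=> u uS; rewrite -hx //.
  apply/matrixP => a b; rewrite !ord1 [RHS]mxE.
  have := h (tvect c q u); rewrite (fundamentalE HL _ _ cq Av) tvectK //; apply.
  by apply/(verticalE _ sq Av); rewrite tvectK.
by rewrite (fundamentalE HL _ _ cq Av) hx // h !mul0mx mxE.
Qed.

Lemma tcoord_vpart q (v e : tangent q) : sdom q -> A v ->
  tcoord c (vpart L sigma v e) = tcoord c e *m vertical_mx (cmap c q, tcoord c v).
Proof.
move=> sq Av; have [cq jq] := sq; set z : Z := (_, _).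
have Oz : Om z by exact: sdomain_pair.
have VV : vertical_mx z *m vertical_mx z = vertical_mx z.
  apply/row_matrixP => i; rewrite row_mul; apply: vertical_mx_id => //.
  by rewrite -row_mul vertical_mx_submersion_mx // row0.
(* A chosen w satisfies w = w P = e P, which is uniqueness. The default value 0 never occurs, as e P
   meets the requirement. *)
rewrite /vpart; case: xgetP => [w -> [vw hw]|/(_ (tvect c q (tcoord c e *m vertical_mx z)))].
  move: hw => /(ghorizontalE _ sq Av); rewrite -/z tcoordB mulmxBl => /eqP.
  rewrite subr_eq0 => /eqP ->.
  by move: vw => /(verticalE _ sq Av); rewrite -/z => /vertical_mx_id ->.
case; split.
  by apply/(verticalE _ sq Av); rewrite tvectK // -/z -mulmxA vertical_mx_submersion_mx // mulmx0.
by apply/(ghorizontalE _ sq Av); rewrite tcoordB tvectK // -/z mulmxBl -mulmxA VV subrr.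
Qed.

End ChartSubmersion.

(** * O'Neill tensors and curvatures in the chart at a point *)

Section TotalSpace.
Context {R : realType} {m n : nat} {M : manifold R m} {B : manifold R n}.
Let Z : normedModType R := ('rV[R]_m * 'rV[R]_m)%type.
Variables (A : forall p : M, set (tangent p)) (L : forall p : M, tangent p -> R).
Variables (AB : forall p : B, set (tangent p)) (LB : forall p : B, tangent p -> R).
Variables (sigma : M -> B) (nab : vfield M -> vfield M -> avfield M).
Hypotheses (Hsub : finsler_submersion A L AB LB sigma)
  (Hlcc : levi_civita_chern A L nab)
  (Hnd : forall (p : M) (v : tangent p), A v -> vertical_nondegenerate L sigma v).
Variable p0 : M.
Implicit Types (X : avfield M) (E : vfield M).

Let c := chart_at p0.
Let HL := fs_total Hsub.
Let Hac := lcc_connection Hlcc.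
Let oA := pf_open HL.
Local Notation Om := (sdomain A sigma p0).
Local Notation hat := (hat p0).
Local Notation Gi := (christoffel_mx nab p0).
Local Notation P := (vertical_mx L sigma p0).
Local Notation covv := (covv Gi).
Local Notation covm := (covm Gi).
Local Notation chi := (chi Gi P).
Local Notation christoffel := (christoffel Gi).

Let oO : open Om. Proof. exact: open_sdomain Hsub p0. Qed.
Let sG k : smooth_on Om (Gi k).
Proof.
by move=> d; apply: Ck_sub (smooth_christoffel_mx oA Hac p0 k d); exact: sdomain_sub.
Qed.
Let sP : smooth_on Om P. Proof. exact: smooth_vertical_mx Hsub Hnd p0. Qed.
Let PP z : Om z -> P z *m P z = P z.
Proof.
move=> Oz; apply/row_matrixP => i; rewrite row_mul; apply: vertical_mx_id => //.
by rewrite -row_mul (vertical_mx_submersion_mx Hsub Hnd Oz) row0.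
Qed.

Let sQ : smooth_on Om (fun z => 1%:M - P z).
Proof. by move=> k; apply: (CkB oO (Ck_cst _ _ _) (sP k)). Qed.

Lemma tcoord_hpart q (v e : tangent q) : sdom sigma p0 q -> A v ->
  tcoord c (hpart L sigma v e) = tcoord c e *m (1%:M - P (cmap c q, tcoord c v)).
Proof.
move=> sq Av; rewrite /hpart tcoordB mulmxBr mulmx1.
by rewrite (tcoord_vpart Hsub Hnd _ sq Av).
Qed.

Lemma hat_vtop X z : Om z -> hat (vtop L sigma X) z = hat X z *m P z.
Proof.
move=> /sdomainP[q [v [sq Av ->]]]; have [cq _] := sq.
by rewrite !hatE // (tcoord_vpart Hsub Hnd _ sq Av).
Qed.

Lemma hat_hbot X z : Om z -> hat (hbot L sigma X) z = hat X z *m (1%:M - P z).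
Proof.
move=> /sdomainP[q [v [sq Av ->]]]; have [cq _] := sq.
by rewrite !hatE // (tcoord_hpart _ sq Av).
Qed.

Lemma sdomain_cinv z : Om z -> cdom c (cinv c z.1).
Proof. by move=> /sdomainP[q [v [[cq _] _ ->]]]; rewrite /= cmapK. Qed.

Lemma hat_aniso_ext (e : tangent p0) z : Om z -> hat (aniso (ext e)) z = e.
Proof. by move=> /sdomain_cinv cz; rewrite /hat /aniso tcoord_ext. Qed.

Lemma diff_vhat_ext (h : tangent p0) q a : cdom c q ->
  'd (vhat c (ext h)) (cmap c q) a = 0.
Proof.
move=> cq; have oI : open (cmap c @` cdom c) by exact: open_cimage.
have qI : (cmap c @` cdom c) (cmap c q) by exists q.
have d := is_diff_const (h : 'rV[R]_m) (cmap c q).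
apply: etrans _ (is_diff_val a d); apply/esym/diff_near; last exact: (@ex_diff _ _ _ _ _ _ _ d).
have := open_nbhs_nbhs (conj oI qI).
by apply: filterS => x xI; rewrite vhat_ext.
Qed.

Lemma hat_nab_ext (e h : tangent p0) z : Om z ->
  hat (nab (ext e) (ext h)) z = (h : 'rV[R]_m) *m christoffel e z.
Proof.
move=> Oz; have [q [v [sq Av ->]]] := sdomainP Oz; have [cq _] := sq.
rewrite hatE // (tcoord_nab Hac (open_cdom c) (fun _ x => x) cq Av (smooth_ext e) (smooth_ext h)).
by rewrite !tcoord_ext // diff_vhat_ext // add0r.
Qed.

Lemma hat_nabla_ext (e : tangent p0) X (F : Z -> 'rV[R]_m) z : smooth_on Om F ->
  (forall z, Om z -> hat X z = F z) -> Om z ->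
  hat (nabla_av nab (ext e) X) z = covv e F z.
Proof.
move=> sF XF Oz; have sX : smooth_on Om (hat X).
  by move=> k; apply: Ck_ext (sF k) => // y /XF.
rewrite (hat_nabla_av Hac oO sX (open_cdom c) (sdomain_cinv Oz) (sdomain_sub Oz) (smooth_ext e) Oz).
rewrite /vhat tcoord_ext; last exact: sdomain_cinv.
by apply: (covv_ext Gi oO) => //; exact: (@ex_diff _ _ _ _ _ _ _ (smooth_diff sX Oz)).
Qed.

Lemma covm_cst1 e z : covm e (fun _ => 1%:M) z = 0.
Proof. by rewrite /covm /hder diff_cst mulmx1 mul1mx add0r subrr. Qed.

Lemma covm_compl e z : Om z -> covm e (fun z => 1%:M - P z) z = - covm e P z.
Proof.
move=> Oz.
have d1 : differentiable (fun _ : Z => 1%:M : 'M[R]_m) z.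
  exact: (@ex_diff _ _ _ _ _ _ _ (is_diff_const _ z)).
have dP : differentiable P z by exact: (@ex_diff _ _ _ _ _ _ _ (smooth_diff sP Oz)).
by rewrite (covmB Gi e d1 dP) covm_cst1 sub0r.
Qed.

(** The extension of e is constant in the chart at q, so its components [eps] vary in the chart at
    p0. Their derivative is multiplied by Q P or P Q and disappears: this is the tensoriality of
    chi. *)
Lemma tcoord_oneill_chi q (v h e : tangent q) : sdom sigma p0 q -> A v ->
  tcoord c (oneill_chi L sigma nab v h e) =
  tcoord c e *m chi (tcoord c h) (cmap c q, tcoord c v).
Proof.
move=> sq Av; have [cq jq] := sq; set c' := chart_at q.
have c'q : cdom c' q by exact: cdom_chart_at.
set z : Z := (cmap c q, tcoord c v); have Oz : Om z by exact: sdomain_pair.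
pose U : set M := cdom c' `&` cdom c.
have oU : open U by apply: openI; exact: open_cdom.
have Uc : U `<=` cdom c by move=> r [].
have oI : open (cmap c @` U) by exact: open_image.
pose W : set Z := Om `&` fst @^-1` (cmap c @` U).
have oW : open W.
  by apply: openI => //; apply: open_comp => // y _; exact: cvg_fst.
have Wz : W z by split => //; exists q.
have sE : smooth_vfield U (ext e) by apply: smooth_vfield_sub (smooth_ext e) => r [].
pose eps (y : Z) := vhat c (ext e) y.1.
have seps : smooth_on W eps.
  move=> k; apply: (@Ck_comp _ _ _ _ _ W (cmap c @` U) fst) => //.
  - exact: fin_dim_rV.
  - by move=> y [].
  - by apply: Ck_linear => // y; exact: cvg_fst.
  - exact: (smooth_vhat oU Uc sE).
have eps_z : eps z = tcoord c e by rewrite /eps /vhat /= cmapK // /ext tvect_chart_at.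
have dsm (V : normedModType R) (F : Z -> V) : smooth_on W F -> differentiable F z.
  by move=> sF; exact: (@ex_diff _ _ _ _ _ _ _ (smooth_diff sF Wz)).
have WO : W `<=` Om by move=> y [].
have key X (K : Z -> 'M[R]_m) : smooth_on Om K ->
    (forall y, Om y -> hat X y = hat (aniso (ext e)) y *m K y) ->
    tcoord c (nabla_av nab (ext h) X q v) =
    covv (tcoord c h) eps z *m K z + tcoord c e *m covm (tcoord c h) K z.
  move=> sK XK; have sKW : smooth_on W K by move=> k; apply: Ck_sub (sK k).
  have sF : smooth_on W (fun y => eps y *m K y) by move=> k; exact: (Ck_mulmx oW (seps k) (sKW k)).
  have XF y : W y -> hat X y = eps y *m K y by move=> /WO Oy; rewrite XK.
  have sX : smooth_on W (hat X) by move=> k; apply: Ck_ext (sF k) => // y /XF.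
  rewrite (tcoord_nabla_av Hac oW sX (open_cdom c') c'q cq Av (smooth_ext h) Wz).
  rewrite (covv_ext Gi oW _ Wz (dsm _ _ sX) XF) covv_mulmx; [|exact: dsm..].
  by rewrite -/z eps_z /ext tvect_chart_at.
rewrite /oneill_chi tcoordD (tcoord_vpart Hsub Hnd _ sq Av) (tcoord_hpart _ sq Av).
rewrite (key _ _ sQ (fun y => @hat_hbot _ y)) (key _ _ sP (fun y => @hat_vtop _ y)) covm_compl //.
have Ci := covm_idem Gi oO sP PP (tcoord c h) Oz.
rewrite -/z /chi; move: (PP Oz) Ci.
move: (covm _ P z) (P z) (covv _ _ z) (tcoord c e) => d p a e' pp dd.
have PD : p *m d = d - d *m p by rewrite -{2}dd addrC addKr.
have pq : p *m (1%:M - p) = 0 by rewrite mulmxBr mulmx1 pp subrr.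
have qp : (1%:M - p) *m p = 0 by rewrite mulmxBl mul1mx pp subrr.
rewrite !mulmxDl -!mulmxA pq qp !mulmx0 !add0r PD mulNmx -mulmxDr; congr (_ *m _).
by rewrite mulmxBr mulmx1 addrC.
Qed.

Variable v0 : tangent p0.
Hypothesis Av0 : A v0.
Let z0 : Z := (cmap c p0, v0).

Let cp : cdom c p0. Proof. exact: cdom_chart_at. Qed.
Let sp : sdom sigma p0 p0. Proof. by split; exact: cdom_chart_at. Qed.
Let z0E : (cmap c p0, tcoord c v0) = z0. Proof. by rewrite tcoord_chart_at. Qed.
Let Oz0 : Om z0. Proof. by rewrite -z0E; exact: sdomain_pair. Qed.

Lemma smooth_vfield0 (U : set M) E : open U -> (forall q, U q -> E q = 0) -> smooth_vfield U E.
Proof.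
move=> oU E0 i k; apply: (@Ck_ext _ _ _ _ _ (fun _ => 0)).
- exact: open_cmap.
- by move=> _ [q [Uq iq] <-]; rewrite cmapK // E0 // /tcoord linear0.
- exact: Ck_cst.
Qed.

Lemma hat_at X : hat X z0 = X p0 v0.
Proof. by rewrite -z0E hatE // tcoord_chart_at. Qed.

Lemma christoffel0 z : christoffel 0 z = 0.
Proof. by rewrite /christoffel big1 // => i _; rewrite mxE scale0r. Qed.

Lemma nabla_av_bracket (e h : tangent p0) X : smooth_on Om (hat X) ->
  nabla_av nab (bracket (ext e) (ext h)) X p0 v0 = 0.
Proof.
move=> sX.
have b0 q : cdom c q -> bracket (ext e) (ext h) q = 0 by exact: bracket_ext.
have Oz : Om (cmap c p0, tcoord c v0) by rewrite z0E.
rewrite -[LHS]tcoord_chart_at -/c.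
rewrite (tcoord_nabla_av Hac oO sX (open_cdom c) cp cp Av0 (smooth_vfield0 (open_cdom c) b0) Oz).
rewrite b0 // tcoord_chart_at /covv /hder /hlift christoffel0 !mulmx0 oppr0 addr0.
exact: linear0.
Qed.

Lemma nab_bracket (e h b : tangent p0) : nab (bracket (ext e) (ext h)) (ext b) v0 = 0.
Proof.
have b0 q : cdom c q -> bracket (ext e) (ext h) q = 0 by exact: bracket_ext.
rewrite -[LHS]tcoord_chart_at -/c.
rewrite (tcoord_nab Hac (open_cdom c) (fun _ x => x) cp Av0 (smooth_vfield0 (open_cdom c) b0) (smooth_ext b)).
by rewrite b0 // tcoord_chart_at diff_vhat_ext // christoffel0 mulmx0 addr0.
Qed.

Lemma nab_ext (e h : tangent p0) : nab (ext e) (ext h) v0 = (h : 'rV[R]_m) *m christoffel e z0.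
Proof. by rewrite -hat_nab_ext // hat_at. Qed.

Lemma christoffel_sym (u w : tangent p0) :
  (u : 'rV[R]_m) *m christoffel w z0 = (w : 'rV[R]_m) *m christoffel u z0.
Proof.
apply/eqP; rewrite -subr_eq0; apply/eqP; rewrite -!nab_ext.
rewrite (lcc_torsion_free Hlcc (open_cdom c) (smooth_ext w) (smooth_ext u) cp Av0).
exact: bracket_ext.
Qed.

Lemma curvE (e h b : tangent p0) : curv nab v0 e h b = (b : 'rV[R]_m) *m curvm Gi e h z0.
Proof.
have sF (a : tangent p0) : smooth_on Om (fun z => (b : 'rV[R]_m) *m christoffel a z).
  by apply: smooth_mulmx_cst => //; exact: smooth_christoffel.
have D (a a' : tangent p0) : nabla_av nab (ext a) (nab (ext a') (ext b)) p0 v0 =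
    (b : 'rV[R]_m) *m hder Gi a (christoffel a') z0
    + (b : 'rV[R]_m) *m christoffel a' z0 *m christoffel a z0.
  rewrite -hat_at (hat_nabla_ext _ (sF a')) //; last by move=> z Oz; exact: hat_nab_ext.
  rewrite /covv hder_mulmx.
  - by rewrite {1}/hder diff_cst mul0mx add0r.
  - exact: (@ex_diff _ _ _ _ _ _ _ (is_diff_const _ z0)).
  - exact: (@ex_diff _ _ _ _ _ _ _ (smooth_diff (smooth_christoffel oO sG a') Oz0)).
rewrite /curv nab_bracket subr0 (D e h) (D h e) /curvm.
have K (d1 d2 g1 g2 : 'M[R]_m) : (b : 'rV[R]_m) *m d1 + (b : 'rV[R]_m) *m g1 *m g2
    - ((b : 'rV[R]_m) *m d2 + (b : 'rV[R]_m) *m g2 *m g1)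
    = (b : 'rV[R]_m) *m (d1 - d2 + g1 *m g2 - g2 *m g1).
  by rewrite mulmxBr mulmxDr mulmxBr !mulmxA opprD addrACA addrA.
exact: K.
Qed.

(** Used with [K] equal to P for T and to 1 - P for A. The formula for S is assumed at all nearby
    vectors because S is differentiated before evaluation at [v0]. *)
Lemma nabla_tensorE (S : atensor M) (K : Z -> 'M[R]_m) (e u s : tangent p0) :
  smooth_on Om K ->
  (forall q (v b h : tangent q), sdom sigma p0 q -> A v -> tcoord c (S q v b h) =
     tcoord c h *m chi (tcoord c b *m K (cmap c q, tcoord c v)) (cmap c q, tcoord c v)) ->
  nabla_tensor nab S v0 e u s =
  (s : 'rV[R]_m) *m (covm e (chi ((u : 'rV[R]_m) *m K z0)) z0
    + chi ((u : 'rV[R]_m) *m covm e K z0 - (u : 'rV[R]_m) *m K z0 *m christoffel e z0) z0).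
Proof.
move=> sK SK.
have S0 (b h : tangent p0) : S p0 v0 b h = (h : 'rV[R]_m) *m chi ((b : 'rV[R]_m) *m K z0) z0.
  have := SK _ v0 b h sp Av0; rewrite z0E (tcoord_chart_at b) (tcoord_chart_at h).
  exact: etrans (esym (tcoord_chart_at _)).
have sF : smooth_on Om (fun z => (s : 'rV[R]_m) *m chi ((u : 'rV[R]_m) *m K z) z).
  move=> k; apply: Ck_mulmx => //; first exact: Ck_cst.
  by apply: (smooth_chi_param oO sG sP); exact: smooth_mulmx_cst.
rewrite /nabla_tensor !S0 !nab_ext -hat_at (hat_nabla_ext _ sF) //; last first.
  move=> _ /sdomainP[q [v [sq Av ->]]]; have [cq _] := sq.
  by have := SK q v (ext u q) (ext s q) sq Av; rewrite hatE // (tcoord_ext u cq) (tcoord_ext s cq).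
exact: (covv_chi oO sG sP e s u Oz0 sK).
Qed.

Lemma proj_curvE (Pr : avfield M -> avfield M) (K : Z -> 'M[R]_m) (e h s : tangent p0) :
  smooth_on Om K -> (forall X z, Om z -> hat (Pr X) z = hat X z *m K z) ->
  proj_curv nab Pr v0 e h s =
  (covv e (fun z => covv h (fun z => (s : 'rV[R]_m) *m K z) z *m K z) z0
   - covv h (fun z => covv e (fun z => (s : 'rV[R]_m) *m K z) z *m K z) z0) *m K z0.
Proof.
move=> sK PrK.
have s1 : smooth_on Om (fun z => (s : 'rV[R]_m) *m K z) by exact: smooth_mulmx_cst.
have h1 z : Om z -> hat (Pr (aniso (ext s))) z = (s : 'rV[R]_m) *m K z.
  by move=> Oz; rewrite PrK // hat_aniso_ext.
have s2 (a : tangent p0) : smooth_on Om (fun z => covv a (fun z => (s : 'rV[R]_m) *m K z) z *m K z).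
  by move=> k; apply: Ck_mulmx => //; exact: (smooth_covv oO sG a s1).
have h2 (a : tangent p0) z : Om z -> hat (Pr (nabla_av nab (ext a) (Pr (aniso (ext s))))) z =
    covv a (fun z => (s : 'rV[R]_m) *m K z) z *m K z.
  by move=> Oz; rewrite PrK // (hat_nabla_ext _ s1 h1 Oz).
have sh : smooth_on Om (hat (Pr (aniso (ext s)))).
  by move=> k; apply: Ck_ext (s1 k) => // z /h1.
rewrite /proj_curv -hat_at PrK //; congr (_ *m _).
rewrite hat_at nabla_av_bracket // subr0.
have D (a a' : tangent p0) : nabla_av nab (ext a)
    (Pr (nabla_av nab (ext a') (Pr (aniso (ext s))))) p0 v0 =
    covv a (fun z => covv a' (fun z => (s : 'rV[R]_m) *m K z) z *m K z) z0.
  apply: etrans (esym (hat_at _)) _.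
  exact: (hat_nabla_ext a (s2 a') (h2 a') Oz0).
have K2 (a b a' b' : 'rV[R]_m) : a = a' -> b = b' -> a - b = a' - b' by move=> -> ->.
by apply: K2; apply: D.
Qed.

Lemma fundamental_gform (e h : tangent p0) : fundamental L v0 e h = gform (metric_mx L p0 z0) e h.
Proof. by rewrite (fundamentalE HL _ _ cp Av0) !tcoord_chart_at. Qed.

(** This is nabla g = 0 on fields with constant components: the base derivative [E1] minus the fibre
    derivative [E2] along v0 Gamma_e is the derivative of g along the horizontal lift of e. *)
Lemma hder_metric (e : tangent p0) : hder Gi e (metric_mx L p0) z0 =
  christoffel e z0 *m metric_mx L p0 z0 + metric_mx L p0 z0 *m (christoffel e z0)^T.
Proof.
have sM : smooth_on Om (metric_mx L p0).
  by move=> k; apply: Ck_sub (smooth_metric_mx HL p0 k); exact: sdomain_sub.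
have dM := smooth_diff sM Oz0.
have key (x y : tangent p0) : ((x : 'rV[R]_m) *m hder Gi e (metric_mx L p0) z0 *m (y : 'rV[R]_m)^T) 0 0 =
    gform (metric_mx L p0 z0) ((x : 'rV[R]_m) *m christoffel e z0) y
    + gform (metric_mx L p0 z0) x ((y : 'rV[R]_m) *m christoffel e z0).
  pose f (z : Z) := gform (metric_mx L p0 z) x y.
  have df : is_diff z0 f (fun w => ((x : 'rV[R]_m) *m 'd (metric_mx L p0) z0 w *m (y : 'rV[R]_m)^T) 0 0).
    have d1 := is_diff_mulmx (is_diff_const (x : 'rV[R]_m) z0) dM.
    have d2 := is_diff_mulmx d1 (is_diff_const ((y : 'rV[R]_m)^T) z0).
    have := is_diff_linear_comp (@coord_linear R 1 1 0 0) (@coord_continuous _ _ _ _ _) d2.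
    by congr (is_diff _ _ _); apply/funext => w; rewrite mulmx0 addr0 mul0mx add0r.
  have fE q (w : tangent q) : cdom c q -> A w ->
      fundamental L w (ext x q) (ext y q) = f (cmap c q, tcoord c w).
    by move=> cq Aw; rewrite (fundamentalE HL _ _ cq Aw) !tcoord_ext.
  have nOm : nbhs z0 (timage c A) by apply: open_nbhs_nbhs; split; [exact: oA|exact: (sdomain_sub Oz0)].
  have di1 : is_diff (cmap c p0) (fun r => (r, v0) : Z) (fun a => (a, 0)).
    exact: is_diff_pair (is_diff_id _) (is_diff_const (v0 : 'rV[R]_m) _).
  have di2 : is_diff (v0 : 'rV[R]_m) (fun r => (cmap c p0, r) : Z) (fun a => (0, a)).
    exact: is_diff_pair (is_diff_const _ _) (is_diff_id _).
  have E1 : dfun (fun q => fundamental L (ext v0 q) (ext x q) (ext y q)) (ext e p0) = 'd f z0 (e, 0).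
    have d1 := is_diff_comp di1 df.
    have -> : ext e p0 = e by exact: tvect_chart_at.
    apply: etrans _ (etrans (is_diff_val (e : 'rV[R]_m) d1) (esym (is_diff_val _ df))).
    apply/esym/diff_near; last exact: (@ex_diff _ _ _ _ _ _ _ d1).
    have k1 := differentiable_continuous (@ex_diff _ _ _ _ _ _ _ di1).
    have n1 : nbhs (cmap c p0) ((fun r => (r, v0) : Z) @^-1` timage c A) by exact: k1.
    apply: filterS n1 => r [/cinv_dom[cr er] Ar].
    have := fE _ (ext v0 (cinv c r)) cr Ar; rewrite er (tcoord_ext v0 cr).
    exact: esym.
  have E2 a : 'D_a (fun w : tangent p0 => fundamental L w (ext x p0) (ext y p0)) v0 = 'd f z0 (0, a).
    have d2 := is_diff_comp di2 df.
    have k2 := differentiable_continuous (@ex_diff _ _ _ _ _ _ _ di2).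
    have n2 : nbhs (v0 : 'rV[R]_m) ((fun r => (cmap c p0, r) : Z) @^-1` timage c A) by exact: k2.
    have n3 : \forall w \near (v0 : 'rV[R]_m), (f \o (fun r => (cmap c p0, r) : Z)) w =
        fundamental L (w : tangent p0) (ext x p0) (ext y p0).
      apply: filterS n2 => w [_]; rewrite /= cmapK // tvect_chart_at => Aw.
      have := fE _ w cp Aw; rewrite tcoord_chart_at.
      exact: esym.
    apply: etrans (esym (near_eq_derive a n3)) _.
    rewrite (deriveE _ (@ex_diff _ _ _ _ _ _ _ d2)).
    exact: etrans (is_diff_val a d2) (esym (is_diff_val _ df)).
  have := lcc_metric Hlcc e x y Av0; rewrite /nabla_g /nabla_fun.
  rewrite E1 E2 !fundamental_gform !nab_ext => H.
  have E3 : 'd f z0 (hlift Gi e z0) = ((x : 'rV[R]_m) *m hder Gi e (metric_mx L p0) z0 *m (y : 'rV[R]_m)^T) 0 0.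
    exact: is_diff_val df.
  rewrite -E3.
  have -> : hlift Gi e z0 = (e, 0) - (0, (v0 : 'rV[R]_m) *m christoffel e z0).
    by rewrite -[RHS]/(_ - _, _ - _) /= subr0 sub0r.
  rewrite linearB; apply/eqP; rewrite -subr_eq0 opprD addrA; apply/eqP; exact: H.
apply/matrixP => k l.
have ent (N : 'M[R]_m) : N k l = ((delta_mx 0 k : 'rV[R]_m) *m N *m (delta_mx 0 l : 'rV[R]_m)^T) 0 0.
  by rewrite trmx_delta -rowE -colE !mxE.
rewrite ent key /gform [RHS]ent trmx_mul mulmxDr mulmxDl [RHS]mxE !mulmxA.
by [].
Qed.

End TotalSpace.

(** The identity P G = G P^T is differentiated along the lift of e; metric compatibility makes the
    Christoffel terms match, so that nabla_e P is again self-adjoint. *)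
Lemma covm_selfadjoint (R : realType) m (O : set ('rV[R]_m * 'rV[R]_m))
    (Gi : 'I_m -> ('rV[R]_m * 'rV[R]_m)%type -> 'M[R]_m)
    (P G : ('rV[R]_m * 'rV[R]_m)%type -> 'M[R]_m) e z :
  open O -> smooth_on O P -> smooth_on O G ->
  (forall z, O z -> P z *m G z = G z *m (P z)^T) -> O z ->
  hder Gi e G z = christoffel Gi e z *m G z + G z *m (christoffel Gi e z)^T ->
  covm Gi e P z *m G z = G z *m (covm Gi e P z)^T.
Proof.
move=> oO sP sG PG Oz dG; have PGz := PG z Oz.
have dP := smooth_diff sP Oz; have dGz := smooth_diff sG Oz.
have tl : linear (trmx : 'M[R]_m -> 'M[R]_m) by exact: linearP.
have dPt := is_diff_linear_comp tl (linear_mx_continuous tl) dP.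
have E1 : hder Gi e (fun z => P z *m G z) z = hder Gi e P z *m G z + P z *m hder Gi e G z.
  exact: is_diff_val (is_diff_mulmx dP dGz).
have E2 : hder Gi e (fun z => G z *m (P z)^T) z =
    hder Gi e G z *m (P z)^T + G z *m (hder Gi e P z)^T.
  exact: is_diff_val (is_diff_mulmx dGz dPt).
have E3 : hder Gi e (fun z => P z *m G z) z = hder Gi e (fun z => G z *m (P z)^T) z.
  by apply: (hder_ext Gi oO) => //; exact: (@ex_diff _ _ _ _ _ _ _ (is_diff_mulmx dP dGz)).
rewrite E1 E2 dG in E3; move: E3; rewrite /covm.
move: (hder Gi e P z) (christoffel Gi e z) PGz; move: (P z) (G z) => p g d gam pg E.
have K1 : gam *m p *m g = gam *m g *m p^T by rewrite -!mulmxA pg.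
have K2 : g *m p^T *m gam^T = p *m g *m gam^T by rewrite -pg.
have tD : (d + p *m gam - gam *m p)^T = d^T + gam^T *m p^T - p^T *m gam^T.
  by rewrite -!trmx_mul; apply/matrixP => a b; rewrite !(mxE, entryD).
rewrite tD mulmxBl mulmxDl mulmxBr mulmxDr !mulmxA K1 K2.
have {E} -> : d *m g = gam *m g *m p^T + g *m gam^T *m p^T + g *m d^T
    - (p *m gam *m g + p *m g *m gam^T).
  by rewrite -mulmxDl -E mulmxDr !mulmxA addrK.
by mx_abel.
Qed.

Theorem corollary5 (R : realType) (m n : nat)
  (M : manifold R m) (B : manifold R n)
  (A : forall p : M, set (tangent p)) (L : forall p : M, tangent p -> R)
  (AB : forall p : B, set (tangent p)) (LB : forall p : B, tangent p -> R)
  (sigma : M -> B) (nab : vfield M -> vfield M -> avfield M)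
  (Hsub : finsler_submersion A L AB LB sigma)
  (Hlcc : levi_civita_chern A L nab)
  (Hnd : forall (p : M) (v : tangent p), A p v ->
     vertical_nondegenerate L sigma v)
  (p : M) (v : tangent p) (Hv : A p v)
  (s' s u w : tangent p)
  (Hs' : vertical sigma s') (Hs : vertical sigma s)
  (Hu : vertical sigma u) (Hw : vertical sigma w)
  (x y z z' : tangent p)
  (Hx : ghorizontal L sigma v x) (Hy : ghorizontal L sigma v y)
  (Hz : ghorizontal L sigma v z) (Hz' : ghorizontal L sigma v z') :
  let g := fundamental L v in
  let Rm := curv nab v in
  let Rtop := curv_top L sigma nab v in
  let Rbot := curv_bot L sigma nab v in
  let bT := oneill_T L sigma nab in
  let bA := oneill_A L sigma nab in
  let T := bT p v in
  let O := bA p v in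
  let dT := nabla_tensor nab bT v in
  let dA := nabla_tensor nab bA v in
  (* {0} *)
  g (Rm w u s) s' =
    g (Rtop w u s) s' + g (T w s) (T u s') - g (T u s) (T w s')
  /\ (* {1} *)
  g (Rm w u s) z = g (dT w u s) z - g (dT u w s) z
  /\ (* {1'} *)
  g (Rm x u s) w =
    g (Rtop x u s) w - g (T u s) (O x w) + g (O x s) (T u w)
  /\ (* {2} *)
  g (Rm x u s) z =
    g (dT x u s) z - g (dA u x s) z - g (O (O x u) s) z - g (T u x) (T s z)
  /\ (* {2'} *)
  g (Rm x y s) w =
    g (Rtop x y s) w - g (O y s) (O x w) + g (O x s) (O y w)
  /\ (* {3} *)
  g (Rm x y s) z =
    g (dA x y s) z - g (dA y x s) z - g (O y x) (T s z) + g (O x y) (T s z)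
  /\ (* {4} *)
  g (Rm x y z) z' =
    g (Rbot x y z) z' + g (O x z) (O y z') - g (O y z) (O x z').
Proof.
move=> g Rm Rtop Rbot bT bA T O dT dA.
pose z0 : 'rV[R]_m * 'rV[R]_m := (cmap (chart_at p) p, v).
have cp : cdom (chart_at p) p by exact: cdom_chart_at.
have sp : sdom sigma p p by split; exact: cdom_chart_at.
have z0E : (cmap (chart_at p) p, tcoord (chart_at p) v) = z0 by rewrite tcoord_chart_at.
have Oz : sdomain A sigma p z0 by rewrite -z0E; exact: sdomain_pair.
have oO : open (sdomain A sigma p) by exact: open_sdomain Hsub p.
have HL := fs_total Hsub; have oA := pf_open HL; have Hac := lcc_connection Hlcc.
pose Gi := christoffel_mx nab p; pose P := vertical_mx L sigma p.
have sG k : smooth_on (sdomain A sigma p) (Gi k).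
  by move=> d; apply: Ck_sub (smooth_christoffel_mx oA Hac p k d); exact: sdomain_sub.
have sP : smooth_on (sdomain A sigma p) P := smooth_vertical_mx Hsub Hnd p.
have sS := smooth_submersion_mx Hsub p.
have PS t : sdomain A sigma p t -> P t *m submersion_mx sigma p t = 0 by exact: (vertical_mx_submersion_mx Hsub Hnd).
have SP t (e : 'rV[R]_m) : sdomain A sigma p t -> e *m submersion_mx sigma p t = 0 -> e *m P t = e.
  by move=> _; exact: vertical_mx_id.
have PP := vertical_idem PS SP.
have sQ : smooth_on (sdomain A sigma p) (fun z => 1%:M - P z).
  by move=> k; exact: (CkB oO (Ck_cst _ _ _) (sP k)).
have QQ t : sdomain A sigma p t -> (1%:M - P t) *m (1%:M - P t) = 1%:M - P t.
  by move=> Oz'; rewrite mulmxBr mulmx1 mulmxBl mul1mx PP // subrr subr0.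
have vE (a : tangent p) : vertical sigma a -> (a : 'rV[R]_m) *m P z0 = a.
  move=> /(verticalE Hsub _ sp Hv); rewrite z0E tcoord_chart_at; exact: SP.
have hE (a : tangent p) : ghorizontal L sigma v a -> (a : 'rV[R]_m) *m P z0 = 0.
  by move=> /(ghorizontalE Hsub Hnd _ sp Hv); rewrite z0E tcoord_chart_at.
have MPG : P z0 *m metric_mx L p z0 = metric_mx L p z0 *m (P z0)^T by exact: (vertical_mx_selfadjoint Hsub Oz).
have sM : smooth_on (sdomain A sigma p) (metric_mx L p).
  by move=> k; apply: Ck_sub (smooth_metric_mx HL p k); exact: sdomain_sub.
have DG (h : 'rV[R]_m) : covm Gi h P z0 *m metric_mx L p z0 =
    metric_mx L p z0 *m (covm Gi h P z0)^T.
  apply: (covm_selfadjoint oO sP sM _ Oz) => [t Oz'|]; first exact: (vertical_mx_selfadjoint Hsub Oz').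
  exact: (hder_metric Hsub Hlcc Hv).
have pt := @oneill_pointwise R m (metric_mx L p z0) (P z0) (fun e => covm Gi e P z0)
  (fun e => christoffel Gi e z0) (fun e h => curvm Gi e h z0)
  (fun e h => covm Gi e (chi Gi P h) z0) (PP _ Oz) (covm_linear Gi P z0)
  (fun h => covm_idem Gi oO sP PP h Oz) MPG DG.
have SF t a : sdomain A sigma p t -> 'd (submersion_mx sigma p) t (0, a) = 0.
  exact: (diff_submersion_mx_fiber Hsub).
have SS t a b : sdomain A sigma p t -> a *m 'd (submersion_mx sigma p) t (b, 0) = b *m 'd (submersion_mx sigma p) t (a, 0).
  exact: (diff_submersion_mx_sym Hsub).
have {}pt := pt (fun u w => covm_vertical_sym oO sP sS PS SP SF SS Oz (christoffel_sym sigma Hlcc Hv u w)).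
have {}pt := pt (fun u w => christoffel_sym sigma Hlcc Hv u w).
have {}pt := pt (fun e h s sPs => chi_ricci oO sG sP PP e h Oz sPs
  (fun a => vertical_fiber_deriv oO sP sS PS SP SF a Oz)).
have {}pt := pt _ _ _ _ _ _ _ _ (vE _ Hs') (vE _ Hs) (vE _ Hu) (vE _ Hw)
  (hE _ Hx) (hE _ Hy) (hE _ Hz) (hE _ Hz').
have gE a b : g a b = gform (metric_mx L p z0) a b by exact: (fundamental_gform Hsub Hv).
have RmE e h b : Rm e h b = (b : 'rV[R]_m) *m curvm Gi e h z0 by exact: (curvE Hsub Hlcc Hv).
have TE b e : T b e = (e : 'rV[R]_m) *m chi Gi P ((b : 'rV[R]_m) *m P z0) z0.
  apply: etrans (esym (tcoord_chart_at _)) _.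
  have := tcoord_oneill_chi Hsub Hlcc Hnd (vpart L sigma v b) e sp Hv.
  rewrite (tcoord_vpart Hsub Hnd _ sp Hv) z0E (tcoord_chart_at e) (tcoord_chart_at b).
  exact.
have OE b e : O b e = (e : 'rV[R]_m) *m chi Gi P ((b : 'rV[R]_m) *m (1%:M - P z0)) z0.
  apply: etrans (esym (tcoord_chart_at _)) _.
  have := tcoord_oneill_chi Hsub Hlcc Hnd (hpart L sigma v b) e sp Hv.
  rewrite (tcoord_hpart Hsub Hnd _ sp Hv) z0E (tcoord_chart_at e) (tcoord_chart_at b).
  exact.
have compl e : covm Gi e (fun z => 1%:M - P z) z0 = - covm Gi e P z0 by exact: (covm_compl nab Hsub Hnd).
have dTE e b h : dT e b h = (h : 'rV[R]_m) *m (covm Gi e (chi Gi P ((b : 'rV[R]_m) *m P z0)) z0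
    + chi Gi P ((b : 'rV[R]_m) *m covm Gi e P z0 - (b : 'rV[R]_m) *m P z0 *m christoffel Gi e z0) z0).
  apply: (nabla_tensorE Hsub Hlcc Hnd Hv e b h sP) => q t b' h' sq At.
  by have := tcoord_oneill_chi Hsub Hlcc Hnd (vpart L sigma t b') h' sq At;
    rewrite (tcoord_vpart Hsub Hnd _ sq At).
have dAE e b h : dA e b h = (h : 'rV[R]_m) *m
    (covm Gi e (chi Gi P ((b : 'rV[R]_m) *m (1%:M - P z0))) z0
    + chi Gi P (- ((b : 'rV[R]_m) *m covm Gi e P z0)
        - (b : 'rV[R]_m) *m (1%:M - P z0) *m christoffel Gi e z0) z0).
  (* The sign comes from nabla (1 - P) = - nabla P. *)
  rewrite -mulmxN -compl.
  apply: (nabla_tensorE Hsub Hlcc Hnd Hv e b h sQ) => q t b' h' sq At.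
  by have := tcoord_oneill_chi Hsub Hlcc Hnd (hpart L sigma t b') h' sq At;
    rewrite (tcoord_hpart Hsub Hnd _ sq At).
have RtopE e h b : (b : 'rV[R]_m) *m P z0 = b -> Rtop e h b =
    (b : 'rV[R]_m) *m curvm Gi e h z0 *m P z0
    + (b : 'rV[R]_m) *m (covm Gi h P z0 *m covm Gi e P z0 - covm Gi e P z0 *m covm Gi h P z0).
  move=> bP; apply: etrans (projected_curvature oO sG sP PP e h Oz bP).
  apply: (proj_curvE Hsub Hlcc Hv e h b sP) => X t Ot.
  exact: (hat_vtop Hsub Hnd).
have RbotE e h b : (b : 'rV[R]_m) *m P z0 = 0 -> Rbot e h b =
    (b : 'rV[R]_m) *m curvm Gi e h z0 *m (1%:M - P z0)
    + (b : 'rV[R]_m) *m (covm Gi h P z0 *m covm Gi e P z0 - covm Gi e P z0 *m covm Gi h P z0).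
  move=> bP; have bQ : (b : 'rV[R]_m) *m (1%:M - P z0) = b by rewrite mulmxBr mulmx1 bP subr0.
  (* The same lemma applied to the projection 1 - P; its derivatives enter in products of two, so
     their signs cancel and the correction has the form found for P. *)
  have := projected_curvature oO sG sQ QQ e h Oz bQ.
  rewrite !compl !mulNmx !mulmxN !opprK; apply: etrans.
  apply: (proj_curvE Hsub Hlcc Hv e h b sQ) => X t Ot.
  exact: (hat_hbot Hsub Hnd).
clearbody g Rm Rtop Rbot T O dT dA.
rewrite !gE !RmE !dTE !dAE !OE !TE !(RtopE _ _ _ (vE _ Hs)) (RbotE _ _ _ (hE _ Hz)).
case: pt => e0 e1 e1' [e2 e2' e3 e4].
split; first exact: e0.
split; first exact: e1.
split; first exact: e1'.
split; first exact: e2.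
split; first exact: e2'.
split; first exact: e3.
exact: e4.
Qed.
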